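(* Let $(M^{4n},I,J,K,g)$ be an HKT-manifold of real dimension $4n$, with forms $$\omega_I(X,Y)=g(X,Y\circ I),\qquad \Omega(X,Y)=-\bigl(g(X,Y\circ J)-\sqrt{-1}\,g(X,Y\circ K)\bigr).$$ Assume that a nowhere vanishing holomorphic (with respect to $I$), q-real and q-positive form $\Theta\in\Lambda^{2n,0}_I(M)$ is given, and let $\Phi=V(1)\in\Lambda^{n,n}_I(M)$, i.e. $\Phi$ is the form determined by $\Phi\wedge\xi=R(\xi)\wedge\overline{\Theta}$ for all $\xi\in\Lambda^{n,n}_I(M)$. Let $f,\phi$ be real-valued smooth functions on $M$. Then the quaternionic Monge-Ampère equation $$(\Omega+\partial\partial_J\phi)^n=e^f\,\Omega^n$$ is equivalent to the equation $$(\omega_I-\sqrt{-1}\,\partial\bar\partial\phi)^n\wedge\Phi=e^f\,\omega_I^n\wedge\Phi .$$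
   Context: A hypercomplex manifold is a smooth manifold $M$ with (integrable) complex structures $I,J,K$ satisfying $IJ=-JI=K$, acting on the right on $TM$, so that $(X\circ I)\circ J=X\circ K$. $\Lambda^{p,q}_I(M)$ denotes the complex-valued $(p,q)$-forms on $(M,I)$ (so a $(1,0)$-form satisfies $\eta(X\circ I)=\sqrt{-1}\,\eta(X)$), and $\partial,\bar\partial$ its Dolbeault differentials. $J$ acts on 1-forms by $(J\eta)(X)=\eta(X\circ J)$ and on all forms multiplicatively. Put $\partial_J:=J^{-1}\circ\bar\partial\circ J$ on $(p,0)$-forms; on functions $\partial_J\phi=J^{-1}(\bar\partial\phi)$. A quaternionic Hermitian metric is a Riemannian metric $g$ invariant under the group $SU(2)$ of unit quaternions acting on $TM$; it is HKT if $\partial\Omega=0$. A form $\lambda\in\Lambda^{2p,0}_I(M)$ is q-real if $J\bar\lambda=\lambda$. A q-real $(2,0)$-form $\eta$ is q-positive if $\eta(X,X\circ J)\ge0$ for all real $X$. The strongly q-positive cone of $(2p,0)$-forms is generated, with non-negative coefficients, by products of q-positive $(2,0)$-forms; for $(2n,0)$-forms strong and weak q-positivity coincide (called q-positivity). The operator $R$. For $r\le 2n$ let $\Lambda^r_+(M)\subset\Lambda^r(M)$ be the maximal $SU(2)$-subrepresentation of weight $r$, $\Lambda^r_+(M)=0$ for $r>2n$, $P_+$ the $SU(2)$-equivariant projection $\Lambda^r(M)\to\Lambda^r_+(M)$, and $\Lambda^{p,q}_{I,+}(M)$ the $(p,q)$-part of $\Lambda^{p+q}_+(M)$. There is an isomorphism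 $\Lambda^{p+q,0}_I(M)\cong\Lambda^{p,q}_{I,+}(M)$, sending $\alpha_1\wedge\dots\wedge\alpha_{p+q}$ ($\alpha_i$ of type $(1,0)$) to the average, over all $q$-element subsets $S$ of $\{1,\dots,p+q\}$, of the wedge products obtained by replacing $\alpha_i$ by $J\alpha_i$ for $i\in S$. Then $R:\Lambda^{p,q}_I(M)\to\Lambda^{p+q,0}_I(M)$ is $P_+$ followed by the inverse of this isomorphism. Equivalently, $R$ is the multiplicative map which is the identity on $\Lambda^{1,0}_I(M)$ and $J^{-1}$ on $\Lambda^{0,1}_I(M)$. The operator $V:\Lambda^{2p,0}_I(M)\to\Lambda^{n+p,n+p}_I(M)$ is defined by $V(\eta)\wedge\xi=\eta\wedge R(\xi)\wedge\overline{\Theta}$ for all $\xi\in\Lambda^{n-p,n-p}_I(M)$. *)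

(* Defs.v *)
From HB Require Import structures.
From mathcomp Require Import all_boot all_order all_fingroup all_algebra.
From mathcomp Require Import complex.
From mathcomp Require Import all_classical all_reals all_analysis.

Set Implicit Arguments.
Unset Strict Implicit.
Unset Printing Implicit Defensive.

Import Order.TTheory GRing.Theory Num.Theory.
Import numFieldNormedType.Exports.

Local Open Scope classical_set_scope.
Local Open Scope ring_scope.
Local Open Scope complex_scope.

(* Row vectors are tangent vectors and matrices act on them on the right, as   *)
(* the complex structures act on the tangent bundle. In local coordinates all  *)
(* tensors are expressed in the coordinate frame of a chart.                   *)

Fixpoint Ck (R : realType) (m : nat) (k : nat) (U : set 'rV[R]_m)
    (f : 'rV[R]_m -> R) : Prop :=
  match k with
  | 0%N => forall x, U x -> {for x, continuous f}
  | k'.+1 => (forall x, U x -> differentiable f x) /\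
             (forall v, Ck k' U (fun x => 'D_v f x))
  end.

Definition smooth (R : realType) (m : nat) (U : set 'rV[R]_m)
  (f : 'rV[R]_m -> R) : Prop := forall k, Ck k U f.

Definition smoothC (R : realType) (m : nat) (U : set 'rV[R]_m)
    (f : 'rV[R]_m -> R[i]) : Prop :=
  smooth U (fun x => complex.Re (f x)) /\ smooth U (fun x => complex.Im (f x)).

Definition smooth_mx (R : realType) (m p q : nat) (U : set 'rV[R]_m)
    (A : 'rV[R]_m -> 'M[R]_(p, q)) : Prop :=
  forall i j, smooth U (fun x => A x i j).

Record manifold (R : realType) (m : nat) := Manifold {
  carrier :> topologicalType;
  chart : Type;
  dom : chart -> set carrier;
  coord : chart -> carrier -> 'rV[R]_m;
  param : chart -> 'rV[R]_m -> carrier;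
  manifold_hausdorff : hausdorff_space carrier;
  manifold_second_countable : @second_countable carrier;
  dom_open : forall c, open (dom c);
  dom_cover : forall p, exists c, dom c p;
  coordK : forall c p, dom c p -> param c (coord c p) = p;
  coord_open : forall c, open (coord c @` dom c);
  coord_continuous : forall c, {within dom c, continuous (coord c)};
  param_continuous : forall c,
    {within coord c @` dom c, continuous (param c)};
  transition_smooth : forall c d,
    smooth_mx (coord c @` (dom c `&` dom d)) (coord d \o param c) }.

Section Tensors.
Context {R : realType} {m : nat}.
Implicit Types (M : manifold R m) (x : 'rV[R]_m).
Local Notation C := R[i].

Definition cdom M (c : chart M) : set 'rV[R]_m := coord c @` dom c.

Definition overlap M (c d : chart M) : set 'rV[R]_m :=
  coord c @` (dom c `&` dom d).

Definition transition M (c d : chart M) : 'rV[R]_m -> 'rV[R]_m :=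
  coord d \o param c.

Definition smooth_fun M (f : M -> R) : Prop :=
  forall c : chart M, smooth (cdom c) (f \o param c).

(* A tensor field is given by its expression in every chart; only the values  *)
(* at points x of [cdom c] are meaningful.                                     *)
Definition field M (T : Type) : Type := chart M -> 'rV[R]_m -> T.

Definition endo_field M (A : field M 'M[R]_m) : Prop :=
  (forall c, smooth_mx (cdom c) (A c)) /\
  (forall c d x, overlap c d x ->
     A c x *m jacobian (transition c d) x =
     jacobian (transition c d) x *m A d (transition c d x)).

Definition riemannian M (g : field M 'M[R]_m) : Prop :=
  [/\ forall c, smooth_mx (cdom c) (g c),
      forall c d x, overlap c d x ->
        g c x = jacobian (transition c d) x *m g d (transition c d x)
                *m (jacobian (transition c d) x)^T,
      forall c x, cdom c x -> (g c x)^T = g c x &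
      forall c x (v : 'rV[R]_m), cdom c x -> v != 0 ->
        0 < (v *m g c x *m v^T) 0 0].

Definition bracket (X Y : 'rV[R]_m -> 'rV[R]_m) x : 'rV[R]_m :=
  'D_(X x) Y x - 'D_(Y x) X x.

(* Integrability is the vanishing of the Nijenhuis tensor; A x *m A x = - 1%:M *)
(* is used to write - [X, Y] for the last term.                                *)
Definition nijenhuis (A : 'rV[R]_m -> 'M[R]_m) (X Y : 'rV[R]_m -> 'rV[R]_m) x :
    'rV[R]_m :=
  let AX := fun y => X y *m A y in
  let AY := fun y => Y y *m A y in
  bracket AX AY x - bracket AX Y x *m A x - bracket X AY x *m A x
  - bracket X Y x.

Definition complex_structure M (A : field M 'M[R]_m) : Prop :=
  [/\ endo_field A,
      forall c x, cdom c x -> A c x *m A c x = - 1%:M &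
      forall c (X Y : 'rV[R]_m -> 'rV[R]_m),
        smooth_mx (cdom c) X -> smooth_mx (cdom c) Y ->
        forall x, cdom c x -> nijenhuis (A c) X Y x = 0].

Definition hypercomplex M (I J K : field M 'M[R]_m) : Prop :=
  [/\ complex_structure I, complex_structure J, complex_structure K &
      forall c x, cdom c x ->
        I c x *m J c x = K c x /\ J c x *m I c x = - K c x].

Definition quat (I J K : 'M[R]_m) (a b c d : R) : 'M[R]_m :=
  a%:M + b *: I + c *: J + d *: K.

Definition unit_quat (a b c d : R) : Prop :=
  a ^+ 2 + b ^+ 2 + c ^+ 2 + d ^+ 2 = 1.

Definition quaternionic_hermitian M (I J K g : field M 'M[R]_m) : Prop :=
  riemannian g /\
  forall c x a b s t (X Y : 'rV[R]_m), cdom c x -> unit_quat a b s t ->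
    let Q := quat (I c x) (J c x) (K c x) a b s t in
    (X *m Q) *m g c x *m (Y *m Q)^T = X *m g c x *m Y^T.

(* A k-covector takes as argument the k x m matrix whose rows are k
   complexified tangent vectors. *)

Definition cmx p q (A : 'M[R]_(p, q)) : 'M[C]_(p, q) :=
  map_mx (real_complex R) A.

Definition conjmx p q (A : 'M[C]_(p, q)) : 'M[C]_(p, q) := map_mx conjc A.

Definition cov (k : nat) : Type := 'M[C]_(k, m) -> C.

Definition multilinear k (al : cov k) : Prop :=
  forall (i : 'I_k) (u v w : 'M[C]_(k, m)) (a b : C),
    row i u = a *: row i v + b *: row i w ->
    row' i v = row' i u -> row' i w = row' i u ->
    al u = a * al v + b * al w.

Definition alternating k (al : cov k) : Prop :=
  forall (v : 'M[C]_(k, m)) (i j : 'I_k), i != j -> row i v = row j v ->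
    al v = 0.

Definition is_cov k (al : cov k) : Prop := multilinear al /\ alternating al.

Definition wedge k l (al : cov k) (be : cov l) : cov (k + l) := fun v =>
  (k`! * l`!)%:R^-1 *
  \sum_(s : 'S_(k + l))
     (-1) ^+ s * al (usubmx (row_perm s v)) * be (dsubmx (row_perm s v)).

Fixpoint wedge_prod (eta : nat -> cov 2) (n : nat) : cov (n * 2) :=
  match n with
  | 0%N => fun=> 1
  | n'.+1 => wedge (eta n') (@wedge_prod eta n')
  end.
Arguments wedge_prod : clear implicits.

Definition pullback (A : 'M[C]_m) k (al : cov k) : cov k :=
  fun v => al (v *m A).

Definition conj_cov k (al : cov k) : cov k := fun v => conjc (al (conjmx v)).

Definition act_rows k (S : {set 'I_k}) (A B : 'M[C]_m) (v : 'M[C]_(k, m)) :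
    'M[C]_(k, m) :=
  \matrix_(i < k) (row i v *m (if i \in S then A else B)).

(* T^{1,0} consists of the complexified vectors Z with Z *m I = 'i *: Z        *)
Definition pi10 (I : 'M[R]_m) : 'M[C]_m := 2^-1 *: (1%:M - 'i%C *: cmx I).
Definition pi01 (I : 'M[R]_m) : 'M[C]_m := 2^-1 *: (1%:M + 'i%C *: cmx I).

(* the (p,q)-component; it vanishes if p + q <> k *)
Definition pq_part (I : 'M[R]_m) (p q k : nat) (al : cov k) : cov k := fun v =>
  \sum_(S : {set 'I_k} | (#|~: S| == p) && (#|S| == q))
     al (act_rows S (pi01 I) (pi10 I) v).

Definition is_pq (I : 'M[R]_m) (p q k : nat) (al : cov k) : Prop :=
  is_cov al /\ pq_part I p q al = al.

Definition qreal_cov (J : 'M[R]_m) k (al : cov k) : Prop :=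
  pullback (cmx J) (conj_cov al) = al.

Definition qpositive20 (I J : 'M[R]_m) (eta : cov 2) : Prop :=
  [/\ is_pq I 2 0 eta, qreal_cov J eta &
      forall X : 'rV[R]_m, 0 <= eta (col_mx (cmx X) (cmx (X *m J)))].

(* For (2n,0)-covectors strong and weak q-positivity coincide; this is the     *)
(* strong cone. Only eta i 0, ..., eta i (n-1) occur in the i-th product.      *)
Definition qpositive_cov (I J : 'M[R]_m) (n : nat) (th : cov (n * 2)) : Prop :=
  exists (N : nat) (a : 'I_N -> R) (eta : 'I_N -> nat -> cov 2),
    [/\ forall i, 0 <= a i, forall i j, qpositive20 I J (eta i j) &
        forall v, th v = \sum_(i < N) (a i)%:C * wedge_prod (eta i) n v].

(* The irreducible SU(2)-representation of weight r is Sym^r(C^2), where the  *)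
(* unit quaternion a + bI + cJ + dK acts on C^2 = <x, y> by                    *)
(*   x |-> z x + u y,  y |-> - u^* x + z^* y,  z = a + ib, u = c - id,         *)
(* which is its action on <alpha, J alpha> for a (1,0)-covector alpha.         *)
(* [sym_coef] is the coefficient of x^(r-j) y^j in the image of x^(r-k) y^k.   *)
Definition sym_coef (r : nat) (z u : C) (k j : nat) : C :=
  ((z%:P + u *: 'X) ^+ (r - k) * (- (conjc u)%:P + conjc z *: 'X) ^+ k)`_j.

(* t is the family of images of the basis (x^(r-k) y^k)_k under a linear       *)
(* SU(2)-equivariant map from Sym^r(C^2) to the r-covectors.                   *)
Definition sym_family (I J K : 'M[R]_m) (r : nat) (t : 'I_r.+1 -> cov r) :
    Prop :=
  (forall k, is_cov (t k)) /\
  forall a b c d, unit_quat a b c d ->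
  forall k v, pullback (cmx (quat I J K a b c d)) (t k) v =
    \sum_(j < r.+1) sym_coef r (a +i* b) (c -i* d) k j * t j v.

(* the sum of all SU(2)-subrepresentations isomorphic to Sym^r(C^2) *)
Definition Lambda_plus (I J K : 'M[R]_m) (r : nat) (al : cov r) : Prop :=
  exists (N : nat) (t : 'I_N -> 'I_r.+1 -> cov r) (a : 'I_N -> 'I_r.+1 -> C),
    (forall i, sym_family I J K (t i)) /\
    (forall v, al v = \sum_(i < N) \sum_(k < r.+1) a i k * t i k v).

Definition equivariant_projection (I J K : 'M[R]_m) (r : nat)
    (P : cov r -> cov r) : Prop :=
  [/\ forall (a : C) (al be : cov r), is_cov al -> is_cov be ->
        P (fun v => a * al v + be v) = (fun v => a * P al v + P be v),
      forall a b c d (al : cov r), unit_quat a b c d -> is_cov al ->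
        P (pullback (cmx (quat I J K a b c d)) al) =
        pullback (cmx (quat I J K a b c d)) (P al),
      forall al, is_cov al -> Lambda_plus I J K (P al) &
      forall al, Lambda_plus I J K al -> P al = al].

(* An equivariant projection onto Lambda_plus exists and is unique on          *)
(* covectors, so [xget] selects it there.                                      *)
Definition P_plus (I J K : 'M[R]_m) (r : nat) : cov r -> cov r :=
  @xget (cov r -> cov r) id [set P | equivariant_projection I J K P].

(* The isomorphism from (r,0)-covectors to (r-q,q)-covectors of Lambda_plus.   *)
(* Applying J to the arguments in all q-element sets of positions amounts, on  *)
(* a product of (1,0)-covectors, to applying J to all q-element sets of        *)
(* factors.                                                                    *)
Definition plus_iso (J : 'M[R]_m) (q r : nat) (rho : cov r) : cov r := fun v =>
  'C(r, q)%:R^-1 *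
  \sum_(S : {set 'I_r} | #|S| == q) rho (act_rows S (cmx J) 1%:M v).

(* R on covectors of degree r and type (r-q,q) *)
Definition Rop (I J K : 'M[R]_m) (q r : nat) (xi : cov r) : cov r :=
  @xget (cov r) (fun=> 0)
    [set rho | is_pq I r 0 rho /\ plus_iso J q rho = P_plus I J K xi].

Definition dform M (k : nat) : Type := field M (cov k).

Definition is_form M k (al : dform M k) : Prop :=
  [/\ forall c x, cdom c x -> is_cov (al c x),
      forall c v, smoothC (cdom c) (fun x => al c x v) &
      forall c d x, overlap c d x ->
        al c x = pullback (cmx (jacobian (transition c d) x))
                          (al d (transition c d x))].

Definition form_eq M k (al be : dform M k) : Prop :=
  forall c x, cdom c x -> al c x = be c x.

Definition Lambda M (I : field M 'M[R]_m) (p q k : nat) (al : dform M k) :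
    Prop :=
  is_form al /\ forall c x, cdom c x -> is_pq (I c x) p q (al c x).

Definition fun_form M (f : M -> R) : dform M 0 :=
  fun c x _ => (f (param c x))%:C.

Definition add_form M k (al be : dform M k) : dform M k :=
  fun c x v => al c x v + be c x v.

Definition scale_form M k (h : M -> C) (al : dform M k) : dform M k :=
  fun c x v => h (param c x) * al c x v.

Definition wedge_form M k l (al : dform M k) (be : dform M l) :
    dform M (k + l) := fun c x => wedge (al c x) (be c x).

Definition pow_form M (al : dform M 2) (n : nat) : dform M (n * 2) :=
  fun c x => wedge_prod (fun=> al c x) n.

Definition conj_form M k (al : dform M k) : dform M k :=
  fun c x => conj_cov (al c x).

Definition deriveC (f : 'rV[R]_m -> C) x (w : 'rV[C]_m) : C :=
  let D (v : 'rV[R]_m) : C :=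
    'D_v (fun y => complex.Re (f y)) x +i* 'D_v (fun y => complex.Im (f y)) x in
  D (map_mx (@complex.Re R) w) + 'i%C * D (map_mx (@complex.Im R) w).

Definition ext_d M k (al : dform M k) : dform M k.+1 := fun c x v =>
  \sum_(i < k.+1)
     (-1) ^+ i * deriveC (fun y => al c y (row' i v)) x (row i v).

(* del and delbar are applied to (p,q)-forms; p and q are not determined by al *)
Definition del M (I : field M 'M[R]_m) (p q k : nat) (al : dform M k) :
    dform M k.+1 := fun c x => pq_part (I c x) p.+1 q (ext_d al c x).

Definition delbar M (I : field M 'M[R]_m) (p q k : nat) (al : dform M k) :
    dform M k.+1 := fun c x => pq_part (I c x) p q.+1 (ext_d al c x).

Definition act_form M (A : field M 'M[R]_m) k (al : dform M k) : dform M k :=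
  fun c x => pullback (cmx (A c x)) (al c x).

Definition inv_field M (A : field M 'M[R]_m) : field M 'M[R]_m :=
  fun c x => invmx (A c x).

(* J maps (p,0)-forms to (0,p)-forms *)
Definition delJ M (I J : field M 'M[R]_m) (p k : nat) (al : dform M k) :
    dform M k.+1 := act_form (inv_field J) (delbar I 0 p (act_form J al)).

Definition ddJ M (I J : field M 'M[R]_m) (phi : M -> R) : dform M 2 :=
  del I 1 0 (delJ I J 0 (fun_form phi)).

Definition ddbar M (I : field M 'M[R]_m) (phi : M -> R) : dform M 2 :=
  del I 0 1 (delbar I 0 0 (fun_form phi)).

Definition holomorphic M (I : field M 'M[R]_m) (p k : nat) (al : dform M k) :
    Prop :=
  Lambda I p 0 al /\ form_eq (delbar I p 0 al) (fun _ _ _ => 0).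

Definition nowhere_vanishing M k (al : dform M k) : Prop :=
  forall c x, cdom c x -> al c x <> (fun=> 0).

Definition qreal M (J : field M 'M[R]_m) k (al : dform M k) : Prop :=
  form_eq (act_form J (conj_form al)) al.

Definition qpositive M (I J : field M 'M[R]_m) n (al : dform M (n * 2)) :
    Prop :=
  forall c x, cdom c x -> qpositive_cov (I c x) (J c x) (al c x).

Definition R_form M (I J K : field M 'M[R]_m) (q k : nat) (al : dform M k) :
    dform M k := fun c x => Rop (I c x) (J c x) (K c x) q (al c x).

Definition gC (g : 'M[R]_m) (X Y : 'rV[C]_m) : C := (X *m cmx g *m Y^T) 0 0.

Definition omegaI M (I g : field M 'M[R]_m) : dform M 2 := fun c x v =>
  gC (g c x) (row ord0 v) (row ord_max v *m cmx (I c x)).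

Definition Omega M (J K g : field M 'M[R]_m) : dform M 2 := fun c x v =>
  - (gC (g c x) (row ord0 v) (row ord_max v *m cmx (J c x))
     - 'i%C * gC (g c x) (row ord0 v) (row ord_max v *m cmx (K c x))).

Definition hkt M (I J K g : field M 'M[R]_m) : Prop :=
  [/\ hypercomplex I J K, quaternionic_hermitian I J K g &
      form_eq (del I 2 0 (Omega J K g)) (fun _ _ _ => 0)].

End Tensors.

Arguments wedge_prod {R m} eta n.
Arguments pow_form {R m M} al n.

(* Main.v *)
(* Write A = pi10 (1 - J), as a matrix acting on tangent vectors. Pulling back   *)
(* by A is the multiplicative extension of the identity on (1,0)-covectors and   *)
(* J^-1 on (0,1)-covectors, and the operator R is this pullback: an equivariant  *)
(* projection onto Lambda_+ commutes with the projection to (r,0)-covectors      *)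
(* (obtained by averaging over unit quaternions in R + R I), and an element of   *)
(* Lambda_+ is determined by the (r,0)-parts of its SU(2)-translates. As a       *)
(* pullback commutes with wedge products, R((omega_I - i d dbar phi)^n) is the   *)
(* n-th power of R(omega_I - i d dbar phi), and R maps omega_I to -i Omega and   *)
(* d dbar phi to d d_J phi; the latter rests on the vanishing of the Nijenhuis   *)
(* tensors of I and J. The second equation thus becomes the first one wedged     *)
(* with the conjugate of Theta, which can be cancelled because (2n,0)-covectors  *)
(* and (0,2n)-covectors form lines that pair nontrivially.                       *)

From HB Require Import structures.
From mathcomp Require Import all_boot all_order all_fingroup all_algebra.
From mathcomp Require Import complex ring lra.
From mathcomp Require Import all_classical all_reals all_analysis.
Require Import Defs.

Set Implicit Arguments.
Unset Strict Implicit.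
Unset Printing Implicit Defensive.

Import Order.TTheory GRing.Theory Num.Theory.
Import numFieldNormedType.Exports.

Local Open Scope ring_scope.
Local Open Scope complex_scope.

(** * Multilinear and alternating covectors *)

Section Multilinear.
Context {R : realType} {m : nat}.
Local Notation C := R[i].
Implicit Types (k : nat).

Definition rows k (r : 'I_k -> 'rV[C]_m) : 'M[C]_(k, m) :=
  \matrix_(i < k) r i.

Lemma row_rows k (r : 'I_k -> 'rV[C]_m) i : row i (rows r) = r i.
Proof. exact: rowK. Qed.

Lemma rows_row k (v : 'M[C]_(k, m)) : rows (fun i => row i v) = v.
Proof. by apply/row_matrixP => i; rewrite row_rows. Qed.

Definition upd k (r : 'I_k -> 'rV[C]_m) i0 x := 
  fun i : 'I_k => if i == i0 then x else r i.

Lemma multilinear_upd k (al : cov k) r (i : 'I_k) (a b : C) x y :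
  multilinear al ->
  al (rows (upd r i (a *: x + b *: y))) =
  a * al (rows (upd r i x)) + b * al (rows (upd r i y)).
Proof.
move=> mal; apply: (mal i); first by rewrite !row_rows /upd eqxx.
  by apply/matrixP => p q; rewrite !mxE /upd eq_sym (negPf (neq_lift _ _)).
by apply/matrixP => p q; rewrite !mxE /upd eq_sym (negPf (neq_lift _ _)).
Qed.

Lemma multilinear_upd_sum k (al : cov k) r (i : 'I_k) (J : finType) 
    (a : J -> C) (x : J -> 'rV[C]_m) :
  multilinear al ->
  al (rows (upd r i (\sum_j a j *: x j))) =
  \sum_j a j * al (rows (upd r i (x j))).
Proof.
move=> mal; set f := fun x => al (rows (upd r i x)).
have fD b y z : f (b *: y + z) = b * f y + f z.
  by rewrite -[z in LHS]scale1r /f multilinear_upd // mul1r.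
have f0 : f 0 = 0.
  by have := fD (-1) 0 0; rewrite scaler0 addr0 mulN1r addNr.
rewrite -/(f _); elim/big_rec2: _ => [//|j y z _ IH].
by rewrite fD -/(f _) IH.
Qed.

Definition coordform k (c : {ffun 'I_k -> 'I_m} -> C) : cov k := fun v =>
  \sum_(g : {ffun 'I_k -> 'I_m}) c g * \prod_i v i (g i).

Lemma coordform_multilinear k (c : {ffun 'I_k -> 'I_m} -> C) :
  multilinear (coordform c).
Proof.
move=> i u v w a b Eu Ev Ew; rewrite /coordform !mulr_sumr -big_split /=.
apply: eq_bigr => g _.
have bD (z : 'M[C]_(k, m)) : \prod_j z j (g j) =
    z i (g i) * \prod_(j | j != i) z j (g j) by rewrite (bigD1 i).
rewrite !{}bD.
have -> : u i (g i) = a * v i (g i) + b * w i (g i).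
  by move/rowP: Eu => /(_ (g i)); rewrite !mxE.
have E z : row' i z = row' i u ->
   \prod_(j < k | j != i) z j (g j) = \prod_(j < k | j != i) u j (g j).
  by move=> /row'_eq Ez; apply: eq_bigr => j ji; rewrite Ez.
by rewrite (E v) // (E w) //; ring.
Qed.

Lemma multilinear_eq_basis k (al be : @cov R m k) :
  multilinear al -> multilinear be ->
  (forall g : {ffun 'I_k -> 'I_m},
     al (rows (fun i => delta_mx 0 (g i))) =
     be (rows (fun i => delta_mx 0 (g i)))) ->
  al = be.
Proof.
move=> mal mbe E; apply/funext => v.
have H t : (t <= k)%N -> forall r : 'I_k -> 'rV[C]_m,
    (forall i : 'I_k, (t <= i)%N -> exists j, r i = delta_mx 0 j) ->
  al (rows r) = be (rows r).
  elim: t => [_ r /(_ _ isT) Hr|t IH tk r Hr].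
    have [g Hg] := choice Hr.
    have -> : r = (fun i => delta_mx 0 ([ffun i => g i] i)).
      by apply/funext => i; rewrite ffunE.
    exact: E.
  pose i := Ordinal tk.
  have {1 2}-> : r = upd r i (\sum_j r i 0 j *: delta_mx 0 j).
    apply/funext => j; rewrite /upd; case: eqP => // ->.
    exact: row_sum_delta.
  rewrite !multilinear_upd_sum //; apply: eq_bigr => j _; congr (_ * _).
  apply: IH => [|i' ti']; first exact: ltnW.
  rewrite /upd; case: eqP => [_|/eqP i'i]; first by exists j.
  by apply: Hr; rewrite ltn_neqAle ti' andbT eq_sym.
rewrite -(rows_row v); apply: (H k) => // i.
by rewrite leqNgt ltn_ord.
Qed.

Lemma multilinear_coord k (al : @cov R m k) : multilinear al ->
  al = coordform (fun g => al (rows (fun i => delta_mx 0 (g i)))).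
Proof.
move=> mal; apply: multilinear_eq_basis => //.
  exact: coordform_multilinear.
move=> g; rewrite /coordform (bigD1 g) //= big1 ?mulr1 => [|i _]; last first.
  by rewrite !mxE !eqxx.
rewrite big1 ?addr0 // => h hg.
have [i hi] : exists i, h i != g i.
  apply/existsP; apply: contraR hg; rewrite negb_exists => /forallP H.
  by apply/eqP/ffunP => i; apply/eqP; move: (H i); rewrite negbK.
by rewrite (bigD1 i) //= !mxE (negPf hi) andbF mul0r mulr0.
Qed.

Lemma multilinear_sum k (al : @cov R m k) (J : finType)
    (w : 'I_k -> J -> 'rV[C]_m) : multilinear al ->
  al (rows (fun i => \sum_j w i j)) =
  \sum_(f : {ffun 'I_k -> J}) al (rows (fun i => w i (f i))).
Proof.
move=> mal; rewrite (multilinear_coord mal) /coordform [RHS]exchange_big /=.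
apply: eq_bigr => g _; rewrite -mulr_sumr; congr (_ * _).
transitivity (\prod_i \sum_j w i j 0 (g i)).
  by apply: eq_bigr => i _; rewrite !mxE summxE.
rewrite bigA_distr_bigA; apply: eq_bigr => f _.
by apply: eq_bigr => i _; rewrite !mxE.
Qed.

Lemma multilinear_add k (al : @cov R m k) (x y : 'I_k -> 'rV[C]_m) :
  multilinear al ->
  al (rows (fun i => x i + y i)) =
  \sum_(S : {set 'I_k}) al (rows (fun i => if i \in S then x i else y i)).
Proof.
move=> mal; rewrite (multilinear_coord mal) /coordform [RHS]exchange_big /=.
apply: eq_bigr => g _; rewrite -mulr_sumr; congr (_ * _).
under eq_bigr do rewrite !mxE.
rewrite bigA_distr; apply: eq_bigr => S _; apply: eq_bigr => i _.
by rewrite !mxE; case: ifP.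
Qed.

Lemma multilinear_scale k (al : @cov R m k) (c : 'I_k -> C) x :
  multilinear al ->
  al (rows (fun i => c i *: x i)) = \prod_i c i * al (rows x).
Proof.
move=> mal; rewrite (multilinear_coord mal) /coordform mulr_sumr.
apply: eq_bigr => g _; rewrite mulrCA -big_split /=; congr (_ * _).
by apply: eq_bigr => i _; rewrite !mxE.
Qed.

Lemma multilinear_row0 k (al : @cov R m k) v i : multilinear al ->
  row i v = 0 -> al v = 0.
Proof.
move=> mal v0; rewrite (multilinear_coord mal) /coordform big1 // => g _.
rewrite (bigD1 i) //=.
by move/rowP: v0 => /(_ (g i)); rewrite !mxE => ->; rewrite mul0r mulr0.
Qed.

Lemma row'_mul k (v : 'M[C]_(k, m)) (A : 'M[C]_m) i :
  row' i (v *m A) = row' i v *m A.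
Proof.
by apply/matrixP => p q; rewrite !mxE; apply: eq_bigr => l _; rewrite mxE.
Qed.

Lemma multilinear_pullback k (al : @cov R m k) A : multilinear al ->
  multilinear (pullback A al).
Proof.
move=> mal i u v w a b Eu Ev Ew; apply: (mal i).
- by rewrite !row_mul Eu mulmxDl !scalemxAl.
- by rewrite !row'_mul Ev.
- by rewrite !row'_mul Ew.
Qed.

Lemma cov_pullback k (al : @cov R m k) A : is_cov al -> is_cov (pullback A al).
Proof.
move=> [mal aal]; split; first exact: multilinear_pullback.
by move=> v i j ij E; apply: (aal _ i j) => //; rewrite !row_mul E.
Qed.

Lemma multilinear_comb k (al be : @cov R m k) a : multilinear al ->
  multilinear be -> multilinear (fun v => a * al v + be v).
Proof.
move=> mal mbe i u v w b c Eu Ev Ew.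
by rewrite (mal i u v w b c) // (mbe i u v w b c) //; ring.
Qed.

Lemma cov_comb k (al be : @cov R m k) a : is_cov al -> is_cov be ->
  is_cov (fun v => a * al v + be v).
Proof.
move=> [mal aal] [mbe abe]; split; first exact: multilinear_comb.
by move=> v i j ij E; rewrite (aal v i j) // (abe v i j) // mulr0 addr0.
Qed.

Lemma cov0 k : is_cov (fun=> 0 : C) (k := k) (m := m).
Proof. by split=> [i u v w a b _ _ _|//]; rewrite !mulr0 addr0. Qed.

Lemma cov_scale k (al : @cov R m k) a : is_cov al ->
  is_cov (fun v => a * al v).
Proof.
move=> cal; have := cov_comb a cal (cov0 k).
by congr is_cov; apply/funext => v; rewrite addr0.
Qed.

Lemma cov_sum k (J : finType) (P : pred J) (al : J -> @cov R m k) :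
  (forall j, P j -> is_cov (al j)) -> is_cov (fun v => \sum_(j | P j) al j v).
Proof.
move=> H; split.
  move=> i u v w a b Eu Ev Ew; rewrite !mulr_sumr -big_split /=.
  by apply: eq_bigr => j Pj; case: (H j Pj) => mj _; apply: (mj i).
move=> v i j ij E; rewrite big1 // => s Ps.
by case: (H s Ps) => _; apply; eassumption.
Qed.

Lemma row_row_perm k (s : 'S_k) (v : 'M[C]_(k, m)) i :
  row i (row_perm s v) = row (s i) v.
Proof. by apply/rowP => j; rewrite !mxE. Qed.

Lemma alternating_tperm k (al : @cov R m k) v i j : is_cov al -> i != j ->
  al (row_perm (tperm i j) v) = - al v.
Proof.
move=> [mal aal] ij.
pose f x y := al (rows (upd (upd (fun l => row l v) i x) j y)).
have Ev : al v = f (row i v) (row j v).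
  rewrite /f -{1}(rows_row v); congr (al (rows _)); apply/funext => l.
  by rewrite /upd; case: eqP => [->//|_]; case: eqP => [->|].
have Ev' : al (row_perm (tperm i j) v) = f (row j v) (row i v).
  rewrite /f -{1}(rows_row (row_perm _ _)); congr (al (rows _)).
  apply/funext => l; rewrite row_row_perm /upd.
  case: eqP => [->|/eqP lj]; first by rewrite tpermR.
  case: eqP => [->|/eqP li]; first by rewrite tpermL.
  by rewrite tpermD // eq_sym.
have fxx x : f x x = 0.
  by apply: (aal _ i j) => //; rewrite !row_rows /upd !eqxx (negPf ij).
have fDr x y z : f x (y + z) = f x y + f x z.
  by have := multilinear_upd (upd (fun l => row l v) i x) j 1 1 y z mal;
     rewrite !scale1r !mul1r.
have swap x y : upd (upd (fun l => row l v) i x) j y =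
                upd (upd (fun l => row l v) j y) i x.
  apply/funext => l; rewrite /upd; case: eqP => // ->.
  by rewrite eq_sym (negPf ij).
have fDl x y z : f (y + z) x = f y x + f z x.
  have := multilinear_upd (upd (fun l => row l v) j x) i 1 1 y z mal.
  by rewrite -!swap !scale1r !mul1r.
have := fxx (row i v + row j v).
rewrite Ev Ev' fDr !fDl !fxx add0r addr0 => /eqP.
by rewrite addr_eq0 => /eqP->.
Qed.

Lemma alternating_perm k (al : @cov R m k) v (s : 'S_k) : is_cov al ->
  al (row_perm s v) = (-1) ^+ s * al v.
Proof.
move=> cal; have [ts -> dts] := prod_tpermP s.
elim: ts v dts => [|t ts IH] v /=.
  by rewrite big_nil odd_perm1 row_perm1 mul1r.
move=> /andP[dt /IH {}IH]; rewrite big_cons row_permM alternating_tperm // IH.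
by rewrite odd_mul_tperm dt /= signrN mulNr.
Qed.

Lemma alternating_det k (al : @cov R m k) (A : 'M[C]_k) (v : 'M[C]_(k, m)) :
  is_cov al -> al (A *m v) = \det A * al v.
Proof.
move=> cal; have [mal aal] := cal.
have -> : A *m v = rows (fun i => \sum_j A i j *: row j v).
  by apply/row_matrixP => i; rewrite row_rows row_mul mulmx_sum_row;
     apply: eq_bigr => j _; rewrite mxE.
rewrite multilinear_sum //.
under eq_bigr do rewrite multilinear_scale //.
rewrite (bigID (fun f : {ffun 'I_k -> 'I_k} => injectiveb f)) /= addrC big1 ?add0r.
  rewrite (reindex (@pval _)) /=; last first.
    pose inv (f : {ffun 'I_k -> 'I_k}) := insubd (1%g : 'S_k) f.
    by exists inv => f //= ; [rewrite /inv valKd|move=> ?; rewrite /inv insubdK].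
  rewrite /determinant mulr_suml; apply: eq_big => s; first by rewrite (valP s).
  move=> _; rewrite mulrAC -alternating_perm //.
  rewrite mulrC; congr (_ * _).
    by congr al; apply/row_matrixP => i; rewrite row_rows; apply/rowP => q;
      rewrite !mxE -[pval s]/(val s) pvalE.
  by apply: eq_bigr => i _; rewrite -pvalE.
move=> f /injectivePn[i [j ij fij]].
by rewrite (aal _ i j) ?mulr0 // !row_rows fij.
Qed.

End Multilinear.

(** * Types of covectors *)

Section ActRows.
Context {R : realType} {m : nat}.
Local Notation C := R[i].
Implicit Types (A B D : 'M[C]_m).

Lemma row_act_rows k (S : {set 'I_k}) A B (v : 'M[C]_(k, m)) i :
  row i (act_rows S A B v) = row i v *m (if i \in S then A else B).
Proof. exact: rowK. Qed.

Lemma act_rows_mulr k (S : {set 'I_k}) A B D (v : 'M[C]_(k, m)) :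
  act_rows S A B v *m D = act_rows S (A *m D) (B *m D) v.
Proof.
apply/row_matrixP => i; rewrite row_mul !row_act_rows -mulmxA.
by case: ifP.
Qed.

Lemma act_rows_mull k (S : {set 'I_k}) A B D (v : 'M[C]_(k, m)) :
  act_rows S A B (v *m D) = act_rows S (D *m A) (D *m B) v.
Proof.
apply/row_matrixP => i; rewrite !row_act_rows row_mul -mulmxA.
by case: ifP.
Qed.

Lemma multilinear_mulmxD k (al : @cov R m k) A B v : multilinear al ->
  al (v *m (A + B)) = \sum_(S : {set 'I_k}) al (act_rows S A B v).
Proof.
move=> mal; have -> : v *m (A + B) = rows (fun i => row i v *m A + row i v *m B).
  by apply/row_matrixP => i; rewrite row_rows row_mul mulmxDr.
rewrite multilinear_add //; apply: eq_bigr => S _; congr al.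
by apply/row_matrixP => i; rewrite row_rows row_act_rows; case: ifP.
Qed.

Lemma multilinear_act_rowsZ k (al : @cov R m k) S A B (a b : C) v :
  multilinear al ->
  al (act_rows S (a *: A) (b *: B) v) =
  a ^+ #|S| * b ^+ #|~: S| * al (act_rows S A B v).
Proof.
move=> mal; have -> : act_rows S (a *: A) (b *: B) v =
    rows (fun i => (if i \in S then a else b) *: row i (act_rows S A B v)).
  apply/row_matrixP => i; rewrite row_rows !row_act_rows.
  by case: ifP => _; rewrite scalemxAr.
rewrite multilinear_scale // rows_row; congr (_ * _).
rewrite (bigID (mem S)) /=; congr (_ * _).
  by rewrite -prodr_const; apply: eq_bigr => i ->.
rewrite -prodr_const; apply: eq_big => [i|i /negPf -> //].
by rewrite inE.
Qed.

Lemma row'P k (u v : 'M[C]_(k, m)) i :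
  (forall j, j != i -> row j u = row j v) -> row' i u = row' i v.
Proof.
move=> H; apply/matrixP => j l.
have /H/rowP/(_ l) : lift i j != i by rewrite eq_sym neq_lift.
by rewrite !mxE.
Qed.

Lemma row'_row k (u v : 'M[C]_(k, m)) i j :
  row' i u = row' i v -> j != i -> row j u = row j v.
Proof. by move=> /row'_eq E ji; apply/rowP => l; rewrite !mxE E. Qed.

Lemma multilinear_act_rows k (al : @cov R m k) (S : {set 'I_k}) A B :
  multilinear al -> multilinear (fun v => al (act_rows S A B v)).
Proof.
move=> mal i u v w a b Eu Ev Ew; apply: (mal i).
- by rewrite !row_act_rows Eu mulmxDl !scalemxAl.
- by apply: row'P => j ji; rewrite !row_act_rows (row'_row Ev).
- by apply: row'P => j ji; rewrite !row_act_rows (row'_row Ew).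
Qed.

Lemma cov_act_rows_sum k (al : @cov R m k) A B (Q : pred nat) : is_cov al ->
  is_cov (fun v => \sum_(S : {set 'I_k} | Q #|S|) al (act_rows S A B v)).
Proof.
move=> cal; have [mal aal] := cal; split.
  move=> i u v w a b Eu Ev Ew; rewrite !mulr_sumr -big_split /=.
  by apply: eq_bigr => S _; apply: (multilinear_act_rows _ _ _ mal Eu Ev Ew).
move=> v i j ij E; set t := tperm i j.
have tK : involutive (fun S : {set 'I_k} => t @^-1: S).
  by move=> S; apply/setP => l; rewrite !inE tpermK.
set X := \sum_(S | _) _.
have : X = - X.
  rewrite {1}/X (reindex_inj (inv_inj tK)) /= -sumrN.
  apply: eq_big => [S|S _]; first by rewrite card_preimset //; exact: perm_inj.
  rewrite -(alternating_tperm (act_rows S A B v) cal ij); congr al.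
  apply/row_matrixP => l; rewrite row_row_perm !row_act_rows inE -/t.
  congr (_ *m _); rewrite /t; case: tpermP => [->|->|//]; by rewrite E.
by move/eqP; rewrite -addr_eq0 -mulr2n mulrn_eq0 /= => /eqP.
Qed.

End ActRows.

Section Types.
Context {R : realType} {m : nat}.
Local Notation C := R[i].
Variable I : 'M[R]_m.
Hypothesis I2 : I *m I = - 1%:M.
Local Notation p10 := (pi10 I).
Local Notation p01 := (pi01 I).

Lemma cmxI2 : cmx I *m cmx I = - 1%:M.
Proof. by rewrite /cmx -map_mxM I2 map_mxN map_mx1. Qed.

Lemma pi10D01 : p10 + p01 = 1%:M.
Proof.
apply/matrixP => a b; rewrite !mxE.
by case: (a == b); rewrite ?mulr1n ?mulr0n; field.
Qed.

Lemma pi10_cmxI : p10 *m cmx I = 'i *: p10.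
Proof.
rewrite /pi10 -scalemxAl mulmxBl mul1mx -scalemxAl cmxI2 scalerA mulrC -scalerA.
by congr (_ *: _); rewrite scalerN opprK scalerBr scalerA -expr2 sqrCi scaleN1r
  opprK addrC.
Qed.

Lemma cmxI_pi10 : cmx I *m p10 = 'i *: p10.
Proof.
rewrite /pi10 -scalemxAr mulmxBr mulmx1 -scalemxAr cmxI2 scalerA mulrC -scalerA.
by congr (_ *: _); rewrite scalerN opprK scalerBr scalerA -expr2 sqrCi scaleN1r
  opprK addrC.
Qed.

Lemma pi01_cmxI : p01 *m cmx I = - 'i *: p01.
Proof.
rewrite /pi01 -scalemxAl mulmxDl mul1mx -scalemxAl cmxI2 scalerA mulrC -scalerA.
by congr (_ *: _); rewrite scalerN scalerDr scalerA mulNr -expr2 sqrCi opprK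
  scale1r scaleNr addrC.
Qed.

Lemma pi10_idem : p10 *m p10 = p10.
Proof.
rewrite {1}/pi10 -scalemxAl mulmxBl mul1mx -scalemxAl cmxI_pi10 scalerA -expr2.
rewrite sqrCi scaleN1r opprK; apply/matrixP => a b; rewrite !mxE.
by field.
Qed.

Lemma pi01_pi10 : p01 *m p10 = 0.
Proof.
by rewrite -[p01](addKr p10) pi10D01 mulmxDl mulNmx mul1mx pi10_idem addNr.
Qed.

Lemma pi10_pi01 : p10 *m p01 = 0.
Proof.
by rewrite -[p01](addKr p10) pi10D01 mulmxDr mulmxN mulmx1 pi10_idem addNr.
Qed.

Lemma pi01_idem : p01 *m p01 = p01.
Proof. by rewrite -{3}[p01]mul1mx -pi10D01 mulmxDl pi10_pi01 add0r. Qed.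

Lemma act_rows_pi_neq k (al : @cov R m k) (S T : {set 'I_k}) v :
  multilinear al -> S != T ->
  al (act_rows S p01 p10 (act_rows T p01 p10 v)) = 0.
Proof.
move=> mal /eqP ST.
have [i Hi] : exists i, (i \in S) != (i \in T).
  apply/existsP; apply: contraPT (ST) => H E.
  apply: E; apply/setP => i; apply/eqP; move: H; rewrite negb_exists.
  by move=> /forallP /(_ i); rewrite negbK.
apply: (multilinear_row0 (i := i)) => //.
rewrite !row_act_rows -mulmxA; move: Hi.
by case: (i \in S); case: (i \in T) => // _;
  rewrite ?pi01_pi10 ?pi10_pi01 mulmx0.
Qed.

Lemma is_pqP p q k (al : @cov R m k) : is_cov al ->
  is_pq I p q al <->
  (forall T : {set 'I_k}, ~~ ((#|~: T| == p) && (#|T| == q)) ->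
     forall v, al (act_rows T p01 p10 v) = 0).
Proof.
move=> cal; have [mal _] := cal; split=> [[_ <-] T bT v|H].
  rewrite /pq_part big1 // => S gS; apply: act_rows_pi_neq => //.
  by apply: contraNneq bT => <-.
split=> //; apply/funext => v.
rewrite -{2}[v]mulmx1 -pi10D01 addrC multilinear_mulmxD // /pq_part.
rewrite [RHS](bigID (fun T : {set 'I_k} => (#|~: T| == p) && (#|T| == q))) /=.
by rewrite [X in _ + X]big1 ?addr0 // => T /H ->.
Qed.

Lemma cov_pq_part p q k (al : @cov R m k) : is_cov al ->
  is_cov (pq_part I p q al).
Proof.
move=> /(cov_act_rows_sum p01 p10
  (fun d => (k - d == p)%N && (d == q))); congr is_cov.
apply/funext => v; apply: eq_bigl => S.
by rewrite [#|~: S|]cardsCs finset.setCK card_ord.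
Qed.

Lemma pq_part_pq p q k (al : @cov R m k) : is_cov al ->
  is_pq I p q (pq_part I p q al).
Proof.
move=> cal; have [mal _] := cal.
apply/(is_pqP p q (cov_pq_part p q cal)) => T bT v.
rewrite /pq_part big1 // => S gS; apply: act_rows_pi_neq => //.
by apply: contraNneq bT => <-.
Qed.

Lemma act_rows0 k A B (v : 'M[C]_(k, m)) : act_rows finset.set0 A B v = v *m B.
Proof. by apply/row_matrixP => i; rewrite row_act_rows inE row_mul. Qed.

Lemma act_rowsT k A B (v : 'M[C]_(k, m)) : act_rows [set: 'I_k]%SET A B v = v *m A.
Proof. by apply/row_matrixP => i; rewrite row_act_rows inE row_mul. Qed.

Lemma pq_part_k0 k (al : @cov R m k) : pq_part I k 0 al = pullback p10 al.
Proof.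
apply/funext => v; rewrite /pq_part (big_pred1 finset.set0) ?act_rows0 // => S.
rewrite cards_eq0 andbC /=; case: (S =P finset.set0) => //= ->.
by rewrite finset.setC0 cardsT card_ord eqxx.
Qed.

Lemma pq_part_0k k (al : @cov R m k) : pq_part I 0 k al = pullback p01 al.
Proof.
apply/funext => v; rewrite /pq_part (big_pred1 [set: 'I_k]%SET) ?act_rowsT // => S.
rewrite cards_eq0 -(inj_eq (@finset.setC_inj _)) finset.setCK finset.setC0 /=.
by case: (S =P [set: 'I_k]%SET) => //= ->; rewrite cardsT card_ord eqxx.
Qed.
End Types.

(** * Wedge products *)

Section Wedge.
Context {R : realType} {m : nat}.
Local Notation C := R[i].
Implicit Types (k l : nat).

Lemma usub_row_perm k l (s : 'S_(k + l)) (v : 'M[C]_(k + l, m)) i :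
  row i (usubmx (row_perm s v)) = row (s (lshift l i)) v.
Proof. by apply/rowP => j; rewrite !mxE. Qed.

Lemma dsub_row_perm k l (s : 'S_(k + l)) (v : 'M[C]_(k + l, m)) i :
  row i (dsubmx (row_perm s v)) = row (s (rshift k i)) v.
Proof. by apply/rowP => j; rewrite !mxE. Qed.

Lemma multilinear_wedge k l (al : @cov R m k) (be : @cov R m l) :
  multilinear al -> multilinear be -> multilinear (wedge al be).
Proof.
move=> mal mbe i u v w a b Eu Ev Ew; rewrite /wedge.
have algl (e x y z : C) :
  e * (a * x + b * y) * z = a * (e * x * z) + b * (e * y * z) by ring.
have algr (e x y z : C) :
  e * z * (a * x + b * y) = a * (e * z * x) + b * (e * z * y) by ring.
rewrite mulrCA (mulrCA b) -mulrDr; congr (_ * _).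
rewrite !mulr_sumr -big_split /=; apply: eq_bigr => s _.
have [j Ej|j Ej] := split_ordP ((s^-1)%g i).
  have sj : s (lshift l j) = i by rewrite -Ej permKV.
  have N z : row' i z = row' i u ->
      dsubmx (row_perm s z) = dsubmx (row_perm s u).
    move=> Ez; apply/row_matrixP => p; rewrite !dsub_row_perm.
    by apply: (row'_row Ez); rewrite -sj (inj_eq perm_inj) eq_rlshift.
  have N' z : row' i z = row' i u ->
      row' j (usubmx (row_perm s z)) = row' j (usubmx (row_perm s u)).
    move=> Ez; apply: row'P => p pj; rewrite !usub_row_perm.
    by apply: (row'_row Ez); rewrite -sj (inj_eq perm_inj) eq_lshift.
  rewrite (N v Ev) (N w Ew).
  have -> := mal j _ _ _ a b _ (N' v Ev) (N' w Ew); last first.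
    by rewrite !usub_row_perm sj.
  exact: algl.
have sj : s (rshift k j) = i by rewrite -Ej permKV.
have N z : row' i z = row' i u ->
    usubmx (row_perm s z) = usubmx (row_perm s u).
  move=> Ez; apply/row_matrixP => p; rewrite !usub_row_perm.
  by apply: (row'_row Ez); rewrite -sj (inj_eq perm_inj) eq_lrshift.
have N' z : row' i z = row' i u ->
    row' j (dsubmx (row_perm s z)) = row' j (dsubmx (row_perm s u)).
  move=> Ez; apply: row'P => p pj; rewrite !dsub_row_perm.
  by apply: (row'_row Ez); rewrite -sj (inj_eq perm_inj) eq_rshift.
rewrite (N v Ev) (N w Ew).
have -> := mbe j _ _ _ a b _ (N' v Ev) (N' w Ew); last first.
  by rewrite !dsub_row_perm sj.
exact: algr.
Qed.

Lemma alternating_wedge k l (al : @cov R m k) (be : @cov R m l) :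
  alternating (wedge al be).
Proof.
move=> v i j ij E; rewrite /wedge; set X := \sum_s _.
suff -> : X = 0 by rewrite mulr0.
have : X = - X.
  rewrite {1}/X (reindex_inj (mulIg (tperm i j))) /= -sumrN.
  apply: eq_bigr => s _; rewrite row_permM.
  have -> : row_perm (tperm i j) v = v.
    apply/row_matrixP => p; rewrite row_row_perm.
    by case: tpermP => [->|->|//]; rewrite E.
  rewrite odd_permM odd_tperm ij addbT signrN.
  by rewrite !mulNr.
by move/eqP; rewrite -addr_eq0 -mulr2n mulrn_eq0 /= => /eqP.
Qed.

Lemma cov_wedge k l (al : @cov R m k) (be : @cov R m l) :
  is_cov al -> is_cov be -> is_cov (wedge al be).
Proof.
by move=> [mal _] [mbe _]; split;
  [exact: multilinear_wedge|exact: alternating_wedge].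
Qed.

Lemma wedge_pullback k l (al : @cov R m k) (be : @cov R m l) A :
  wedge (pullback A al) (pullback A be) = pullback A (wedge al be).
Proof.
apply/funext => v; rewrite /wedge /pullback; congr (_ * _).
apply: eq_bigr => s _.
suff -> : row_perm s (v *m A) = row_perm s v *m A.
  by rewrite mul_usub_mx mul_dsub_mx.
by rewrite !row_permE mulmxA.
Qed.

Lemma wedge_combl k l (al al' : @cov R m k) (be : @cov R m l) a v :
  wedge (fun v => a * al v + al' v) be v = a * wedge al be v + wedge al' be v.
Proof.
rewrite /wedge mulrCA -mulrDr; congr (_ * _).
rewrite !mulr_sumr -big_split /=; apply: eq_bigr => s _.
by rewrite mulrDr mulrDl mulrCA !mulrA.
Qed.

Lemma wedge_scalel k l (al : @cov R m k) (be : @cov R m l) a v :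
  wedge (fun v => a * al v) be v = a * wedge al be v.
Proof.
rewrite /wedge mulrCA; congr (_ * _).
by rewrite !mulr_sumr; apply: eq_bigr => s _; rewrite mulrCA !mulrA.
Qed.

Lemma wedge_scaler k l (al : @cov R m k) (be : @cov R m l) a v :
  wedge al (fun v => a * be v) v = a * wedge al be v.
Proof.
rewrite /wedge mulrCA; congr (_ * _).
by rewrite !mulr_sumr; apply: eq_bigr => s _; rewrite mulrCA !mulrA.
Qed.

Lemma wedge_prod_pullback (eta : @cov R m 2) A n :
  wedge_prod (fun=> pullback A eta) n = pullback A (wedge_prod (fun=> eta) n).
Proof.
by elim: n => [//|n IH] /=; rewrite IH wedge_pullback.
Qed.

Lemma wedge_prod_scale (eta : @cov R m 2) a n :
  wedge_prod (fun _ v => a * eta v) n = fun v => a ^+ n * wedge_prod (fun=> eta) n v.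
Proof.
elim: n => [|n IH] /=; first by apply/funext => v; rewrite mulr1.
rewrite IH; apply/funext => v.
by rewrite wedge_scalel wedge_scaler mulrA exprS.
Qed.

Lemma split_lshift k l (i : 'I_k) : fintype.split (lshift l i) = inl i.
Proof. exact: (unsplitK (inl i)). Qed.

Lemma split_rshift k l (i : 'I_l) : fintype.split (rshift k i) = inr i.
Proof. exact: (unsplitK (inr i)). Qed.

Lemma ord_swap_subproof k :
  injective (fun i : 'I_(k + k) =>
    match fintype.split i with inl j => rshift k j | inr j => lshift k j end).
Proof.
move=> i j; case: (split_ordP i) => p ->; case: (split_ordP j) => q ->.
- by move=> /rshift_inj ->.
- by move=> /eqP; rewrite eq_rlshift.
- by move=> /eqP; rewrite eq_lrshift.
- by move=> /lshift_inj ->.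
Qed.

Definition ord_swap k : 'S_(k + k) := perm (@ord_swap_subproof k).

(* The sign is 1 for even k, but its value is irrelevant here.                 *)
Lemma wedge_swap k (al be : @cov R m k) :
  wedge al be = fun v => (-1) ^+ (ord_swap k) * wedge be al v.
Proof.
apply/funext => v; rewrite /wedge mulrCA; congr (_ * _).
rewrite (reindex_inj (mulgI (ord_swap k))) /= mulr_sumr.
apply: eq_bigr => s _; rewrite row_permM.
have -> : usubmx (row_perm (ord_swap k) (row_perm s v)) = dsubmx (row_perm s v).
  apply/row_matrixP => i; rewrite usub_row_perm !row_row_perm dsub_row_perm.
  by rewrite permE split_lshift.
have -> : dsubmx (row_perm (ord_swap k) (row_perm s v)) = usubmx (row_perm s v).
  apply/row_matrixP => i; rewrite dsub_row_perm !row_row_perm usub_row_perm.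
  by rewrite permE split_rshift.
rewrite odd_permM signr_addb.
by rewrite -!mulrA [al _ * _]mulrC.
Qed.

Lemma card_preim_split k l (s : 'S_(k + l)) (T : {set 'I_(k + l)}) :
  (#|[set i | s (lshift l i) \in T]| + #|[set i | s (rshift k i) \in T]|)%N
  = #|T|.
Proof.
rewrite -(card_preimset T (@perm_inj _ s)) -!sum1dep_card.
by rewrite [RHS]big_split_ord /=; congr (_ + _)%N; apply: eq_bigl => i; rewrite !inE.
Qed.

Variable I : 'M[R]_m.
Hypothesis I2 : I *m I = - 1%:M.

Lemma wedge_pq k l (al : @cov R m k) (be : @cov R m l) p q p' q' :
  is_pq I p q al -> is_pq I p' q' be ->
  is_pq I (p + p') (q + q') (wedge al be).
Proof.
move=> pal pbe; have [[cal _] [cbe _]] := (pal, pbe).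
apply/(is_pqP I2 _ _ (cov_wedge cal cbe)) => T bT v.
rewrite /wedge big1 ?mulr0 // => s _.
set T1 := [set i | s (lshift l i) \in T].
set T2 := [set i | s (rshift k i) \in T].
have -> : usubmx (row_perm s (act_rows T (pi01 I) (pi10 I) v)) =
          act_rows T1 (pi01 I) (pi10 I) (usubmx (row_perm s v)).
  apply/row_matrixP => i.
  by rewrite usub_row_perm !row_act_rows usub_row_perm inE.
have -> : dsubmx (row_perm s (act_rows T (pi01 I) (pi10 I) v)) =
          act_rows T2 (pi01 I) (pi10 I) (dsubmx (row_perm s v)).
  apply/row_matrixP => i.
  by rewrite dsub_row_perm !row_act_rows dsub_row_perm inE.
have [/andP[/eqP a1 /eqP a2]|/((is_pqP I2 _ _ cal).1 pal) ->] :=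
  boolP ((#|~: T1| == p) && (#|T1| == q))%SET; last by rewrite mulr0 mul0r.
have [/andP[/eqP b1 /eqP b2]|/((is_pqP I2 _ _ cbe).1 pbe) ->] :=
  boolP ((#|~: T2| == p') && (#|T2| == q'))%SET; last by rewrite mulr0.
case/negP: bT; rewrite -a1 -b1 -a2 -b2 -(card_preim_split s (~: T)%SET).
rewrite -(card_preim_split s T) -/T1 -/T2 eqxx andbT; apply/eqP.
by congr (_ + _)%N; apply: eq_card => i; rewrite !inE.
Qed.

Lemma wedge_prod_pq (eta : nat -> @cov R m 2) p q n :
  (forall i, is_pq I p q (eta i)) ->
  is_pq I (n * p) (n * q) (wedge_prod eta n).
Proof.
move=> H; elim: n => [|n IH] /=; last exact: (wedge_pq (H n) IH).
split; first by split=> [i|v i]; have := ltn_ord i.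
by rewrite pq_part_k0.
Qed.

Lemma idem_factor k (P : 'M[C]_m) : P *m P = P -> \rank P = k ->
  exists Z : 'M[C]_(k, m), exists D : 'M[C]_(m, k), P = D *m Z /\ Z *m P = Z.
Proof.
move=> PP <-; exists (row_base P).
have /submxP[D ED] : (P <= row_base P)%MS by rewrite eq_row_base.
exists D; split=> //.
have /submxP[X ->] : (row_base P <= P)%MS by rewrite eq_row_base.
by rewrite -mulmxA PP.
Qed.

(* The wedge product is evaluated on a basis of T^{1,0} followed by a basis of *)
(* T^{0,1}: the terms of permutations preserving the two blocks are all equal, *)
(* and the other terms vanish.                                                 *)
Lemma wedge_eq0 k (al be : @cov R m k) :
  \rank (pi10 I) = k -> \rank (pi01 I) = k ->
  is_pq I k 0 al -> is_pq I 0 k be -> wedge al be = (fun=> 0) ->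
  al = (fun=> 0) \/ be = (fun=> 0).
Proof.
move=> r10 r01 [cal]; rewrite pq_part_k0 => Eal [cbe].
rewrite pq_part_0k => Ebe W0.
have [Z [D [ED EZ]]] := idem_factor (pi10_idem I2) r10.
have [Z' [D' [ED' EZ']]] := idem_factor (pi01_idem I2) r01.
have alE v : al v = \det (v *m D) * al Z.
  by rewrite -{1}Eal /pullback ED mulmxA alternating_det.
have beE v : be v = \det (v *m D') * be Z'.
  by rewrite -{1}Ebe /pullback ED' mulmxA alternating_det.
have Z'p : Z' *m pi10 I = 0 by rewrite -EZ' -mulmxA pi01_pi10 // mulmx0.
have Zp : Z *m pi01 I = 0 by rewrite -EZ -mulmxA pi10_pi01 // mulmx0.
have {}alE (A B : 'M[C]_k) : al (A *m Z + B *m Z') = \det A * al Z.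
  rewrite -{1}Eal /pullback mulmxDl -!mulmxA Z'p mulmx0 addr0 EZ.
  exact: alternating_det.
have {}beE (A B : 'M[C]_k) : be (A *m Z + B *m Z') = \det B * be Z'.
  rewrite -{1}Ebe /pullback mulmxDl -!mulmxA Zp mulmx0 add0r EZ'.
  exact: alternating_det.
pose t (s : 'S_(k + k)) : C := let P := perm_mx s in
  (-1) ^+ s * \det (ulsubmx P) * \det (drsubmx P).
have Et : wedge al be (col_mx Z Z') =
    (k`! * k`!)%:R^-1 * (al Z * be Z' * \sum_s t s).
  have alg (e x y a b : C) : e * (x * a) * (y * b) = a * b * (e * x * y).
    by ring.
  rewrite /wedge; congr (_ * _); rewrite mulr_sumr; apply: eq_bigr => s _.
  rewrite row_permE -[perm_mx s]submxK mul_block_col col_mxKu col_mxKd.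
  by rewrite alE beE alg /t.
have t_block s : ursubmx (perm_mx s : 'M[C]_(k + k)) = 0 -> t s = 1.
  move=> ur0; rewrite /t -mulrA -(det_lblock _ (dlsubmx (perm_mx s))) -ur0.
  by rewrite submxK det_perm -signr_addb addbb.
have t_nblock s : ursubmx (perm_mx s : 'M[C]_(k + k)) != 0 -> t s = 0.
  move=> /matrix0Pn[i [j]]; rewrite !mxE; 
  case: (s (lshift k i) =P rshift k j) => [sij _|_ /negP[]]; last exact/eqP.
  rewrite /t (expand_det_row _ i) big1 ?mulr0 ?mul0r // => j' _.
  by rewrite !mxE sij eq_rlshift mul0r.
have t_ge0 s : 0 <= t s.
  by have [/eqP/t_block ->|/t_nblock ->] :=
    boolP (ursubmx (perm_mx s : 'M[C]_(k + k)) == 0).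
have t1 : t 1%g = 1.
  by apply: t_block; apply/matrixP => i j; rewrite !mxE perm1 eq_lrshift.
have St : \sum_s t s != 0.
  rewrite (bigD1 1%g) //= t1 lt0r_neq0 // ltr_pwDl ?ltr01 //.
  exact: sumr_ge0.
have nz : (k`! * k`!)%:R^-1 != 0 :> C.
  by rewrite invr_neq0 // pnatr_eq0 -lt0n muln_gt0 !fact_gt0.
move: Et; rewrite W0 => /esym/eqP; rewrite mulf_eq0 (negPf nz) /=.
rewrite mulf_eq0 (negPf St) orbF mulf_eq0 => /orP[]/eqP z0.
  left; apply/funext => v; have := alE (v *m D) 0.
  by rewrite mul0mx addr0 z0 mulr0 -{2}Eal /pullback ED mulmxA.
right; apply/funext => v; have := beE 0 (v *m D').
by rewrite mul0mx add0r z0 mulr0 -{2}Ebe /pullback ED' mulmxA.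
Qed.
End Wedge.

Section Rank.
Context {R : realType} {m : nat}.
Local Notation C := R[i].
Variable I : 'M[R]_m.
Hypothesis I2 : I *m I = - 1%:M.

Lemma pi01_conj : pi01 I = conjmx (pi10 I).
Proof.
apply/matrixP => a b; rewrite !mxE.
rewrite rmorphM rmorphB rmorphM fmorphV rmorph_nat.
congr (_ * (_ + _)); first by rewrite rmorph_nat.
by apply/eqP; rewrite eq_complex /=; apply/andP; split; apply/eqP; ring.
Qed.

Lemma rank_pi k : m = (k + k)%N ->
  \rank (pi10 I) = k /\ \rank (pi01 I) = k.
Proof.
move=> mk; have E : \rank (pi01 I) = \rank (pi10 I).
  by rewrite pi01_conj /conjmx mxrank_map.
have : (\rank (pi10 I) + \rank (pi01 I) = m)%N.
  apply/eqP; rewrite eqn_leq mulmx0_rank_max ?pi10_pi01 //=.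
  by rewrite -[X in (X <= _)%N](mxrank1 C m) -(pi10D01 I) mxrank_add.
by move=> H; have := etrans H mk; rewrite E !addnn => /double_inj ->.
Qed.
End Rank.

Section Aux.
Context {R : realType}.
Local Notation C := R[i].

Lemma horner_nat_eq0 r (c : 'I_r.+1 -> C) :
  (forall N : nat, \sum_k c k * N%:R ^+ k = 0) -> forall k, c k = 0.
Proof.
move=> H; pose P := \poly_(k < r.+1) c (inord k).
have PE (N : nat) : P.[N%:R] = 0.
  rewrite horner_poly -[RHS](H N).
  by apply: eq_bigr => k _; rewrite inord_val.
have P0 : P = 0.
  apply: (roots_geq_poly_eq0 (rs := [seq (N%:R : C) | N <- iota 0 r.+1])).
  - by apply/allP => _ /mapP[N _ ->]; apply/eqP.
  - rewrite map_inj_uniq ?iota_uniq // => x y /eqP.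
    by rewrite eqr_nat => /eqP.
  - by rewrite size_map size_iota size_poly.
move=> k; have : P`_k = 0 by rewrite P0 coef0.
by rewrite coef_poly ltn_ord inord_val.
Qed.

Lemma sum_by_card r (F : {set 'I_r} -> C) :
  \sum_S F S = \sum_(k < r.+1) \sum_(S : {set 'I_r} | #|S| == k) F S.
Proof.
rewrite (partition_big (fun S : {set 'I_r} => inord #|S| : 'I_r.+1) xpredT) //=.
apply: eq_bigr => k _; apply: eq_bigl => S.
by rewrite -val_eqE /= inordK // ltnS -[X in (_ <= X)%N]card_ord max_card.
Qed.

Lemma complex_split (a b : R) : a +i* b = a%:C + b%:C * 'i%C.
Proof.
by apply/eqP; rewrite eq_complex /=; apply/andP; split; apply/eqP; ring.
Qed.

Lemma conjc_split (a b : R) : conjc (a +i* b) = a%:C + b%:C * - 'i%C.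
Proof.
by apply/eqP; rewrite eq_complex /=; apply/andP; split; apply/eqP; ring.
Qed.

Lemma circle_root q : (0 < q)%N -> exists a b : R,
  a ^+ 2 + b ^+ 2 = 1 /\ (a +i* b) ^+ q.*2 = -1.
Proof.
move=> q0; have q20 : (0 < q.*2)%N by rewrite double_gt0.
pose z : C := (q.*2).-root (-1); have zq : z ^+ q.*2 = -1 by rewrite rootCK.
exists (complex.Re z), (complex.Im z); split; last first.
  by rewrite -zq; congr (_ ^+ _); case: (z).
have : `|z| ^+ q.*2 = 1 by rewrite -normrX zq normrN1.
move=> /eqP; rewrite pexpr_eq1 // => /eqP; rewrite normc_def.
by move=> /complexI H; rewrite -[LHS]sqr_sqrtr ?addr_ge0 ?sqr_ge0 // H expr1n.
Qed.

Lemma unit_circle_J (N : nat) : exists a : R, 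
  a != 0 /\ a ^+ 2 + (a * N%:R) ^+ 2 = 1.
Proof.
have P : 0 < 1 + N%:R ^+ 2 :> R by rewrite ltr_pwDl // exprn_ge0.
exists (Num.sqrt (1 + N%:R ^+ 2))^-1; split.
  by rewrite invr_neq0 // sqrtr_eq0 -ltNge.
rewrite exprMn -{1}[_ ^+ 2]mulr1 -mulrDr exprVn sqr_sqrtr ?ltW // mulVf //.
Qed.

End Aux.

(** * The operator R *)

Section QuatAlgebra.
Variables (F : fieldType) (m : nat) (j : F) (A B X : 'M[F]_m).
Hypotheses (j2 : j ^+ 2 = -1) (B2 : B *m B = - 1%:M) (BA : B *m A = - (A *m B)).

Lemma quat_mulmx (a b c d s t z u z' u' : F) : A *m X = j *: X ->
  z = a + b * j -> u = c - d * j -> z' = a - b * j -> u' = c + d * j ->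
  (a%:M + b *: A + c *: B + d *: (A *m B)) *m (t *: B + s *: 1%:M) *m X =
  ((u * s + z' * t) *: B + (z * s - u' * t) *: 1%:M) *m X.
Proof.
move=> AX -> -> -> ->; set Y := B *m X.
have BY : B *m Y = - X by rewrite mulmxA B2 mulNmx mul1mx.
have AY : A *m Y = - j *: Y.
  by rewrite mulmxA -[A *m B]opprK -BA mulNmx -mulmxA AX -scalemxAr scaleNr.
have TX s' t' : (t' *: B + s' *: 1%:M) *m X = t' *: Y + s' *: X.
  by rewrite mulmxDl -!scalemxAl mul1mx.
rewrite -mulmxA !TX !mulmxDl !mulmxDr -!scalemxAl -!scalemxAr.
rewrite -!mulmxA !mul_scalar_mx !BY !AX -/Y !AY !mulmxN !AX.
apply/matrixP => k l; rewrite !mxE.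
move: (X k l) (\sum_j0 _) => x y; ring: j2.
Qed.

Lemma scal_mulmx_quat (a b c d s t z u z' u' : F) : X *m A = j *: X ->
  z = a + b * j -> u = c - d * j -> z' = a - b * j -> u' = c + d * j ->
  X *m (t *: B + s *: 1%:M) *m (a%:M + b *: A + c *: B + d *: (A *m B)) =
  X *m ((u' * s + z' * t) *: B + (z * s - u * t) *: 1%:M).
Proof.
move=> XA -> -> -> ->; set Y := X *m B.
have YB : Y *m B = - X by rewrite -mulmxA B2 mulmxN mulmx1.
have YA : Y *m A = - j *: Y.
  by rewrite -mulmxA BA mulmxN mulmxA XA -scalemxAl scaleNr.
have XT s' t' : X *m (t' *: B + s' *: 1%:M) = t' *: Y + s' *: X.
  by rewrite mulmxDr -!scalemxAr mulmx1.
rewrite !XT !mulmxDl !mulmxDr -!scalemxAl -!scalemxAr.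
rewrite !mulmxA !mul_mx_scalar !YA !XA -!scalemxAl !YB -/Y.
apply/matrixP => k l; rewrite !mxE.
move: (X k l) (\sum_j0 _) => x y; ring: j2.
Qed.

Lemma proj_mul_proj (s t : F) : X *m X = X -> X *m B *m X = 0 ->
  X *m (t *: B + s *: 1%:M) *m X = s *: X.
Proof.
move=> XX XBX; rewrite mulmxDr mulmxDl -!scalemxAr -!scalemxAl XBX.
by rewrite scaler0 add0r mulmx1 XX.
Qed.

Lemma proj_mulB_proj (s t : F) : X *m X = X -> X *m B *m X = 0 ->
  X *m (t *: B + s *: 1%:M) *m B *m X = - t *: X.
Proof.
move=> XX XBX; rewrite mulmxDr !mulmxDl -!scalemxAr -!scalemxAl mulmx1 XBX.
rewrite scaler0 addr0 -[X *m B *m B]mulmxA B2 mulmxN mulmx1 mulNmx XX.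
by rewrite scalerN scaleNr.
Qed.

Lemma scalemx_comb (a b c : F) : (a + b * c) *: X = a *: X + b *: (c *: X).
Proof. by rewrite scalerA -scalerDl. Qed.

End QuatAlgebra.

Section Rep.
Context {R : realType} {m : nat}.
Local Notation C := R[i].
Variables I J K : 'M[R]_m.
Hypotheses (I2 : I *m I = - 1%:M) (J2 : J *m J = - 1%:M).
Hypotheses (IJ : I *m J = K) (JI : J *m I = - K).
Local Notation p := (pi10 I).
Local Notation q := (pi01 I).
Local Notation Jc := (cmx J).

Definition scalJ (s t : C) : 'M[C]_m := t *: Jc + s *: 1%:M.

Lemma cmxM k l n (A : 'M[R]_(k, l)) (B : 'M[R]_(l, n)) :
  cmx (A *m B) = cmx A *m cmx B.
Proof. by rewrite /cmx map_mxM. Qed.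

Lemma cmxK : cmx K = cmx I *m Jc. Proof. by rewrite -IJ cmxM. Qed.

Lemma cmxJI : Jc *m cmx I = - (cmx I *m Jc).
Proof. by rewrite -!cmxM IJ JI /cmx map_mxN. Qed.

Lemma J_pi10 : Jc *m p = q *m Jc.
Proof.
rewrite /pi10 /pi01 -scalemxAl -scalemxAr mulmxBr mulmxDl mul1mx mulmx1.
by rewrite -scalemxAl -scalemxAr cmxJI scalerN opprK.
Qed.

Lemma J_pi01 : Jc *m q = p *m Jc.
Proof.
rewrite /pi10 /pi01 -scalemxAl -scalemxAr mulmxDr mulmxBl mul1mx mulmx1.
by rewrite -scalemxAl -scalemxAr cmxJI scalerN.
Qed.

Lemma cmx_quat a b c d : cmx (quat I J K a b c d) =
  (a%:C)%:M + b%:C *: cmx I + c%:C *: Jc + d%:C *: cmx K.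
Proof.
rewrite /cmx /quat !map_mxD !map_mxZ map_scalar_mx.
by [].
Qed.

Lemma quat_scalJ_pi10 a b c d s t :
  let z := a +i* b in let u := c -i* d in
  cmx (quat I J K a b c d) *m scalJ s t *m p =
  scalJ (z * s - conjc u * t) (u * s + conjc z * t) *m p.
Proof.
move=> z u; rewrite cmx_quat cmxK /scalJ.
apply: (quat_mulmx (j := 'i%C)); [rewrite sqrCi|exact: cmxI2|exact: cmxJI|exact: cmxI_pi10|..] => //;
  by apply/eqP; rewrite eq_complex /=; apply/andP; split; apply/eqP; ring.
Qed.

Lemma pi10_quat_I a b :
  p *m cmx (quat I J K a b 0 0) = (a +i* b) *: p.
Proof.
rewrite cmx_quat !scale0r !addr0 mulmxDr -scalemxAr pi10_cmxI // mul_mx_scalar.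
by rewrite (complex_split a b) scalemx_comb.
Qed.

Lemma pi01_quat_I a b :
  q *m cmx (quat I J K a b 0 0) = conjc (a +i* b) *: q.
Proof.
rewrite cmx_quat !scale0r !addr0 mulmxDr -scalemxAr pi01_cmxI // mul_mx_scalar.
by rewrite conjc_split scalemx_comb.
Qed.

Lemma quat_J a c : cmx (quat I J K a 0 c 0) = scalJ a%:C c%:C.
Proof.
rewrite cmx_quat !scale0r addr0 addr0 /scalJ addrC scale_scalar_mx mulr1.
by [].
Qed.

Lemma plus_iso_comb k r (al be : @cov R m r) a v :
  plus_iso J k (fun v => a * al v + be v) v =
  a * plus_iso J k al v + plus_iso J k be v.
Proof. by rewrite /plus_iso big_split /= -mulr_sumr mulrDr mulrCA. Qed.

Lemma plus_iso_sum k r (T : finType) (al : T -> @cov R m r) a v :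
  plus_iso J k (fun v => \sum_i a i * al i v) v =
  \sum_i a i * plus_iso J k (al i) v.
Proof.
rewrite /plus_iso; under [RHS]eq_bigr do rewrite mulrCA.
rewrite -mulr_sumr; congr (_ * _).
by under [RHS]eq_bigr do rewrite mulr_sumr; rewrite exchange_big.
Qed.

Lemma cov_plus_iso k r (al : @cov R m r) :
  is_cov al -> is_cov (plus_iso J k al).
Proof. by move=> cal; apply: cov_scale; apply: (cov_act_rows_sum _ _ (pred1 k)). Qed.

Lemma multilinear_scalJ r (al : @cov R m r) s t v : multilinear al ->
  al (v *m scalJ s t) =
  \sum_(k < r.+1) t ^+ k * s ^+ (r - k) * ('C(r, k)%:R * plus_iso J k al v).
Proof.
move=> mal; rewrite multilinear_mulmxD // sum_by_card; apply: eq_bigr => k _.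
rewrite /plus_iso [_%:R * _]mulrA mulfV ?mul1r; last first.
  by rewrite pnatr_eq0 -lt0n bin_gt0 -ltnS.
rewrite mulr_sumr; apply: eq_bigr => S /eqP Sk.
by rewrite multilinear_act_rowsZ // [#|~: S|]cardsCs finset.setCK card_ord Sk.
Qed.

(* Under T = T^{1,0} (x) C^2, the vector v pi10 (s + t J) is the pure tensor   *)
(* of v pi10 with (s, t).                                                      *)
Lemma plus_iso_scalJ k r (rho : @cov R m r) s t v : is_cov rho ->
  pullback p rho = rho -> (k <= r)%N ->
  plus_iso J k rho (v *m (p *m scalJ s t)) = (- t) ^+ k * s ^+ (r - k) * rho v.
Proof.
move=> [mrho _] prho kr; rewrite /plus_iso.
have E S : rho (act_rows S Jc 1%:M (v *m (p *m scalJ s t))) =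
    (- t) ^+ #|S| * s ^+ (r - #|S|) * rho v.
  rewrite act_rows_mull mulmx1 -{1}prho /pullback act_rows_mulr.
  have pJp : p *m Jc *m p = 0 by rewrite -mulmxA J_pi10 mulmxA pi10_pi01 // mul0mx.
  have -> : p *m scalJ s t *m p = s *: p.
    by apply: proj_mul_proj => //; exact: pi10_idem.
  have -> : p *m scalJ s t *m Jc *m p = - t *: p.
    by apply: proj_mulB_proj => //; [exact: cmxI2|exact: pi10_idem].
  rewrite multilinear_act_rowsZ // [#|~: S|]cardsCs finset.setCK card_ord.
  congr (_ * _); rewrite -{2}prho /pullback; congr rho.
  by apply/row_matrixP => i; rewrite row_act_rows if_same row_mul.
rewrite (eq_bigr (fun=> (- t) ^+ k * s ^+ (r - k) * rho v)); last first.
  by move=> S /eqP Sk; rewrite E Sk.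
rewrite sumr_const.
have -> : #|[pred S : {set 'I_r} | #|S| == k]| = 'C(r, k).
  by rewrite -[X in 'C(X, _)]card_ord -card_draws; apply: eq_card => S; rewrite !inE.
rewrite -[_ * _ *+ 'C(r, k)]mulr_natl mulKf //.
by rewrite pnatr_eq0 -lt0n bin_gt0.
Qed.

Definition in_span_plus r (be : @cov R m r) : Prop :=
  exists rho : 'I_r.+1 -> @cov R m r,
  [/\ forall k, is_cov (rho k), forall k, pullback p (rho k) = rho k &
      forall v, be v = \sum_(k < r.+1) plus_iso J k (rho k) v].

Lemma in_span_plus_scalJ r (be : @cov R m r) rho s t v :
  (forall k, is_cov (rho k)) -> (forall k, pullback p (rho k) = rho k) ->
  (forall v, be v = \sum_(k < r.+1) plus_iso J k (rho k) v) ->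
  be (v *m (p *m scalJ s t)) =
  \sum_(k < r.+1) (- t) ^+ k * s ^+ (r - k) * rho k v.
Proof.
move=> crho prho ->; apply: eq_bigr => k _.
by rewrite plus_iso_scalJ // -ltnS.
Qed.

Lemma in_span_plus_inj r (al be : @cov R m r) :
  in_span_plus al -> in_span_plus be ->
  (forall v (N : nat), al (v *m (p *m scalJ 1 N%:R)) =
                       be (v *m (p *m scalJ 1 N%:R))) -> al = be.
Proof.
move=> [rho [crho prho Eal]] [sig [csig psig Ebe]] H.
have Erho k : rho k = sig k.
  apply/funext => v.
  have /(_ k) : forall k : 'I_r.+1, (-1) ^+ k * (rho k v - sig k v) = 0.
    apply: horner_nat_eq0 => N; have := H v N.
    rewrite (in_span_plus_scalJ _ _ _ crho prho Eal).
    rewrite (in_span_plus_scalJ _ _ _ csig psig Ebe) => /eqP.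
    rewrite -subr_eq0 -sumrB => /eqP E; rewrite -[RHS]E; apply: eq_bigr => l _.
    by rewrite expr1n !mulr1 (exprNn N%:R) mulrBr mulrBl mulrAC [in X in _ - X]mulrAC.
  by move/eqP; rewrite mulf_eq0 signr_eq0 /= subr_eq0 => /eqP.
by apply/funext => v; rewrite Eal Ebe; apply: eq_bigr => k _; rewrite Erho.
Qed.

(* The unique element of Lambda_+ that agrees with al on the vectors           *)
(* v pi10 (s + t J).                                                           *)
Definition proj_plus r (al : @cov R m r) : @cov R m r := fun v =>
  \sum_(k < r.+1) plus_iso J k (fun w => (-1) ^+ k * 'C(r, k)%:R *
                                   plus_iso J k al (w *m p)) v.

Lemma proj_plus_in_span r (al : @cov R m r) : is_cov al ->
  in_span_plus (proj_plus al).
Proof.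
move=> cal; exists (fun k w => (-1) ^+ k * 'C(r, k)%:R * plus_iso J k al (w *m p)).
split=> [k|k|v].
- by apply: cov_scale; exact: (cov_pullback p (cov_plus_iso k cal)).
- by apply/funext => v; rewrite /pullback -mulmxA pi10_idem.
- by rewrite /proj_plus.
Qed.

Lemma proj_plus_scalJ r (al : @cov R m r) s t v : is_cov al ->
  proj_plus al (v *m (p *m scalJ s t)) = al (v *m (p *m scalJ s t)).
Proof.
move=> cal; rewrite [in RHS]mulmxA multilinear_scalJ; last by case: cal.
have crho (k : 'I_r.+1) := cov_scale ((-1) ^+ k * 'C(r, k)%:R)
  (cov_pullback p (cov_plus_iso k cal)).
have prho (k : 'I_r.+1) : pullback p (fun w => (-1) ^+ k * 'C(r, k)%:R *
    pullback p (plus_iso J k al) w) = fun w => (-1) ^+ k * 'C(r, k)%:R *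
    pullback p (plus_iso J k al) w.
  by apply/funext => w; rewrite /pullback -mulmxA pi10_idem.
rewrite (in_span_plus_scalJ _ _ _ crho prho) //.
have alg (e x y z w : C) : e ^+ 2 = 1 ->
    e * x * y * (e * z * w) = x * y * (z * w).
  by move=> e2; transitivity (e ^+ 2 * (x * y * (z * w))); [ring|rewrite e2 mul1r].
by apply: eq_bigr => k _; rewrite (exprNn t) /pullback alg // sqrr_sign.
Qed.

Lemma sym_family_plus_iso r (rho : @cov R m r) : is_cov rho ->
  pullback p rho = rho -> sym_family I J K (fun k : 'I_r.+1 => plus_iso J k rho).
Proof.
move=> crho prho; have [mrho _] := crho.
split=> [k|a b c d _ k v]; first exact: cov_plus_iso.
set Q := cmx _; set z := a +i* b; set u := c -i* d.
pose e (k : 'I_r.+1) := plus_iso J k rho (v *m Q) -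
   \sum_(j < r.+1) sym_coef r z u k j * plus_iso J j rho v.
suff /(_ k)/eqP : forall k : 'I_r.+1, 'C(r, k)%:R * e k = 0.
  rewrite mulf_eq0 pnatr_eq0 -leqn0 leqNgt bin_gt0 -ltnS ltn_ord /=.
  by rewrite subr_eq0 => /eqP.
apply: horner_nat_eq0 => {k} N; set t : C := N%:R.
have E1 : \sum_(k < r.+1) t ^+ k * ('C(r, k)%:R * plus_iso J k rho (v *m Q)) =
    rho (v *m Q *m scalJ 1 t).
  rewrite multilinear_scalJ //; apply: eq_bigr => k _.
  by rewrite expr1n mulr1.
have E2 : rho (v *m Q *m scalJ 1 t) =
    rho (v *m scalJ (z - conjc u * t) (u + conjc z * t)).
  have prv w : rho w = rho (w *m p) by rewrite -{1}prho.
  rewrite [LHS]prv [RHS]prv -!mulmxA [Q *m _]mulmxA /Q quat_scalJ_pi10.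
  by rewrite !mulr1.
have Epoly : \sum_(k < r.+1) (t ^+ k * 'C(r, k)%:R) *:
    ((z%:P + u *: 'X) ^+ (r - k) * (- (conjc u)%:P + conjc z *: 'X) ^+ k) =
    ((z - conjc u * t)%:P + (u + conjc z * t) *: 'X) ^+ r.
  have -> : (z - conjc u * t)%:P + (u + conjc z * t) *: 'X =
     (z%:P + u *: 'X) + t *: (- (conjc u)%:P + conjc z *: 'X) :> {poly C}.
    rewrite polyCB polyCM !scalerDl scalerDr scalerN -!mul_polyC.
    by rewrite !polyCM; ring.
  rewrite exprDn; apply: eq_bigr => k _.
  by rewrite exprZn -scalerAr scalerMnl mulr_natr.
rewrite /e; under eq_bigr => k _.
  rewrite mulrBr mulrBl.
  over.
rewrite sumrB; apply/eqP; rewrite subr_eq0; apply/eqP.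
transitivity (rho (v *m Q *m scalJ 1 t)).
  by rewrite -E1; apply: eq_bigr => k _; rewrite mulrC.
rewrite E2 multilinear_scalJ //.
have Ecoef (j : 'I_r.+1) : 
   (u + conjc z * t) ^+ j * (z - conjc u * t) ^+ (r - j) * 'C(r, j)%:R =
   \sum_(k < r.+1) (t ^+ k * 'C(r, k)%:R) * sym_coef r z u k j.
  transitivity (((z - conjc u * t)%:P + (u + conjc z * t) *: 'X) ^+ r : {poly C})`_j.
    rewrite [in RHS]exprDn coef_sum (bigD1 j) //= big1 ?addr0 => [|i ij].
      rewrite coefMn exprZn -scalerAr -polyC_exp mul_polyC coefZ coefZ coefXn.
      by rewrite eqxx mulr1 mulr_natr.
    rewrite coefMn exprZn -scalerAr -polyC_exp mul_polyC !coefZ coefXn.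
    by rewrite eq_sym (negPf (ij : (i != j :> nat))) !mulr0 mul0rn.
  rewrite -Epoly coef_sum; apply: eq_bigr => k _.
  by rewrite coefZ.
under eq_bigr => j _ do rewrite mulrA Ecoef mulr_suml.
rewrite exchange_big /=; apply: eq_bigr => k _.
rewrite mulr_sumr mulr_suml; apply: eq_bigr => j _.
move: (plus_iso _ _ _ _) (sym_coef _ _ _ _ _) => x y; ring.
Qed.

End Rep.

Section Rop.
Context {R : realType} {m : nat}.
Local Notation C := R[i].
Variables I J K : 'M[R]_m.
Hypotheses (I2 : I *m I = - 1%:M) (J2 : J *m J = - 1%:M).
Hypotheses (IJ : I *m J = K) (JI : J *m I = - K).
Local Notation p := (pi10 I).
Local Notation q := (pi01 I).
Local Notation Jc := (cmx J).
Local Notation quatc a b c d := (cmx (quat I J K a b c d)).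

Lemma pullback_act_rows_quat r (al : @cov R m r) a b S v : multilinear al ->
  al (act_rows S q p v *m quatc a b 0 0) =
  conjc (a +i* b) ^+ #|S| * (a +i* b) ^+ (r - #|S|) * al (act_rows S q p v).
Proof.
move=> mal; rewrite act_rows_mulr (pi10_quat_I J K I2) (pi01_quat_I J K I2).
apply: etrans (multilinear_act_rowsZ S q p _ _ v mal) _.
by rewrite [#|~: S|]cardsCs finset.setCK card_ord.
Qed.

Lemma conjc_circle k r (z : C) a b : z = a +i* b -> a ^+ 2 + b ^+ 2 = 1 ->
  z ^+ k.*2 = -1 -> (k <= r)%N -> conjc z ^+ k * z ^+ (r - k) = - z ^+ r.
Proof.
move=> zE ab z2k kr.
have zz : conjc z * z = 1.
  rewrite zE; apply/eqP; rewrite eq_complex /=; apply/andP; split; apply/eqP.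
    by rewrite mulNr opprK -!expr2.
  by ring.
have {zE ab}: conjc z ^+ k * z ^+ k = 1 by rewrite -exprMn zz expr1n.
have -> : z ^+ r = z ^+ k * z ^+ (r - k) by rewrite -exprD subnKC.
move: z2k; rewrite -addnn exprD; move: (conjc z ^+ k) (z ^+ k) (z ^+ (r - k)).
move=> x y w yy xy; have -> : x = - y; last by rewrite mulNr.
by rewrite -[x]mulr1 -[1]opprK -yy mulrN mulrA xy mul1r.
Qed.

Lemma sym_coef_I r (z : C) j : sym_coef r z 0 0 j = if j == 0%N then z ^+ r else 0.
Proof.
rewrite /sym_coef scale0r addr0 expr0 mulr1 subn0 -polyC_exp coefC.
by [].
Qed.

Lemma sym_coef_J r (z u : C) j : (j <= r)%N ->
  sym_coef r z u 0 j = u ^+ j * z ^+ (r - j) * 'C(r, j)%:R.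
Proof.
move=> jr; rewrite /sym_coef expr0 mulr1 subn0.
pose j' := Ordinal (jr : (j < r.+1)%N).
rewrite exprDn coef_sum (bigD1 j') //= big1 ?addr0 => [|i ij].
  rewrite coefMn exprZn -scalerAr -polyC_exp mul_polyC coefZ coefZ coefXn.
  by rewrite eqxx mulr1 mulr_natr.
rewrite coefMn exprZn -scalerAr -polyC_exp mul_polyC !coefZ coefXn.
by rewrite eq_sym (negPf (ij : (i != j' :> nat))) !mulr0 mul0rn.
Qed.

Lemma sym_family_pi10 r (t : 'I_r.+1 -> @cov R m r) : sym_family I J K t ->
  pullback p (t ord0) = t ord0.
Proof.
move=> [ct Ht]; have [m0 _] := ct ord0.
apply/funext => v; rewrite /pullback -{2}[v]mulmx1 -(pi10D01 I) addrC.
rewrite multilinear_mulmxD // (bigD1 finset.set0) //= act_rows0 big1 ?addr0 //.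
move=> S; rewrite -card_gt0 => S0.
have Sr : (#|S| <= r)%N by rewrite -[X in (_ <= X)%N]card_ord max_card.
have [a [b [ab zS]]] := @circle_root R _ S0.
have u1 : unit_quat a b 0 0 by rewrite /unit_quat expr0n !addr0.
have := Ht a b 0 0 u1 ord0 (act_rows S q p v); rewrite /pullback.
rewrite pullback_act_rows_quat // (conjc_circle erefl ab zS Sr).
rewrite oppr0 (bigD1 ord0) //= sym_coef_I /= big1 ?addr0; last first.
  by move=> j j0; rewrite sym_coef_I ifN ?mul0r.
move/eqP; rewrite mulNr eq_sym -addr_eq0 -mulr2n mulrn_eq0 /= mulf_eq0.
rewrite expf_eq0 => /orP[/andP[_ /eqP z0]|/eqP->//].
move: zS => /eqP; rewrite z0 expr0n double_eq0 (gtn_eqF S0) eq_sym.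
by rewrite oppr_eq0 oner_eq0.
Qed.

Lemma sym_familyE r (t : 'I_r.+1 -> @cov R m r) : sym_family I J K t ->
  forall k v, t k v = plus_iso J k (t ord0) v.
Proof.
move=> st; have [ct Ht] := st; have [m0 _] := ct ord0.
have p0 := sym_family_pi10 st; move=> k v.
suff /(_ k)/eqP : forall k : 'I_r.+1,
    'C(r, k)%:R * (t k v - plus_iso J k (t ord0) v) = 0.
  rewrite mulf_eq0 pnatr_eq0 -leqn0 leqNgt bin_gt0 -ltnS ltn_ord /=.
  by rewrite subr_eq0 => /eqP.
apply: horner_nat_eq0 => {k} N.
have [a [a0 u1]] := @unit_circle_J R N.
have uq : unit_quat a 0 (a * N%:R) 0 by rewrite /unit_quat expr0n !addr0.
have := Ht _ _ _ _ uq ord0 v.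
rewrite /pullback quat_J multilinear_scalJ // oppr0 => /eqP.
rewrite -subr_eq0 -sumrB => /eqP E.
have ar : a%:C ^+ r != 0 :> C by rewrite expf_neq0 // -[0]/(0%:C) (inj_eq (@complexI _)).
apply: (mulfI ar); rewrite mulr0 -[RHS]oppr0 -[in RHS]E mulr_sumr -sumrN.
apply: eq_bigr => k _.
have kr : (k <= r)%N by rewrite -ltnS.
rewrite (sym_coef_J a%:C (a * N%:R)%:C kr).
have -> : a%:C ^+ r = a%:C ^+ k * a%:C ^+ (r - k) :> C.
  by rewrite -exprD subnKC // -ltnS.
have -> : (a * N%:R)%:C = a%:C * N%:R :> C by rewrite rmorphM rmorph_nat.
rewrite exprMn.
have alg (x y w c X Y : C) :
  x * y * (c * (X - Y) * w) = - (x * w * y * (c * Y) - x * w * y * c * X).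
  by ring.
exact: alg.
Qed.

Lemma in_span_plus_Lambda r (be : @cov R m r) :
  in_span_plus I J be <-> Lambda_plus I J K be.
Proof.
split=> [[rho [crho prho E]]|[N [t [a [st E]]]]].
  exists r.+1, (fun i k => plus_iso J k (rho i)), (fun i k => (i == k)%:R).
  split=> [i|v]; first exact: sym_family_plus_iso.
  rewrite E; apply: eq_bigr => i _; rewrite (bigD1 i) //= eqxx mul1r big1 ?addr0 //.
  by move=> k ki; rewrite eq_sym (negPf ki) mul0r.
exists (fun k v => \sum_i a i k * t i ord0 v); split=> [k|k|v].
- by apply: cov_sum => i _; apply: cov_scale; case: (st i).
- apply/funext => v; apply: eq_bigr => i _.
  by have := sym_family_pi10 (st i) => /(congr1 (@^~ v)) <-.
rewrite E exchange_big; apply: eq_bigr => k _ /=.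
by rewrite plus_iso_sum; apply: eq_bigr => i _; rewrite (sym_familyE (st i)).
Qed.

Lemma Lambda_plus_cov r (be : @cov R m r) : Lambda_plus I J K be -> is_cov be.
Proof.
move=> [N [t [a [st E]]]]; have -> := funext E.
apply: cov_sum => i _; apply: cov_sum => k _; apply: cov_scale.
by case: (st i).
Qed.

Lemma Lambda_plus_quat r (be : @cov R m r) a b c d : unit_quat a b c d ->
  Lambda_plus I J K be -> Lambda_plus I J K (pullback (quatc a b c d) be).
Proof.
move=> uq [N [t [x [st E]]]].
exists N, t, (fun i j => \sum_(k < r.+1) x i k * sym_coef r (a +i* b) (c -i* d) k j).
split=> // v; rewrite /pullback E; apply: eq_bigr => i _.
have [_ Ht] := st i.
under eq_bigr => k _ do rewrite -/(pullback _ (t i k) v) Ht // mulr_sumr.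
rewrite exchange_big; apply: eq_bigr => j _ /=.
by rewrite mulr_suml; apply: eq_bigr => k _; rewrite mulrA.
Qed.

Lemma pi10_scalJ_quat a b c d s t :
  p *m scalJ J s t *m quatc a b c d =
  p *m scalJ J ((a +i* b) * s - (c -i* d) * t) ((c +i* d) * s + (a -i* b) * t).
Proof.
rewrite (cmx_quat I J K a b c d) (cmxK IJ) /scalJ.
apply: (scal_mulmx_quat (j := 'i%C));
  [rewrite sqrCi|exact: cmxI2|exact: (cmxJI IJ JI)|exact: pi10_cmxI|..] => //;
  by apply/eqP; rewrite eq_complex /=; apply/andP; split; apply/eqP; ring.
Qed.

Lemma proj_plus_quat r (al : @cov R m r) a b c d : unit_quat a b c d ->
  is_cov al ->
  proj_plus I J (pullback (quatc a b c d) al) =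
  pullback (quatc a b c d) (proj_plus I J al).
Proof.
move=> uq cal; have cQal := cov_pullback (quatc a b c d) cal.
apply: (in_span_plus_inj I2 J2 IJ JI).
- exact: proj_plus_in_span.
- apply/in_span_plus_Lambda; apply: Lambda_plus_quat => //.
  by apply/in_span_plus_Lambda; exact: proj_plus_in_span.
- move=> v N; rewrite (proj_plus_scalJ I2 J2 IJ JI _ _ _ cQal) /pullback.
  rewrite -[v *m _ *m quatc a b c d]mulmxA pi10_scalJ_quat.
  by rewrite (proj_plus_scalJ I2 J2 IJ JI _ _ _ cal).
Qed.

Lemma Lambda_plus_proj r (al : @cov R m r) : is_cov al ->
  Lambda_plus I J K (proj_plus I J al).
Proof. by move=> cal; apply/in_span_plus_Lambda; exact: proj_plus_in_span. Qed.

Lemma proj_plus_eq r (al be : @cov R m r) : is_cov al -> Lambda_plus I J K be ->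
  (forall v (N : nat), be (v *m (p *m scalJ J 1 N%:R)) =
                       al (v *m (p *m scalJ J 1 N%:R))) ->
  be = proj_plus I J al.
Proof.
move=> cal /in_span_plus_Lambda Lbe H.
apply: (in_span_plus_inj I2 J2 IJ JI) => //; first exact: proj_plus_in_span.
by move=> v N; rewrite H (proj_plus_scalJ I2 J2 IJ JI _ _ _ cal).
Qed.

Lemma proj_plus_equivariant r : equivariant_projection I J K (@proj_plus R m I J r).
Proof.
split.
- move=> a al be cal cbe; apply/funext => v.
  rewrite /proj_plus mulr_sumr -big_split; apply: eq_bigr => k _ /=.
  rewrite -plus_iso_comb; congr (plus_iso J k _ v); apply/funext => w.
  by rewrite plus_iso_comb mulrDr mulrCA.
- by move=> a b c d al uq cal; exact: proj_plus_quat.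
- by move=> al cal; exact: Lambda_plus_proj.
- move=> al Lal; apply/esym/proj_plus_eq => //; exact: Lambda_plus_cov Lal.
Qed.

Section Projection.
Variables (r : nat) (P : @cov R m r -> @cov R m r).
Hypothesis (HP : equivariant_projection I J K P).

Lemma eproj_comb a (al be : @cov R m r) : is_cov al -> is_cov be ->
  P (fun v => a * al v + be v) = (fun v => a * P al v + P be v).
Proof. by case: HP => + _ _ _; apply. Qed.

Lemma eproj_quat a b c d (al : @cov R m r) : unit_quat a b c d -> is_cov al ->
  P (pullback (quatc a b c d) al) = pullback (quatc a b c d) (P al).
Proof. by case: HP => _ + _ _; apply. Qed.

Lemma eproj_Lambda (al : @cov R m r) : is_cov al -> Lambda_plus I J K (P al).
Proof. by case: HP => _ _ + _; apply. Qed.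

Lemma eproj_id (al : @cov R m r) : Lambda_plus I J K al -> P al = al.
Proof. by case: HP => _ _ _; apply. Qed.

Lemma eproj_scale a (al : @cov R m r) : is_cov al ->
  P (fun v => a * al v) = (fun v => a * P al v).
Proof.
move=> cal; have c0 := @cov0 R m r.
have P0 : P (fun=> 0) = fun=> 0.
  have := eproj_comb (-1) c0 c0; have -> : (fun v : 'M[C]_(r, m) => -1 * 0 + 0) = (fun=> 0 : C).
    by apply/funext => v; rewrite mulr0 addr0.
  by move=> ->; apply/funext => v; rewrite mulN1r addNr.
have := eproj_comb a cal c0; rewrite P0.
have -> : (fun v => a * al v + 0) = (fun v => a * al v).
  by apply/funext => v; rewrite addr0.
by move=> ->; apply/funext => v; rewrite addr0.
Qed.

(* The (r,0)-part of a covector is obtained by averaging, for j = 1, .., r,    *)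
(* with its normalised pullback by a unit z of R + R I such that z^(2j) = -1,  *)
(* which kills the (r-j,j)-part; hence it commutes with every equivariant map. *)
Lemma eproj_averaging k : (k <= r)%N -> exists E : @cov R m r -> @cov R m r,
  [/\ forall al, is_cov al -> is_cov (E al),
      forall al, is_cov al -> P (E al) = E (P al),
      forall al v, is_cov al -> E al (v *m p) = al (v *m p) &
      forall al (S : {set 'I_r}) v, is_cov al -> (0 < #|S| <= k)%N ->
        E al (act_rows S q p v) = 0].
Proof.
elim: k => [_|k IH kr].
  exists id; split=> // be S v _ /andP[S0].
  by rewrite leqNgt S0.
have [E [cE PE E0 ES]] := IH (ltnW kr).
have [a [b [ab zk]]] := @circle_root R _ (ltn0Sn k).
have uq : unit_quat a b 0 0 by rewrite /unit_quat expr0n !addr0.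
pose z := a +i* b.
have zr0 : z ^+ r != 0.
  rewrite expf_neq0 //; apply: contra_eq_neq zk => z0.
  by rewrite -/z z0 expr0n /= eq_sym oppr_eq0 oner_eq0.
exists (fun be v => 2^-1 * (z ^- r * E be (v *m quatc a b 0 0) + E be v)).
split.
- move=> be cbe; apply: cov_scale.
  apply: (cov_comb _ (cov_pullback (quatc a b 0 0) _)); exact: cE.
- move=> be cbe.
  have cQ := cov_pullback (quatc a b 0 0) (cE _ cbe).
  rewrite (eproj_scale 2^-1 (cov_comb (z ^- r) cQ (cE _ cbe))).
  rewrite (eproj_comb _ cQ (cE _ cbe)) eproj_quat //; last exact: cE.
  by rewrite PE.
- move=> be v cbe; have [mE _] := cE _ cbe.
  rewrite /= -(act_rows0 q p v) pullback_act_rows_quat // cards0 expr0 mul1r subn0.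
  rewrite mulKf // act_rows0 E0 // -/z; move: (be _) => x.
  by field.
- move=> be S v cbe /andP[S0 Sk]; have [mE _] := cE _ cbe.
  rewrite /= pullback_act_rows_quat //.
  have [Sk'|Sk'] := ltnP k #|S|; last by rewrite ES ?S0 // !mulr0 addr0 mulr0.
  have -> : #|S| = k.+1 by apply/eqP; rewrite eqn_leq Sk.
  rewrite (conjc_circle erefl ab zk kr) -/z mulNr mulrN mulKf //.
  by rewrite addNr mulr0.
Qed.

Lemma eproj_pi10 (al : @cov R m r) : is_cov al ->
  P (pullback p al) = pullback p (P al).
Proof.
move=> cal; have [E [cE PE E0 ES]] := eproj_averaging (leqnn r).
have Ep be : is_cov be -> E be = pullback p be.
  move=> cbe; apply/funext => v; have [mE _] := cE _ cbe.
  rewrite -[in LHS](mulmx1 v) -(pi10D01 I) addrC multilinear_mulmxD //.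
  rewrite (bigD1 finset.set0) //= act_rows0 E0 // big1 ?addr0 // => S S0.
  by apply: ES => //; rewrite card_gt0 S0 -[X in (_ <= X)%N]card_ord max_card.
rewrite -!Ep ?PE //.
exact/Lambda_plus_cov/eproj_Lambda.
Qed.

Lemma Lambda_plus_r0 (al : @cov R m r) : is_cov al ->
  Lambda_plus I J K (pullback p al).
Proof.
move=> cal; apply/in_span_plus_Lambda.
have c0 := cov_pullback p cal.
exists (fun k v => (k == ord0)%:R * pullback p al v); split=> [k|k|v].
- exact: cov_scale.
- by apply/funext => v; rewrite /pullback -mulmxA pi10_idem.
rewrite (bigD1 ord0) //= big1 ?addr0 => [|k /negPf k0].
  rewrite /plus_iso bin0 invr1 mul1r (big_pred1 finset.set0) => [|S].
    by rewrite act_rows0 mulmx1 mul1r.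
  by rewrite cards_eq0.
rewrite /plus_iso big1 ?mulr0 // => S _.
by rewrite k0 mul0r.
Qed.

Lemma eproj_proj_plus (al : @cov R m r) : is_cov al -> P al = proj_plus I J al.
Proof.
move=> cal; apply: proj_plus_eq => //; first exact: eproj_Lambda.
have E0 be : is_cov be -> pullback p (P be) = pullback p be.
  by move=> cbe; rewrite -eproj_pi10 // eproj_id //; exact: Lambda_plus_r0.
move=> v N; have [a [a0 u1]] := @unit_circle_J R N.
have uq : unit_quat a 0 (a * N%:R) 0 by rewrite /unit_quat expr0n !addr0.
have cP := Lambda_plus_cov (eproj_Lambda cal).
have cQ := cov_pullback (quatc a 0 (a * N%:R) 0) cal.
have /(congr1 (@^~ v)) := E0 _ cQ; rewrite eproj_quat // /pullback quat_J.
have -> : scalJ J a%:C (a * N%:R)%:C = a%:C *: scalJ J 1 N%:R.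
  by rewrite rmorphM rmorph_nat scalerDr !scalerA mulr1.
have scl (be : @cov R m r) w : is_cov be -> be (a%:C *: w) = a%:C ^+ r * be w.
  move=> cbe; rewrite -mul_scalar_mx alternating_det // det_scalar.
  by [].
have ar : a%:C ^+ r != 0 :> C by rewrite expf_neq0 // -[0]/(0%:C) (inj_eq (@complexI _)).
by rewrite -!mulmxA -!scalemxAr (scl _ _ cP) (scl _ _ cal) => /(mulfI ar).
Qed.

End Projection.

Lemma P_plusE r (al : @cov R m r) : is_cov al ->
  P_plus I J K al = proj_plus I J al.
Proof.
move=> cal; apply: eproj_proj_plus => //.
rewrite /P_plus; apply: (xgetPex _ (P := [set P | equivariant_projection I J K P])).
by exists (@proj_plus R m I J r); exact: proj_plus_equivariant.
Qed.

(* Pullback by Rmx is alpha |-> alpha on (1,0)-covectors and                   *)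
(* beta |-> - beta o J = J^{-1} beta on (0,1)-covectors.                       *)
Definition Rmx : 'M[C]_m := p *m scalJ J 1 (-1).

Lemma Rmx_pi10 : p *m Rmx = Rmx.
Proof. by rewrite /Rmx mulmxA pi10_idem. Qed.

Lemma plus_iso_pi10_eq0 p' q' r k (al : @cov R m r) v : is_pq I p' q' al ->
  k != q' -> plus_iso J k al (v *m p) = 0.
Proof.
move=> pal kq; have [cal _] := pal.
rewrite /plus_iso big1 ?mulr0 // => S /eqP Sk.
rewrite act_rows_mull mulmx1.
have -> : act_rows S (p *m Jc) p v = act_rows S q p (act_rows S (p *m Jc) p v).
  apply/row_matrixP => i; rewrite !row_act_rows; case: ifP => _; rewrite -!mulmxA.
    by rewrite (J_pi01 IJ JI) [p *m (p *m Jc)]mulmxA pi10_idem.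
  by rewrite pi10_idem.
by apply: ((is_pqP I2 p' q' cal).1 pal); rewrite Sk (negPf kq) andbF.
Qed.

Lemma proj_plus_pq p' q' r (al : @cov R m r) : (p' + q' = r)%N ->
  is_pq I p' q' al ->
  proj_plus I J al = plus_iso J q' (pullback Rmx al).
Proof.
move=> pqr pal; have [cal _] := pal; have [mal _] := cal.
have qr : (q' < r.+1)%N by rewrite ltnS -pqr leq_addl.
pose k0 := Ordinal qr.
apply/funext => v; rewrite /proj_plus (bigD1 k0) //= [X in _ + X]big1 ?addr0.
  congr (plus_iso J q' _ v); apply/funext => w.
  rewrite /pullback /Rmx mulmxA multilinear_scalJ // (bigD1 k0) //=.
  rewrite [X in _ + X]big1 ?addr0 ?expr1n ?mulr1 ?mulrA // => k kk0.
  by rewrite (plus_iso_pi10_eq0 _ pal) ?mulr0.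
move=> k kk0; rewrite /plus_iso big1 ?mulr0 // => S _.
by rewrite -/(plus_iso J k al _) (plus_iso_pi10_eq0 _ pal) ?mulr0.
Qed.

Lemma pullback_Rmx_pq r (al : @cov R m r) : is_cov al ->
  is_pq I r 0 (pullback Rmx al).
Proof.
move=> cal; split; first exact: cov_pullback.
by rewrite pq_part_k0; apply/funext => v; rewrite /pullback -mulmxA Rmx_pi10.
Qed.

Lemma RopE p' q' r (al : @cov R m r) : (p' + q' = r)%N -> is_pq I p' q' al ->
  Rop I J K q' al = pullback Rmx al.
Proof.
move=> pqr pal; have [cal _] := pal.
have E : P_plus I J K al = plus_iso J q' (pullback Rmx al).
  by rewrite P_plusE // (proj_plus_pq pqr pal).
have qr : (q' <= r)%N by rewrite -pqr leq_addl.
have [[crho prho] Erho] : is_pq I r 0 (Rop I J K q' al) /\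
    plus_iso J q' (Rop I J K q' al) = P_plus I J K al.
  rewrite /Rop; apply: (xgetPex _ (P := [set rho | is_pq I r 0 rho /\
     plus_iso J q' rho = P_plus I J K al])).
  by exists (pullback Rmx al); split; [exact: pullback_Rmx_pq|rewrite E].
have [cR pR] := pullback_Rmx_pq cal.
rewrite !pq_part_k0 in prho pR.
have {}Erho : plus_iso J q' (Rop I J K q' al) = plus_iso J q' (pullback Rmx al).
  by rewrite Erho E.
apply/funext => v; move: Erho => /(congr1 (@^~ (v *m (p *m scalJ J 1 (-1))))).
rewrite !(plus_iso_scalJ I2 J2 IJ JI) // opprK !expr1n !mul1r.
by [].
Qed.

End Rop.

(** * Smooth functions *)

Section Calculus.
Context {R : realType} {m : nat}.
Local Notation V := 'rV[R]_m.
Implicit Types (f g : V -> R) (U : set V) (x u v : V).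
Local Open Scope classical_set_scope.

Lemma near_eq_differentiable f g x :
  (\near x, f x = g x) -> differentiable f x -> differentiable g x.
Proof.
move=> fg df.
have -> : g = f + (g - f) by rewrite addrC subrK.
apply: differentiableD => //; set h := g - f.
have h0 : \forall y \near x, h y = 0.
  near=> y; apply/eqP; rewrite /h fctE subr_eq0; apply/eqP/esym.
  by near: y.
have E : h \o shift x = cst (h x) + (0 : V -> R) +o_ (0 : V) id.
  apply/eqaddoP => _ /posnumP[e].
  have : \forall y \near (0 : V), h (y + x) = 0.
    by move: h0; rewrite (near_shift 0) subr0.
  apply: filterS => y hy.
  rewrite !fctE /= hy (nbhs_singleton h0).
  by rewrite (_ : (0 : V -> R) y = 0) // addr0 subr0 normr0 mulr_ge0.
have c0 : continuous (0 : V -> R) by exact: cst_continuous.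
have d0 : 'd h x = 0 :> (V -> R) by apply/diff_unique.
by apply/diff_locallyP; rewrite d0.
Unshelve. all: by end_near. Qed.

Lemma open_near U x (P : V -> Prop) : open U -> U x ->
  (forall y, U y -> P y) -> \near x, P x.
Proof.
by move=> oU Ux H; near=> y; apply: H; near: y; exact: open_nbhs_nbhs.
Unshelve. all: by end_near. Qed.

Lemma Ck_ext k U f g : open U -> (forall x, U x -> f x = g x) ->
  Ck k U f -> Ck k U g.
Proof.
move=> oU; elim: k f g => [|k IH] f g fg /=.
  move=> cf x Ux; rewrite /prop_for /continuous_at -fg //.
  have H : \near x, f x = g x by apply: (open_near oU Ux) => y Uy; rewrite fg.
  by apply: cvg_trans (cf x Ux); exact: (near_eq_cvg H).
move=> [df Cf]; split=> [x Ux|v].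
  apply: near_eq_differentiable (df x Ux).
  by apply: (open_near oU Ux) => y Uy; rewrite fg.
apply: IH (Cf v) => x Ux; apply: near_eq_derive.
by apply: (open_near oU Ux) => y Uy; rewrite fg.
Qed.

Lemma smooth_ext U f g : open U -> (forall x, U x -> f x = g x) ->
  smooth U f -> smooth U g.
Proof. by move=> oU fg sf k; apply: Ck_ext (sf k). Qed.

Lemma smooth_differentiable U f x : smooth U f -> U x -> differentiable f x.
Proof. by move=> sf; have [df _] := sf 1%N; apply: df. Qed.

Lemma smooth_continuous U f x : smooth U f -> U x -> {for x, continuous f}.
Proof. by move=> sf; apply: (sf 0%N). Qed.

Lemma smooth_derive U f v : smooth U f -> smooth U ('D_v f).
Proof. by move=> sf k; have [_] := sf k.+1; apply. Qed.

Lemma smooth_cst U (a : R) : smooth U (fun=> a).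
Proof.
move=> k; elim: k a => [|k IH] a /=; first by move=> x _; exact: cst_continuous.
split=> [x _|v]; first exact: differentiable_cst.
have -> : (fun x => 'D_v (fun=> a) x) = fun=> 0 by apply/funext => x; rewrite derive_cst.
exact: IH.
Qed.

Lemma CkD k U f g : open U -> Ck k U f -> Ck k U g ->
  Ck k U (fun x => f x + g x).
Proof.
move=> oU; elim: k f g => [|k IH] f g /=.
  by move=> sf sg x Ux; exact: (continuousD (sf x Ux) (sg x Ux)).
move=> [df cf] [dg cg]; split=> [x Ux|v].
  by apply: differentiableD; [exact: df|exact: dg].
apply: (@Ck_ext _ U (fun x => 'D_v f x + 'D_v g x)) => //.
  move=> x Ux; rewrite -deriveD //; apply: diff_derivable; [exact: df|exact: dg].
by apply: IH.
Qed.

Lemma smoothD U f g : open U -> smooth U f -> smooth U g ->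
  smooth U (fun x => f x + g x).
Proof. by move=> oU sf sg k; apply: CkD. Qed.

Lemma smoothM U f g : open U -> smooth U f -> smooth U g ->
  smooth U (fun x => f x * g x).
Proof.
move=> oU sf sg k; elim: k f g sf sg => [|k IH] f g sf sg /=.
  move=> x Ux.
  exact: (continuousM (smooth_continuous sf Ux) (smooth_continuous sg Ux)).
split=> [x Ux|v].
  by apply: differentiableM; [exact: smooth_differentiable sf Ux|exact: smooth_differentiable sg Ux].
apply: (@Ck_ext _ U (fun x => f x * 'D_v g x + g x * 'D_v f x)) => //.
  move=> x Ux; rewrite -deriveM //; apply: diff_derivable.
    exact: smooth_differentiable sf Ux.
  exact: smooth_differentiable sg Ux.
have {}IH h h' : smooth U h -> smooth U h' -> Ck k U (fun x => h x * 'D_v h' x).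
  by move=> sh sh'; apply: IH => //; exact: smooth_derive.
by apply: CkD => //; apply: IH.
Qed.

Lemma smoothN U f : open U -> smooth U f -> smooth U (fun x => - f x).
Proof.
move=> oU sf; apply: (@smooth_ext U (fun x => -1 * f x)) => //.
  by move=> x _; rewrite mulN1r.
by apply: smoothM => //; exact: smooth_cst.
Qed.

Definition second_difference f x u v (h : R) : R :=
  f (x + h *: u + h *: v) - f (x + h *: u) - (f (x + h *: v) - f x).

Lemma is_derive_line f u w (s : R) : differentiable f (w + s *: u) ->
  is_derive s 1 (fun t => f (w + t *: u)) ('D_u f (w + s *: u)).
Proof.
move=> df; set L := fun t : R => w + t *: u.
have dL : is_diff s L ( *:%R^~ u).
  by apply: is_diff_eq (is_diffD _ _) _; apply/funext => t /=; rewrite !fctE add0r.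
have dfL : differentiable (f \o L) s by apply: differentiable_comp.
apply: DeriveDef; first exact: diff_derivable.
rewrite deriveE // diff_comp //= deriveE //.
by rewrite diff_val scale1r.
Qed.

Lemma second_difference_bound U f x u v (e : R) : open U -> U x ->
  smooth U f -> 0 < e -> exists2 d : R, 0 < d &
  forall h, 0 < h < d ->
    `|second_difference f x u v h - h ^+ 2 * 'D_v ('D_u f) x| <= e * h ^+ 2.
Proof.
move=> oU Ux sf e0; set A := 'D_v ('D_u f) x.
have sD := smooth_derive v (smooth_derive u sf).
have : \near x, U x /\ `|A - 'D_v ('D_u f) x| <= e.
  near=> y; split; first by near: y; exact: open_nbhs_nbhs.
  near: y; have := smooth_continuous sD Ux.
  by move/cvgrPdist_le => /(_ e e0).
move=> /nbhs_ballP[r /= r0 Hr].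
have n0 : 0 < `|u| + `|v| + 1 by rewrite ltr_wpDl // addr_ge0.
exists (r / (`|u| + `|v| + 1)); first exact: divr_gt0.
move=> h /andP[h0 hd].
have inU s t : 0 <= s <= h -> 0 <= t <= h ->
   U (x + s *: u + t *: v) /\ `|A - 'D_v ('D_u f) (x + s *: u + t *: v)| <= e.
  move=> /andP[s0 sh] /andP[t0 th]; apply: Hr.
  rewrite -ball_normE /= -[x + _ + _]addrA opprD addrA subrr add0r normrN.
  apply: le_lt_trans (ler_normD _ _) _; rewrite !normrZ !ger0_norm //.
  apply: (@le_lt_trans _ _ (h * (`|u| + `|v| + 1))).
    have : s * `|u| <= h * `|u| by rewrite ler_wpM2r.
    have : t * `|v| <= h * `|v| by rewrite ler_wpM2r.
    move: (s * _) (t * _) => p q; rewrite !mulrDr mulr1; lra.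
  by rewrite -ltr_pdivlMr.
have hh : 0 <= h <= h by apply/andP; split=> //; exact: ltW.
have h00 : 0 <= (0 : R) <= h by rewrite lexx ltW.
have itv s : s \in `]0, h[%R -> 0 <= s <= h.
  by rewrite in_itv /= => /andP[? ?]; rewrite !ltW.
have itvc s : s \in `[0, h]%R -> 0 <= s <= h by rewrite in_itv.
pose g s := f (x + h *: v + s *: u) - f (x + s *: u).
have dg s : 0 <= s <= h -> is_derive s 1 g
    ('D_u f (x + h *: v + s *: u) - 'D_u f (x + s *: u)).
  move=> s0; apply: is_deriveB; apply: is_derive_line.
    apply: smooth_differentiable sf _.
    by rewrite -addrA [h *: v + _]addrC addrA; case: (inU _ _ s0 hh).
  apply: smooth_differentiable sf _.
  by have [] := inU _ _ s0 h00; rewrite scale0r addr0.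
have cg : {within `[0, h], continuous g}.
  by apply: derivable_within_continuous => s /itvc /dg [].
have [xi /itv xi0 Exi] := MVT h0 (fun s sI => dg s (itv s sI)) cg.
pose k t := 'D_u f (x + xi *: u + t *: v).
have dk t : 0 <= t <= h -> is_derive t 1 k ('D_v ('D_u f) (x + xi *: u + t *: v)).
  move=> t0; apply: is_derive_line.
  apply: smooth_differentiable (smooth_derive u sf) _.
  by case: (inU _ _ xi0 t0).
have ck : {within `[0, h], continuous k}.
  by apply: derivable_within_continuous => s /itvc /dk [].
have [eta /itv eta0 Eeta] := MVT h0 (fun t tI => dk t (itv t tI)) ck.
have -> : second_difference f x u v h =
    h ^+ 2 * 'D_v ('D_u f) (x + xi *: u + eta *: v).
  have -> : second_difference f x u v h = g h - g 0.
    rewrite /second_difference /g !scale0r !addr0.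
    by rewrite -!addrA [h *: u + h *: v]addrC.
  rewrite Exi subr0 expr2 -[RHS]mulrA [RHS]mulrC [h * _]mulrC; congr (_ * _).
  move: Eeta; rewrite subr0 /k scale0r addr0 => <-.
  by rewrite -!addrA [h *: v + _]addrC.
have [_ H] := inU _ _ xi0 eta0.
rewrite -mulrBr normrM [`|h ^+ 2|]ger0_norm ?sqr_ge0 // distrC mulrC.
by rewrite ler_wpM2r // sqr_ge0.
Unshelve. all: by end_near. Qed.

Lemma second_differenceC f x u v h :
  second_difference f x u v h = second_difference f x v u h.
Proof.
rewrite /second_difference -!addrA [h *: u + _]addrC; congr (_ + _).
by rewrite !opprD !opprK !addrA [- _ - _]addrC.
Qed.

Lemma derive_comm U f x u v : open U -> U x -> smooth U f ->
  'D_v ('D_u f) x = 'D_u ('D_v f) x.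
Proof.
move=> oU Ux sf; set A := LHS; set B := RHS.
apply/eqP; rewrite -subr_eq0 -normr_eq0 eq_le normr_ge0 andbT.
apply/ler_addgt0Pl => e e0; rewrite addr0.
have e20 : 0 < e / 2 by rewrite divr_gt0.
have [d d0 Hd] := second_difference_bound u v oU Ux sf e20.
have [d' d'0 Hd'] := second_difference_bound v u oU Ux sf e20.
pose h := Num.min d d' / 2.
have m0 : 0 < Num.min d d' by rewrite lt_min d0.
have h0 : 0 < h by rewrite divr_gt0.
have hm : h < Num.min d d' by rewrite ltr_pdivrMr // ltr_pMr // ltr1n.
move: hm; rewrite lt_min => /andP[hd hd'].
have {}Hd := Hd h; have {}Hd' := Hd' h.
rewrite h0 /= in Hd Hd'; have {hd}Hd := Hd hd; have {hd'}Hd' := Hd' hd'.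
rewrite second_differenceC in Hd'.
have h2 : 0 < h ^+ 2 by rewrite exprn_gt0.
rewrite -(ler_pM2r h2); apply: le_trans (_ : `|h ^+ 2 * A - h ^+ 2 * B| <= _).
  by rewrite -mulrBr normrM [`|h ^+ 2|]ger0_norm ?sqr_ge0 // mulrC.
have alg (S a b c : R) : `|S - a| <= c -> `|S - b| <= c -> `|a - b| <= c + c.
  move=> Sa Sb; rewrite -[a - b](subrKA S) (le_trans (ler_normD _ _)) //.
  by rewrite [X in X + _]distrC lerD.
have -> : e * h ^+ 2 = e / 2 * h ^+ 2 + e / 2 * h ^+ 2.
  by rewrite -mulrDl -splitr.
exact: alg Hd Hd'.
Qed.

End Calculus.

Section ComplexCalculus.
Context {R : realType} {m : nat}.
Local Notation C := R[i].
Local Notation V := 'rV[R]_m.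
Implicit Types (f g : V -> C) (U : set V) (x : V) (w : 'rV[C]_m).
Local Open Scope classical_set_scope.
Local Notation Re := (@complex.Re R).
Local Notation Im := (@complex.Im R).

Lemma cReM (a b : C) : Re (a * b) = Re a * Re b - Im a * Im b.
Proof. by case: a; case: b. Qed.

Lemma cImM (a b : C) : Im (a * b) = Re a * Im b + Re b * Im a.
Proof. by case: a => a1 a2; case: b => b1 b2 /=; rewrite [b1 * a2]mulrC. Qed.

Lemma cReD (a b : C) : Re (a + b) = Re a + Re b.
Proof. by case: a; case: b. Qed.

Lemma cImD (a b : C) : Im (a + b) = Im a + Im b.
Proof. by case: a; case: b. Qed.

Lemma complex_eq (a b : C) : Re a = Re b -> Im a = Im b -> a = b.
Proof. by case: a => a1 a2; case: b => b1 b2 /= -> ->. Qed.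

Lemma smoothC_ext U f g : open U -> (forall x, U x -> f x = g x) ->
  smoothC U f -> smoothC U g.
Proof.
move=> oU fg [s1 s2]; split.
  by apply: smooth_ext s1 => // x Ux; rewrite fg.
by apply: smooth_ext s2 => // x Ux; rewrite fg.
Qed.

Lemma smoothC_cst U (a : C) : smoothC U (fun=> a).
Proof. by split; exact: smooth_cst. Qed.

Lemma smoothC_real U (f : V -> R) : smooth U f -> smoothC U (fun x => (f x)%:C).
Proof. by move=> sf; split=> //; exact: smooth_cst. Qed.

Lemma smoothCD U f g : open U -> smoothC U f -> smoothC U g ->
  smoothC U (fun x => f x + g x).
Proof.
move=> oU [s1 s2] [t1 t2]; split.
  by under eq_fun do rewrite cReD; exact: smoothD.
by under eq_fun do rewrite cImD; exact: smoothD.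
Qed.

Lemma smoothCM U f g : open U -> smoothC U f -> smoothC U g ->
  smoothC U (fun x => f x * g x).
Proof.
move=> oU [s1 s2] [t1 t2]; split.
  under eq_fun do rewrite cReM; apply: smoothD => //; last apply: smoothN => //;
    exact: smoothM.
by under eq_fun do rewrite cImM; apply: smoothD => //; exact: smoothM.
Qed.

Lemma smoothC_sum U (T : Type) (r : seq T) (P : pred T) (F : T -> V -> C) :
  open U -> (forall i, P i -> smoothC U (F i)) ->
  smoothC U (fun x => \sum_(i <- r | P i) F i x).
Proof.
move=> oU sF; elim: r => [|i r IH].
  by apply: (@smoothC_ext U (fun=> 0)) => // [x _|]; [rewrite big_nil|exact: smoothC_cst].
case: (boolP (P i)) => Pi; last first.
  by apply: smoothC_ext IH => // x _; rewrite big_cons (negPf Pi).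
apply: (@smoothC_ext U (fun x => F i x + \sum_(i <- r | P i) F i x)) => //.
  by move=> x _; rewrite big_cons Pi.
by apply: smoothCD => //; exact: sF.
Qed.

Lemma smoothC_prod U (T : Type) (r : seq T) (P : pred T) (F : T -> V -> C) :
  open U -> (forall i, P i -> smoothC U (F i)) ->
  smoothC U (fun x => \prod_(i <- r | P i) F i x).
Proof.
move=> oU sF; elim: r => [|i r IH].
  by apply: (@smoothC_ext U (fun=> 1)) => // [x _|]; [rewrite big_nil|exact: smoothC_cst].
case: (boolP (P i)) => Pi; last first.
  by apply: smoothC_ext IH => // x _; rewrite big_cons (negPf Pi).
apply: (@smoothC_ext U (fun x => F i x * \prod_(i <- r | P i) F i x)) => //.
  by move=> x _; rewrite big_cons Pi.
by apply: smoothCM => //; exact: sF.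
Qed.

Lemma deriveCE f x w : deriveC f x w =
  ('D_(map_mx Re w) (Re \o f) x - 'D_(map_mx Im w) (Im \o f) x) +i*
  ('D_(map_mx Re w) (Im \o f) x + 'D_(map_mx Im w) (Re \o f) x).
Proof.
by apply: complex_eq; rewrite /deriveC /=; ring.
Qed.

Lemma smoothC_deriveC U f w : open U -> smoothC U f ->
  smoothC U (fun x => deriveC f x w).
Proof.
move=> oU [s1 s2]; under eq_fun do rewrite deriveCE; split => /=.
  by apply: smoothD => //; last apply: smoothN => //; exact: smooth_derive.
by apply: smoothD => //; exact: smooth_derive.
Qed.

Definition differentiableC f x :=
  differentiable (Re \o f) x /\ differentiable (Im \o f) x.

Lemma smoothC_differentiable U f x : smoothC U f -> U x -> differentiableC f x.
Proof.
by move=> [s1 s2] Ux; split;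
  [exact: smooth_differentiable s1 Ux|exact: smooth_differentiable s2 Ux].
Qed.

Lemma derive_linear (f : V -> R) x (a b : R) u v : differentiable f x ->
  'D_(a *: u + b *: v) f x = a * 'D_u f x + b * 'D_v f x.
Proof. by move=> df; rewrite !deriveE // linearD !linearZ. Qed.

Lemma deriveC_comb f x (a b : C) w w' : differentiableC f x ->
  deriveC f x (a *: w + b *: w') = a * deriveC f x w + b * deriveC f x w'.
Proof.
move=> [d1 d2]; rewrite !deriveCE.
have -> : map_mx Re (a *: w + b *: w') =
    (Re a *: map_mx Re w + Re b *: map_mx Re w') +
    (- Im a *: map_mx Im w + - Im b *: map_mx Im w').
  by apply/rowP => j; rewrite !mxE cReD !cReM; ring.
have -> : map_mx Im (a *: w + b *: w') =
    (Re a *: map_mx Im w + Re b *: map_mx Im w') +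
    (Im a *: map_mx Re w + Im b *: map_mx Re w').
  by apply/rowP => j; rewrite !mxE cImD !cImM; ring.
have dD (h : V -> R) u v : differentiable h x ->
    'D_(u + v) h x = 'D_u h x + 'D_v h x.
  by move=> dh; rewrite -[u]scale1r -[v in LHS]scale1r derive_linear // !scale1r !mul1r.
have dZ (h : V -> R) a' u : differentiable h x ->
    'D_(a' *: u) h x = a' * 'D_u h x.
  move=> dh; have := derive_linear a' 0 u u dh.
  by rewrite scale0r addr0 mul0r addr0.
rewrite !(dD (Re \o f)) // !(dD (Im \o f)) // !(dZ (Re \o f)) // !(dZ (Im \o f)) //.
have alg (a1 a2 b1 b2 p p' q q' r r' s s' : R) :
  (a1 * p + b1 * q + (- a2 * r + - b2 * s) - (a1 * r' + b1 * s' + (a2 * p' + b2 * q'))) +i*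
  (a1 * p' + b1 * q' + (- a2 * r' + - b2 * s') + (a1 * r + b1 * s + (a2 * p + b2 * q))) =
  (a1 +i* a2) * ((p - r') +i* (p' + r)) + (b1 +i* b2) * ((q - s') +i* (q' + s)).
  by apply: complex_eq; rewrite /=; ring.
by case: a => a1 a2; case: b => b1 b2; exact: alg.
Qed.

Lemma deriveC_sum_delta f x w : differentiableC f x ->
  deriveC f x w = \sum_i w 0 i * deriveC f x (delta_mx 0 i).
Proof.
move=> df; rewrite {1}(row_sum_delta w).
have f0 : deriveC f x 0 = 0.
  have := deriveC_comb 0 0 0 0 df; rewrite !scale0r add0r => ->.
  by rewrite !mul0r addr0.
have fD b y z : deriveC f x (b *: y + z) = b * deriveC f x y + deriveC f x z.
  by have := deriveC_comb b 1 y z df; rewrite scale1r mul1r.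
elim/big_rec2: _ => [//|j y z _ IH].
by rewrite fD IH.
Qed.

Lemma deriveC_near f g x w : (\near x, f x = g x) ->
  deriveC f x w = deriveC g x w.
Proof.
move=> fg; rewrite !deriveCE.
have fR : \near x, (Re \o f) x = (Re \o g) x by apply: filterS fg => y /= ->.
have fI : \near x, (Im \o f) x = (Im \o g) x by apply: filterS fg => y /= ->.
by rewrite !(near_eq_derive _ fR) !(near_eq_derive _ fI).
Qed.

Lemma differentiableCM f g x : differentiableC f x -> differentiableC g x ->
  differentiableC (fun x => f x * g x) x.
Proof.
move=> [f1 f2] [g1 g2]; split.
  rewrite (_ : _ \o _ = (Re \o f) * (Re \o g) - (Im \o f) * (Im \o g)).
    by apply: differentiableB; apply: differentiableM.
  by apply/funext => y /=; rewrite cReM.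
rewrite (_ : _ \o _ = (Re \o f) * (Im \o g) + (Re \o g) * (Im \o f)).
  by apply: differentiableD; apply: differentiableM.
by apply/funext => y /=; rewrite cImM.
Qed.

Lemma deriveCM f g x w : differentiableC f x -> differentiableC g x ->
  deriveC (fun x => f x * g x) x w =
  f x * deriveC g x w + g x * deriveC f x w.
Proof.
move=> [f1 f2] [g1 g2]; rewrite !deriveCE.
rewrite (_ : Re \o (fun x => f x * g x) =
  (Re \o f) * (Re \o g) - (Im \o f) * (Im \o g)); last first.
  by apply/funext => y /=; rewrite cReM.
rewrite (_ : Im \o (fun x => f x * g x) =
  (Re \o f) * (Im \o g) + (Re \o g) * (Im \o f)); last first.
  by apply/funext => y /=; rewrite cImM.
have [f1' f2' g1' g2'] :
  [/\ forall v, derivable (Re \o f) x v, forall v, derivable (Im \o f) x v,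
      forall v, derivable (Re \o g) x v & forall v, derivable (Im \o g) x v].
  by split=> v; apply: diff_derivable.
rewrite !deriveB ?deriveD ?deriveM //; try exact: derivableM.
have alg (z z' : C) (p p' q q' r r' s s' : R) :
  (Re z * p + Re z' * q - (Im z * p' + Im z' * q') -
   (Re z * r' + Im z' * s + (Re z' * s' + Im z * r))) +i*
  (Re z * p' + Im z' * q + (Re z' * q' + Im z * p) +
   (Re z * r + Re z' * s - (Im z * r' + Im z' * s'))) =
  z * ((p - r') +i* (p' + r)) + z' * ((q - s') +i* (q' + s)).
  by case: z => a1 a2; case: z' => b1 b2; apply: complex_eq; rewrite /=; ring.
exact: alg.
Qed.

Lemma deriveC_cst (a : C) x w : deriveC (fun=> a) x w = 0.
Proof.
rewrite deriveCE.
have -> : Re \o (fun=> a) = cst (Re a) :> (V -> R) by [].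
have -> : Im \o (fun=> a) = cst (Im a) :> (V -> R) by [].
by rewrite !derive_cst subr0 addr0.
Qed.

Lemma differentiableCD f g x : differentiableC f x -> differentiableC g x ->
  differentiableC (fun x => f x + g x) x.
Proof.
move=> [f1 f2] [g1 g2]; split.
  rewrite (_ : _ \o _ = (Re \o f) + (Re \o g)); first exact: differentiableD.
  by apply/funext => y /=; rewrite cReD.
rewrite (_ : _ \o _ = (Im \o f) + (Im \o g)); first exact: differentiableD.
by apply/funext => y /=; rewrite cImD.
Qed.

Lemma deriveCD f g x w : differentiableC f x -> differentiableC g x ->
  deriveC (fun x => f x + g x) x w = deriveC f x w + deriveC g x w.
Proof.
move=> [f1 f2] [g1 g2]; rewrite !deriveCE.
rewrite (_ : Re \o (fun x => f x + g x) = (Re \o f) + (Re \o g)); last first.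
  by apply/funext => y /=; rewrite cReD.
rewrite (_ : Im \o (fun x => f x + g x) = (Im \o f) + (Im \o g)); last first.
  by apply/funext => y /=; rewrite cImD.
rewrite !deriveD; try exact: diff_derivable.
by apply: complex_eq; rewrite /=; ring.
Qed.

Lemma differentiableC_cst (a : C) x : differentiableC (fun=> a) x.
Proof. by split; exact: differentiable_cst. Qed.

Lemma differentiableC_sum (T : Type) (r : seq T) (P : pred T) (F : T -> V -> C) x :
  (forall i, P i -> differentiableC (F i) x) ->
  differentiableC (fun x => \sum_(i <- r | P i) F i x) x.
Proof.
move=> dF; elim: r => [|i r IH].
  by under eq_fun do rewrite big_nil; exact: differentiableC_cst.
under eq_fun do rewrite big_cons; case: (boolP (P i)) => Pi //.
by apply: differentiableCD => //; exact: dF.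
Qed.

Lemma deriveC_sum (T : Type) (r : seq T) (P : pred T) (F : T -> V -> C) x w :
  (forall i, P i -> differentiableC (F i) x) ->
  deriveC (fun x => \sum_(i <- r | P i) F i x) x w =
  \sum_(i <- r | P i) deriveC (F i) x w.
Proof.
move=> dF; elim: r => [|i r IH].
  by under eq_fun do rewrite big_nil; rewrite deriveC_cst big_nil.
under eq_fun do rewrite big_cons; rewrite big_cons.
case: (boolP (P i)) => Pi //.
rewrite deriveCD ?IH //; first exact: dF.
exact: differentiableC_sum.
Qed.

Lemma map_Re_mul w (A : 'M[R]_m) : map_mx Re (w *m cmx A) = map_mx Re w *m A.
Proof.
apply/rowP => j; rewrite !mxE (big_morph _ cReD (erefl _)).
by apply: eq_bigr => l _; rewrite !mxE cReM /= mulr0 subr0.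
Qed.

Lemma map_Im_mul w (A : 'M[R]_m) : map_mx Im (w *m cmx A) = map_mx Im w *m A.
Proof.
apply/rowP => j; rewrite !mxE (big_morph _ cImD (erefl _)).
by apply: eq_bigr => l _; rewrite !mxE cImM /= mulr0 add0r mulrC.
Qed.

End ComplexCalculus.

(** * Forms on a manifold *)

Section Charts.
Context {R : realType} {m : nat} {M : manifold R m}.
Local Notation C := R[i].
Implicit Types (c d : chart M).
Local Open Scope classical_set_scope.

Lemma cdom_open c : open (cdom c).
Proof. exact: coord_open. Qed.

Lemma overlapE c d x : overlap c d x <-> cdom c x /\ dom d (param c x).
Proof.
split=> [[p [pc pd] <-]|[[p pc <-]]].
  by rewrite coordK //; split=> //; exists p.
by rewrite coordK // => pd; exists p.
Qed.

Lemma overlap_open c d : open (overlap c d).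
Proof.
have pc := @param_continuous _ _ M c.
rewrite (continuous_open_subspace _ (@cdom_open c)) in pc.
rewrite openE => x /overlapE[cx dx].
have xc : x \in cdom c by rewrite inE.
have : nbhs x (cdom c `&` (param c @^-1` dom d)).
  apply: filterI.
    by apply: open_nbhs_nbhs; split=> //; exact: cdom_open.
  by apply: (pc x xc); apply: open_nbhs_nbhs; split=> //; exact: dom_open.
by apply: filterS => y [? ?]; apply/overlapE.
Qed.

Lemma overlap_cdom c d x : overlap c d x -> cdom c x.
Proof. by move=> /overlapE[]. Qed.

Lemma transition_cdom c d x : overlap c d x -> cdom d (transition c d x).
Proof. by move=> /overlapE[_ dx]; exists (param c x). Qed.

Lemma param_transition c d x : overlap c d x ->
  param d (transition c d x) = param c x.
Proof. by move=> /overlapE[_ dx]; rewrite /transition /= coordK. Qed.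

Lemma smooth_transition c d j :
  smooth (overlap c d) (fun x => transition c d x 0 j).
Proof. exact: (@transition_smooth _ _ M c d 0 j). Qed.

Lemma transition_differentiable c d x : overlap c d x ->
  differentiable (transition c d) x.
Proof.
move=> ox; have -> : transition c d =
    \sum_j (fun y => transition c d y 0 j *: (delta_mx 0 j : 'rV[R]_m)).
  by apply/funext => y; rewrite fct_sumE {1}(row_sum_delta (transition c d y)).
apply: differentiable_sum => j; apply: differentiableZl.
exact: (smooth_differentiable (@smooth_transition c d j) ox).
Qed.

Lemma jacobian_transitionE c d x i j : overlap c d x ->
  jacobian (transition c d) x i j =
  'D_(delta_mx 0 i) (fun y => transition c d y 0 j) x.
Proof.
move=> ox; have dT := transition_differentiable ox.
have := deriveEjacobian (delta_mx 0 i) dT.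
rewrite derive_mx; last exact: diff_derivable.
by rewrite -rowE => /rowP/(_ j); rewrite !mxE => ->.
Qed.

Lemma deriveC_transition c d x (h : 'rV[R]_m -> C) (w : 'rV[C]_m) :
  overlap c d x -> differentiableC h (transition c d x) ->
  deriveC (h \o transition c d) x w =
  deriveC h (transition c d x) (w *m cmx (jacobian (transition c d) x)).
Proof.
move=> ox [d1 d2]; have dT := transition_differentiable ox.
set J := jacobian _ _.
have chain (k : 'rV[R]_m -> R) v : differentiable k (transition c d x) ->
    'D_v (k \o transition c d) x = 'D_(v *m J) k (transition c d x).
  move=> dk; rewrite deriveE; last exact: differentiable_comp.
  by rewrite diff_comp //= [RHS]deriveE // -deriveEjacobian // deriveE.
rewrite !deriveCE.
rewrite map_Re_mul map_Im_mul.
by rewrite -!chain.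
Qed.

Lemma differentiableC_transition c d x (h : 'rV[R]_m -> C) :
  overlap c d x -> differentiableC h (transition c d x) ->
  differentiableC (h \o transition c d) x.
Proof.
move=> ox [d1 d2]; have dT := transition_differentiable ox.
split.
  exact: (differentiable_comp dT d1).
exact: (differentiable_comp dT d2).
Qed.

End Charts.

Section AlternatingForm2.
Context {R : realType} {m : nat}.
Local Notation C := R[i].

Definition alt2 (D : 'I_m -> 'I_m -> C) : @cov R m 2 := fun v =>
  \sum_i \sum_j (v ord0 i * v ord_max j - v ord_max i * v ord0 j) * D i j.

Lemma alt2_pullback D (A : 'M[C]_m) : pullback A (alt2 D) =
  alt2 (fun i j => \sum_k \sum_l A i k * A j l * D k l).
Proof.
apply/funext => v; rewrite /pullback /alt2.
transitivity (\sum_k \sum_l \sum_i \sum_j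
   (v ord0 i * v ord_max j - v ord_max i * v ord0 j) * (A i k * A j l * D k l)).
  apply: eq_bigr => k _; apply: eq_bigr => l _.
  rewrite !mxE !big_distrlr /= -sumrB mulr_suml; apply: eq_bigr => i _.
  rewrite -sumrB mulr_suml; apply: eq_bigr => j _.
  have alg (a b c' d e f : C) :
    (a * b * (c' * d) - e * b * (f * d)) * D k l = (a * c' - e * f) * (b * d * D k l).
    by ring.
  exact: alg.
under eq_bigr => k _ do rewrite exchange_big.
rewrite exchange_big; apply: eq_bigr => i _ /=.
under eq_bigr => k _ do rewrite exchange_big.
rewrite exchange_big; apply: eq_bigr => j _ /=.
by rewrite mulr_sumr; apply: eq_bigr => k _; rewrite mulr_sumr.
Qed.

Lemma alt2D D D' v : alt2 (fun i j => D i j + D' i j) v = alt2 D v + alt2 D' v.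
Proof.
rewrite /alt2 -big_split; apply: eq_bigr => i _ /=.
by rewrite -big_split; apply: eq_bigr => j _ /=; rewrite mulrDr.
Qed.

Lemma alt2_sym D v : (forall i j, D i j = D j i) -> alt2 D v = 0.
Proof.
move=> sD; set X := alt2 D v.
have : X = - X.
  rewrite {1}/X /alt2 exchange_big /= -sumrN; apply: eq_bigr => i _.
  rewrite -sumrN; apply: eq_bigr => j _; rewrite (sD j i) -[RHS]mulNr opprB.
  by rewrite [v ord0 j * _]mulrC [v ord_max j * _]mulrC.
by move/eqP; rewrite -addr_eq0 -mulr2n mulrn_eq0 /= => /eqP.
Qed.

Lemma ord2P (i : 'I_2) : i = ord0 \/ i = ord_max.
Proof. by case: i => -[|[|//]] ?; [left|right]; apply: val_inj. Qed.

Lemma alt2_cov D : is_cov (alt2 D).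
Proof.
split.
  move=> i u v w a b Eu Ev Ew.
  have {}Eu j : u i j = a * v i j + b * w i j.
    by move/rowP: Eu => /(_ j); rewrite !mxE.
  rewrite /alt2 !mulr_sumr -big_split; apply: eq_bigr => p _ /=.
  rewrite !mulr_sumr -big_split; apply: eq_bigr => q _ /=.
  have {}Ev i' l : i' != i -> v i' l = u i' l by move=> ii'; rewrite (row'_eq Ev).
  have {}Ew i' l : i' != i -> w i' l = u i' l by move=> ii'; rewrite (row'_eq Ew).
  have [i0|i1] := ord2P i.
    rewrite {}i0 in Eu Ev Ew; rewrite !Eu !(Ev ord_max) // !(Ew ord_max) //.
    move: (D p q) (u _ _) (u _ _) (v _ _) (v _ _) (w _ _) (w _ _); move=> *; ring.
  rewrite {}i1 in Eu Ev Ew; rewrite !Eu !(Ev ord0) // !(Ew ord0) //.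
  move: (D p q) (u _ _) (u _ _) (v _ _) (v _ _) (w _ _) (w _ _); move=> *; ring.
move=> v i j ij E; rewrite /alt2 big1 // => p _; rewrite big1 // => q _.
have {}E l : v ord0 l = v ord_max l.
  have {E} : v i l = v j l by move/rowP: E => /(_ l); rewrite !mxE.
  by case: (ord2P i) ij => -> ; case: (ord2P j) => ->; rewrite ?eqxx.
by rewrite !E subrr mul0r.
Qed.

End AlternatingForm2.

Section Forms.
Context {R : realType} {m : nat} {M : manifold R m}.
Local Notation C := R[i].
Implicit Types (c d : chart M).
Local Open Scope classical_set_scope.
Local Notation jac c d x := (cmx (jacobian (@transition R m M c d) x)).

Definition ev (j : 'I_m) : 'M[C]_(1, m) := delta_mx 0 j.

Lemma cov1_sum (al : @cov R m 1) (w : 'M[C]_(1, m)) : multilinear al ->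
  al w = \sum_j w 0 j * al (ev j).
Proof.
move=> mal; rewrite {1}(row_sum_delta w).
have fD b y z : al (b *: y + z) = b * al y + al z.
  rewrite -[z in LHS]scale1r -[al z]mul1r; apply: (mal 0).
  - by apply/rowP => j; rewrite !mxE.
  - by apply/matrixP => -[].
  - by apply/matrixP => -[].
have f0 : al 0 = 0.
  by have := fD (-1) 0 0; rewrite scaler0 addr0 mulN1r addNr.
elim/big_rec2: _ => [//|j y z _ IH].
by rewrite fD IH.
Qed.

Lemma cdom_near c x (P : 'rV[R]_m -> Prop) : cdom c x ->
  (forall y, cdom c y -> P y) -> \near x, P x.
Proof. exact: (open_near (@cdom_open _ _ _ c)). Qed.

Lemma overlap_near c d x (P : 'rV[R]_m -> Prop) : overlap c d x ->
  (forall y, overlap c d y -> P y) -> \near x, P x.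
Proof. exact: (open_near (@overlap_open _ _ _ c d)). Qed.

Lemma ext_d1E (al : dform M 1) c x : is_form al -> cdom c x ->
  ext_d al c x =
  alt2 (fun i j => deriveC (fun y => al c y (ev j)) x (delta_mx 0 i)).
Proof.
move=> [cal sal _] cx; apply/funext => v.
have da j : differentiableC (fun y => al c y (ev j)) x.
  exact: smoothC_differentiable (sal c (ev j)) cx.
have E (w : 'M[C]_(1, m)) u : deriveC (fun y => al c y w) x u =
    \sum_i \sum_j u 0 i * w 0 j *
       deriveC (fun y => al c y (ev j)) x (delta_mx 0 i).
  have nw : \near x, al c x w = \sum_j w 0 j * al c x (ev j).
    apply: (cdom_near cx) => y cy; apply: cov1_sum.
    by case: (cal c y cy).
  rewrite (deriveC_near _ nw) deriveC_sum => [|j _]; last first.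
    by apply: differentiableCM => //; exact: differentiableC_cst.
  rewrite exchange_big; apply: eq_bigr => j _ /=.
  rewrite deriveCM //; last exact: differentiableC_cst.
  rewrite deriveC_cst mulr0 addr0 deriveC_sum_delta // mulr_sumr.
  by apply: eq_bigr => i _; rewrite mulrCA mulrA.
rewrite /ext_d big_ord_recl big_ord1 /= expr0 mul1r expr1 mulN1r.
rewrite !E /alt2 -sumrB; apply: eq_bigr => i _; rewrite -sumrB.
apply: eq_bigr => j _; rewrite mulrBl !mxE.
congr (_ * _ - _ * _).
  by congr (v _ _ * v _ _); apply: val_inj.
by congr (v _ _ * v _ _); apply: val_inj.
Qed.

End Forms.

Section FormClosure.
Context {R : realType} {m : nat} {M : manifold R m}.
Local Notation C := R[i].
Implicit Types (c d : chart M).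
Local Open Scope classical_set_scope.
Local Notation jac c d x := (cmx (jacobian (@transition R m M c d) x)).

Lemma deriveC_real (h : 'rV[R]_m -> R) x (v : 'rV[R]_m) :
  deriveC (fun y => (h y)%:C) x (cmx v) = ('D_v h x)%:C.
Proof.
rewrite deriveCE.
have -> : map_mx (@complex.Re R) (cmx v) = v by apply/rowP => j; rewrite !mxE.
have -> : map_mx (@complex.Im R) (cmx v) = 0 by apply/rowP => j; rewrite !mxE.
have -> : (@complex.Im R) \o (fun y => (h y)%:C) = cst 0 :> ('rV[R]_m -> R) by [].
by rewrite !derive0 derive_cst subr0 addr0.
Qed.

Lemma cmx_delta j : cmx (delta_mx 0 j : 'rV[R]_m) = delta_mx 0 j :> 'rV[C]_m.
Proof. by rewrite /cmx map_delta_mx. Qed.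

(* The second derivatives of the transition map are symmetric, hence cancel.   *)
Lemma ext_d_transition (al : dform M 1) c d x : is_form al -> overlap c d x ->
  ext_d al c x = pullback (jac c d x) (ext_d al d (transition c d x)).
Proof.
move=> fal ox; have [cal sal tal] := fal.
have dx := transition_cdom ox; set T := transition c d; set J := jacobian T x.
rewrite (ext_d1E fal (overlap_cdom ox)) (ext_d1E fal dx) alt2_pullback.
pose Hs i j := \sum_k ('D_(delta_mx 0 i)
  (fun y => 'D_(delta_mx 0 j) (fun y => T y 0 k) y) x)%:C * al d (T x) (ev k).
have sT k : smooth (overlap c d) (fun y => T y 0 k) := @smooth_transition _ _ _ c d k.
have E i j : deriveC (fun y => al c y (ev j)) x (delta_mx 0 i) =
   Hs i j + \sum_k \sum_l (cmx J) i k * (cmx J) j l *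
      deriveC (fun y => al d y (ev l)) (T x) (delta_mx 0 k).
  have nE : \near x, al c x (ev j) = 
      \sum_k ('D_(delta_mx 0 j) (fun y => T y 0 k) x)%:C * al d (T x) (ev k).
    apply: (overlap_near ox) => y oy; rewrite (tal _ _ _ oy) /pullback.
    rewrite cov1_sum; last by case: (cal d _ (transition_cdom oy)).
    apply: eq_bigr => k _; congr (_ * _).
    by rewrite /ev -rowE 2!mxE jacobian_transitionE.
  have dA k : differentiableC
      (fun y => ('D_(delta_mx 0 j) (fun y => T y 0 k) y)%:C) x.
    apply: smoothC_differentiable ox; apply: smoothC_real.
    exact: smooth_derive.
  have da k : differentiableC (fun y => al d y (ev k)) (T x).
    exact: smoothC_differentiable (sal d (ev k)) dx.
  have dB k : differentiableC (fun y => al d (T y) (ev k)) x.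
    exact: (differentiableC_transition ox (da k)).
  rewrite (deriveC_near _ nE) deriveC_sum => [|k _]; last first.
    exact: differentiableCM.
  rewrite [X in _ = _ + X]exchange_big -big_split; apply: eq_bigr => k _ /=.
  rewrite deriveCM // addrC mulrC -cmx_delta deriveC_real; congr (_ + _); last exact: mulrC.
  rewrite [deriveC _ _ _](deriveC_transition _ ox (da k)) cmx_delta -rowE.
  rewrite deriveC_sum_delta // mulr_suml; apply: eq_bigr => l _.
  rewrite mxE mulrAC; congr (_ * _ * _).
  by rewrite mxE jacobian_transitionE.
transitivity (alt2 (fun i j => Hs i j + \sum_k \sum_l (cmx J) i k * (cmx J) j l *
      deriveC (fun y => al d y (ev l)) (T x) (delta_mx 0 k))).
  by congr alt2; apply/funext => i; apply/funext => j; exact: E.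
apply/funext => v; apply: etrans (alt2D Hs _ v) _.
apply: etrans (congr1 (fun z => z + _) (alt2_sym v _)) (add0r _) => i j.
apply: eq_bigr => k _.
by have -> := derive_comm (delta_mx 0 j) (delta_mx 0 i)
  (@overlap_open _ _ _ c d) ox (sT k).
Qed.

Lemma is_form_ext_d1 (al : dform M 1) : is_form al -> is_form (ext_d al).
Proof.
move=> fal; have [cal sal tal] := fal; split.
- by move=> c x cx; rewrite ext_d1E //; exact: alt2_cov.
- move=> c v; apply: smoothC_sum => [|i _]; first exact: cdom_open.
  apply: smoothCM; [exact: cdom_open|exact: smoothC_cst|].
  by apply: smoothC_deriveC; [exact: cdom_open|exact: sal].
- by move=> c d x; exact: ext_d_transition.
Qed.

Lemma smoothC_cov k (al : dform M k) c (w : 'rV[R]_m -> 'M[C]_(k, m)) :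
  is_form al -> (forall i j, smoothC (cdom c) (fun x => w x i j)) ->
  smoothC (cdom c) (fun x => al c x (w x)).
Proof.
move=> [cal sal _] sw; have oc := @cdom_open _ _ _ c.
apply: (@smoothC_ext _ _ _ (fun x =>
  \sum_(g : {ffun 'I_k -> 'I_m})
     al c x (rows (fun i => delta_mx 0 (g i))) * \prod_i w x i (g i))) => //.
  move=> x cx; rewrite [in RHS](multilinear_coord (al := al c x)) //.
  by case: (cal c x cx).
apply: smoothC_sum => // g _; apply: smoothCM => //.
by apply: smoothC_prod.
Qed.

Definition smooth_cmx c p q (A : 'rV[R]_m -> 'M[C]_(p, q)) :=
  forall i j, smoothC (cdom c) (fun x => A x i j).

Lemma smooth_cmx_cst c p q (A : 'M[C]_(p, q)) : smooth_cmx c (fun=> A).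
Proof. by move=> i j; exact: smoothC_cst. Qed.

Lemma smooth_cmxM c p q r (A : 'rV[R]_m -> 'M[C]_(p, q)) (B : _ -> 'M[C]_(q, r)) :
  smooth_cmx c A -> smooth_cmx c B -> smooth_cmx c (fun x => A x *m B x).
Proof.
move=> sA sB i j; have oc := @cdom_open _ _ _ c.
under eq_fun do rewrite mxE.
by apply: smoothC_sum => // k _; apply: smoothCM.
Qed.

Lemma smooth_cmx_real c p q (A : 'rV[R]_m -> 'M[R]_(p, q)) :
  smooth_mx (cdom c) A -> smooth_cmx c (fun x => cmx (A x)).
Proof.
by move=> sA i j; under eq_fun do rewrite mxE; exact: smoothC_real.
Qed.

Lemma smooth_pi10 c (I : 'rV[R]_m -> 'M[R]_m) :
  smooth_mx (cdom c) I -> smooth_cmx c (fun x => pi10 (I x)).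
Proof.
move=> sI i j; have oc := @cdom_open _ _ _ c.
have E x : pi10 (I x) i j = 2^-1 * (i == j)%:R + - (2^-1 * 'i%C) * (I x i j)%:C.
  by rewrite !mxE; ring.
under eq_fun do rewrite E.
apply: smoothCD => //; first exact: smoothC_cst.
by apply: smoothCM => //; [exact: smoothC_cst|exact: smoothC_real].
Qed.

Lemma smooth_pi01 c (I : 'rV[R]_m -> 'M[R]_m) :
  smooth_mx (cdom c) I -> smooth_cmx c (fun x => pi01 (I x)).
Proof.
move=> sI i j; have oc := @cdom_open _ _ _ c.
have E x : pi01 (I x) i j = 2^-1 * (i == j)%:R + 2^-1 * 'i%C * (I x i j)%:C.
  by rewrite !mxE; ring.
under eq_fun do rewrite E.
apply: smoothCD => //; first exact: smoothC_cst.
by apply: smoothCM => //; [exact: smoothC_cst|exact: smoothC_real].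
Qed.

Lemma smooth_act_rows c k (S : {set 'I_k}) A B (v : 'M[C]_(k, m)) :
  smooth_cmx c A -> smooth_cmx c B ->
  smooth_cmx c (fun x => act_rows S (A x) (B x) v).
Proof.
move=> sA sB i j; under eq_fun do rewrite mxE.
by case: (i \in S); apply: smooth_cmxM => //; exact: smooth_cmx_cst.
Qed.

Lemma jac_pi10 (I : field M 'M[R]_m) c d x : endo_field I -> overlap c d x ->
  pi10 (I c x) *m jac c d x = jac c d x *m pi10 (I d (transition c d x)).
Proof.
move=> [_ tI] ox; rewrite /pi10 -scalemxAl -scalemxAr mulmxBl mulmxBr.
rewrite mul1mx mulmx1 -scalemxAl -scalemxAr; congr (_ *: (_ - _ *: _)).
by rewrite -!cmxM tI.
Qed.

Lemma jac_pi01 (I : field M 'M[R]_m) c d x : endo_field I -> overlap c d x ->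
  pi01 (I c x) *m jac c d x = jac c d x *m pi01 (I d (transition c d x)).
Proof.
move=> [_ tI] ox; rewrite /pi01 -scalemxAl -scalemxAr mulmxDl mulmxDr.
rewrite mul1mx mulmx1 -scalemxAl -scalemxAr; congr (_ *: (_ + _ *: _)).
by rewrite -!cmxM tI.
Qed.

Lemma is_form_pq_part (I : field M 'M[R]_m) p q k (al : dform M k) :
  endo_field I -> is_form al -> is_form (fun c x => pq_part (I c x) p q (al c x)).
Proof.
move=> eI fal; have [cal sal tal] := fal; split.
- by move=> c x cx; apply: cov_pq_part; exact: cal.
- move=> c v; apply: smoothC_sum => [|S _]; first exact: cdom_open.
  apply: smoothC_cov => //; have [sI _] := eI.
  by apply: smooth_act_rows; [exact: smooth_pi01|exact: smooth_pi10].
- move=> c d x ox; rewrite (tal _ _ _ ox); apply/funext => v.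
  rewrite /pq_part /pullback; apply: eq_bigr => S _.
  by rewrite act_rows_mulr act_rows_mull jac_pi01 // jac_pi10.
Qed.

Lemma is_form_add k (al be : dform M k) : is_form al -> is_form be ->
  is_form (add_form al be).
Proof.
move=> [cal sal tal] [cbe sbe tbe]; split.
- move=> c x cx; have := cov_comb 1 (cal c x cx) (cbe c x cx).
  by congr is_cov; apply/funext => v; rewrite mul1r.
- by move=> c v; apply: smoothCD => //; exact: cdom_open.
- by move=> c d x ox; rewrite /add_form (tal _ _ _ ox) (tbe _ _ _ ox).
Qed.

Lemma is_form_scale k (a : C) (al : dform M k) : is_form al ->
  is_form (scale_form (fun=> a) al).
Proof.
move=> [cal sal tal]; split.
- by move=> c x cx; exact: (cov_scale a (cal c x cx)).
- move=> c v; apply: smoothCM => //; first exact: cdom_open.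
  exact: smoothC_cst.
- by move=> c d x ox; rewrite /scale_form (tal _ _ _ ox).
Qed.

Lemma is_form_wedge k l (al : dform M k) (be : dform M l) : is_form al ->
  is_form be -> is_form (wedge_form al be).
Proof.
move=> [cal sal tal] [cbe sbe tbe]; split.
- by move=> c x cx; exact: (cov_wedge (cal c x cx) (cbe c x cx)).
- move=> c v; have oc := @cdom_open _ _ _ c.
  apply: smoothCM => //; first exact: smoothC_cst.
  apply: smoothC_sum => // s _; apply: smoothCM => //.
  by apply: smoothCM => //; exact: smoothC_cst.
- move=> c d x ox; rewrite /wedge_form (tal _ _ _ ox) (tbe _ _ _ ox).
  exact: wedge_pullback.
Qed.

Lemma is_form_pow (al : dform M 2) n : is_form al -> is_form (pow_form al n).
Proof.
move=> fal; elim: n => [|n IH]; last exact: (is_form_wedge fal IH).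
split=> [c x _|c v|c d x _].
- by split=> [i|v i]; have := ltn_ord i.
- exact: smoothC_cst.
- by [].
Qed.

End FormClosure.

Section ConcreteForms.
Context {R : realType} {m : nat} {M : manifold R m}.
Local Notation C := R[i].
Implicit Types (c d : chart M).
Local Open Scope classical_set_scope.
Local Notation jac c d x := (cmx (jacobian (@transition R m M c d) x)).

Definition loc (phi : M -> R) c (y : 'rV[R]_m) : C := (phi (param c y))%:C.

Lemma smoothC_loc (phi : M -> R) c : smooth_fun phi -> smoothC (cdom c) (loc phi c).
Proof. by move=> sphi; exact: smoothC_real (sphi c). Qed.

Lemma ext_d_fun (phi : M -> R) c x v :
  ext_d (fun_form phi) c x v = deriveC (loc phi c) x (row ord0 v).
Proof. by rewrite /ext_d big_ord1 expr0 mul1r. Qed.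

Lemma is_form_dfun (phi : M -> R) : smooth_fun phi ->
  is_form (ext_d (fun_form phi) : dform M 1).
Proof.
move=> sphi; split.
- move=> c x cx; split.
    move=> i u v w a b; rewrite (ord1 i) => Eu _ _; rewrite !ext_d_fun Eu.
    apply: deriveC_comb; exact: smoothC_differentiable (smoothC_loc c sphi) cx.
  by move=> v i j; rewrite (ord1 i) (ord1 j).
- move=> c v; have oc := @cdom_open _ _ _ c.
  under eq_fun do rewrite ext_d_fun.
  by apply: smoothC_deriveC => //; exact: smoothC_loc.
- move=> c d x ox; apply/funext => v; rewrite /pullback !ext_d_fun row_mul.
  rewrite -deriveC_transition //; last first.
    by apply: smoothC_differentiable (smoothC_loc d sphi) _; exact: transition_cdom.
  apply: deriveC_near; apply: (overlap_near ox) => y oy.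
  by rewrite /loc /= param_transition.
Qed.

Lemma is_form_delbar_fun (I : field M 'M[R]_m) (phi : M -> R) :
  endo_field I -> smooth_fun phi -> is_form (delbar I 0 0 (fun_form phi)).
Proof.
by move=> eI sphi; exact: (is_form_pq_part 0 1 eI (is_form_dfun sphi)).
Qed.

Lemma is_form_ddbar (I : field M 'M[R]_m) (phi : M -> R) :
  endo_field I -> smooth_fun phi -> is_form (ddbar I phi).
Proof.
move=> eI sphi.
exact: (is_form_pq_part 1 1 eI (is_form_ext_d1 (is_form_delbar_fun eI sphi))).
Qed.

Lemma ddbar_pq (I : field M 'M[R]_m) (phi : M -> R) c x :
  endo_field I -> smooth_fun phi -> cdom c x -> I c x *m I c x = - 1%:M ->
  is_pq (I c x) 1 1 (ddbar I phi c x).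
Proof.
move=> eI sphi cx I2.
have [cB _ _] := is_form_ext_d1 (is_form_delbar_fun eI sphi).
exact: (pq_part_pq I2 1 1 (cB c x cx)).
Qed.

Lemma is_pq_comb (I : 'M[R]_m) p q k (al be : @cov R m k) a :
  I *m I = - 1%:M -> is_pq I p q al -> is_pq I p q be ->
  is_pq I p q (fun v => al v + a * be v).
Proof.
move=> I2 pal pbe; have [cal _] := pal; have [cbe _] := pbe.
have cc : is_cov (fun v => al v + a * be v).
  have := cov_comb a cbe cal; congr is_cov; apply/funext => v.
  by rewrite addrC.
apply/(is_pqP I2 p q cc) => T bT v.
by rewrite ((is_pqP I2 p q cal).1 pal) // ((is_pqP I2 p q cbe).1 pbe) // mulr0 addr0.
Qed.

Lemma cmx_tr (A : 'M[R]_m) : cmx A^T = (cmx A)^T.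
Proof. by apply/matrixP => i j; rewrite !mxE. Qed.

Section Gc.
Variable g : 'M[R]_m.
Lemma gCDl X Y Z a b : gC g (a *: X + b *: Y) Z = a * gC g X Z + b * gC g Y Z.
Proof. by rewrite /gC !mulmxDl -!scalemxAl !mxE. Qed.

Lemma gCDr X Y Z a b : gC g Z (a *: X + b *: Y) = a * gC g Z X + b * gC g Z Y.
Proof. by rewrite /gC linearD !linearZ /= mulmxDr -!scalemxAr !mxE. Qed.

Lemma gCZl X Y a : gC g (a *: X) Y = a * gC g X Y.
Proof. by rewrite /gC -!scalemxAl !mxE. Qed.

Lemma gCZr X Y a : gC g X (a *: Y) = a * gC g X Y.
Proof. by rewrite /gC linearZ /= -!scalemxAr !mxE. Qed.

Lemma gC_sym X Y : g^T = g -> gC g X Y = gC g Y X.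
Proof.
move=> gs; rewrite /gC; set A := X *m _ *m _.
transitivity (A^T 0 0); first by rewrite [RHS]mxE.
by rewrite /A !trmx_mul trmxK -cmx_tr gs mulmxA.
Qed.

Lemma gC_inv A X Y : A *m g *m A^T = g -> gC g (X *m cmx A) (Y *m cmx A) = gC g X Y.
Proof.
move=> Ag; rewrite /gC trmx_mul -!mulmxA; congr ((_ *m _) 0 0).
rewrite !mulmxA; congr (_ *m _).
by rewrite -[in RHS]Ag !cmxM cmx_tr.
Qed.

End Gc.

Lemma hermitian_inv (I J K g : field M 'M[R]_m) c x a b s t :
  quaternionic_hermitian I J K g -> cdom c x -> unit_quat a b s t ->
  let Q := quat (I c x) (J c x) (K c x) a b s t in
  Q *m g c x *m Q^T = g c x.
Proof.
move=> [_ H] cx uq Q; apply/matrixP => i j.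
have := H c x a b s t (delta_mx 0 i) (delta_mx 0 j) cx uq.
cbv zeta; rewrite -/Q trmx_mul !trmx_delta => /matrixP/(_ 0 0).
have E (A : 'M[R]_m) : (delta_mx 0 i *m A *m delta_mx j 0 : 'M[R]_1) 0 0 = A i j.
  by rewrite -rowE -colE !mxE.
have -> : delta_mx 0 i *m Q *m g c x *m (Q^T *m delta_mx j 0) =
    delta_mx 0 i *m (Q *m g c x *m Q^T) *m delta_mx j 0 :> 'M[R]_1.
  by rewrite !mulmxA.
by rewrite !E.
Qed.

End ConcreteForms.

Section Hermitian.
Context {R : realType} {m : nat}.
Local Notation C := R[i].
Variables I g : 'M[R]_m.
Hypotheses (I2 : I *m I = - 1%:M) (gs : g^T = g) (gI : I *m g *m I^T = g).

Lemma gC_skew X Y : gC g (X *m cmx I) Y = - gC g X (Y *m cmx I).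
Proof.
rewrite -(gC_inv (X *m cmx I) Y gI) -mulmxA cmxI2 // mulmxN mulmx1.
by rewrite -scaleN1r gCZl mulN1r.
Qed.

Definition fundamental_form : @cov R m 2 := fun v =>
  gC g (row ord0 v) (row ord_max v *m cmx I).

Lemma fundamental_form_cov : is_cov fundamental_form.
Proof.
split; last first.
  move=> v i j ij E; rewrite /fundamental_form.
  have -> : row ord0 v = row ord_max v.
    by case: (ord2P i) ij E => ->; case: (ord2P j) => ->; rewrite ?eqxx.
  set X := row _ _; have : gC g X (X *m cmx I) = - gC g X (X *m cmx I).
    by rewrite {1}gC_sym // gC_skew.
  by move/eqP; rewrite -addr_eq0 -mulr2n mulrn_eq0 /= => /eqP.
move=> i u v w a b Eu Ev Ew; rewrite /fundamental_form.
case: (ord2P i) => i0; rewrite {}i0 in Eu Ev Ew; rewrite Eu.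
  rewrite (row'_row (j := ord_max) Ev isT) (row'_row (j := ord_max) Ew isT).
  exact: gCDl.
rewrite (row'_row (j := ord0) Ev isT) (row'_row (j := ord0) Ew isT).
rewrite mulmxDl -!scalemxAl; exact: gCDr.
Qed.

Lemma row_pi10_I (X : 'rV[C]_m) :
  X *m pi10 I *m cmx I = 'i%C *: (X *m pi10 I).
Proof. by rewrite -mulmxA pi10_cmxI // scalemxAr. Qed.

Lemma row_pi01_I (X : 'rV[C]_m) :
  X *m pi01 I *m cmx I = - 'i%C *: (X *m pi01 I).
Proof. by rewrite -mulmxA pi01_cmxI // scalemxAr. Qed.

Lemma gC_eigen X Y (a : C) : X *m cmx I = a *: X -> Y *m cmx I = a *: Y ->
  a ^+ 2 = -1 -> gC g X Y = 0.
Proof.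
move=> XI YI a2; have := gC_inv X Y gI.
rewrite XI YI gCZl gCZr mulrA -expr2 a2 mulN1r => /eqP.
by rewrite eq_sym -addr_eq0 -mulr2n mulrn_eq0 /= => /eqP.
Qed.

Lemma fundamental_form_pq : is_pq I 1 1 fundamental_form.
Proof.
apply/(is_pqP I2 1 1 fundamental_form_cov) => T bT v.
rewrite /fundamental_form !row_act_rows.
have -> : (ord0 \in T) = (ord_max \in T).
  apply/eqP; apply: contraNT bT => bT.
  have card2 (S : {set 'I_2}) : #|S| = ((ord0 \in S) + (ord_max \in S))%N.
    rewrite -sum1_card big_mkcond big_ord_recl big_ord1 /=.
    have -> : lift ord0 ord0 = ord_max :> 'I_2 by exact: val_inj.
    by case: (_ \in S); case: (_ \in S).
  rewrite !card2 !inE; move: bT.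
  by case: (_ \in T); case: (_ \in T).
have i2 : ('i%C : C) ^+ 2 = -1 by rewrite sqrCi.
have i2' : (- 'i%C : C) ^+ 2 = -1 by rewrite sqrrN sqrCi.
case: ifP => _.
  by rewrite row_pi01_I gCZr (gC_eigen (row_pi01_I _) (row_pi01_I _) i2') mulr0.
by rewrite row_pi10_I gCZr (gC_eigen (row_pi10_I _) (row_pi10_I _) i2) mulr0.
Qed.

End Hermitian.

Section OmegaForm.
Context {R : realType} {m : nat} {M : manifold R m}.
Local Notation C := R[i].
Local Open Scope classical_set_scope.

Lemma is_form_omegaI (I g : field M 'M[R]_m) : endo_field I -> riemannian g ->
  (forall c x, cdom c x -> I c x *m I c x = - 1%:M) ->
  (forall c x, cdom c x -> I c x *m g c x *m (I c x)^T = g c x) ->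
  is_form (omegaI I g).
Proof.
move=> [sI tI] [sg tg gs _] I2 gI; split.
- by move=> c x cx; apply: fundamental_form_cov; [exact: I2|exact: gs|exact: gI].
- move=> c v.
  have sIc := smooth_cmx_real (sI c).
  have sgc := smooth_cmx_real (sg c).
  have str p q (A : 'rV[R]_m -> 'M[C]_(p, q)) : smooth_cmx c A -> smooth_cmx c (fun x => (A x)^T).
    by move=> sA i j; under eq_fun do rewrite mxE; exact: sA.
  have H : smooth_cmx c (fun x => row ord0 v *m cmx (g c x) *m
      (row ord_max v *m cmx (I c x))^T).
    apply: smooth_cmxM; last apply: str; apply: smooth_cmxM => //;
      exact: smooth_cmx_cst.
  exact: H.
- move=> c d x ox; apply/funext => v; rewrite /pullback /omegaI.
  rewrite !row_mul -(mulmxA (row ord_max v)) -cmxM -(tI _ _ _ ox) cmxM.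
  by rewrite /gC (tg _ _ _ ox) !cmxM cmx_tr !trmx_mul !mulmxA.
Qed.

Lemma quat_I (I J K : 'M[R]_m) : quat I J K 0 1 0 0 = I.
Proof. by rewrite /quat scale1r !scale0r !addr0 -scalemx1 scale0r add0r. Qed.

Lemma quat_Jm (I J K : 'M[R]_m) : quat I J K 0 0 1 0 = J.
Proof. by rewrite /quat scale1r !scale0r !addr0 -scalemx1 scale0r add0r. Qed.

End OmegaForm.

(** * The image of the Hessian under R *)

Section NijenhuisForm.
Variables (F : fieldType) (m : nat) (A : 'M[F]_m) (D : 'rV[F]_m -> 'M[F]_m).
Hypothesis D_linear : forall s t a b, D (s *: a + t *: b) = s *: D a + t *: D b.

Definition nij_form (a b : 'rV[F]_m) : 'rV[F]_m :=
  b *m D (a *m A) - a *m D (b *m A) + a *m D b *m A - b *m D a *m A.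

Lemma nij_formC a b : nij_form a b = - nij_form b a.
Proof.
have alg (p q r s : 'rV[F]_m) : p - q + r - s = - (q - p + s - r).
  by apply/rowP => k; rewrite !mxE; ring.
exact: alg.
Qed.

Lemma nij_form_linear b s t a1 a2 :
  nij_form (s *: a1 + t *: a2) b = s *: nij_form a1 b + t *: nij_form a2 b.
Proof.
have alg (p p' q q' r r' u u' : 'rV[F]_m) :
  (s *: p + t *: p') - (s *: q + t *: q') + (s *: r + t *: r')
    - (s *: u + t *: u') =
  s *: (p - q + r - u) + t *: (p' - q' + r' - u').
  by apply/rowP => k; rewrite !mxE; ring.
rewrite /nij_form -alg; congr (_ - _ + _ - _).
- by rewrite mulmxDl -!scalemxAl D_linear mulmxDr -!scalemxAr.
- by rewrite mulmxDl -!scalemxAl.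
- by rewrite !mulmxDl -!scalemxAl.
- by rewrite D_linear mulmxDr -!scalemxAr mulmxDl -!scalemxAl.
Qed.

End NijenhuisForm.

Section NijenhuisAlgebra.
Variables (F : fieldType) (m : nat) (j : F) (I J : 'M[F]_m).
Variables (dI dJ : 'rV[F]_m -> 'M[F]_m) (w0 w1 : 'rV[F]_m).
Hypotheses (j2 : j ^+ 2 = -1) (two : 2 != 0 :> F).
Hypotheses (J2 : J *m J = - 1%:M) (JI : J *m I = - (I *m J)).
Hypothesis dII : forall a, dI a *m I = - (I *m dI a).
Hypothesis dIJ : forall a, dI a *m J + I *m dJ a + dJ a *m I + J *m dI a = 0.
Hypothesis dIZ : forall (c : F) a, dI (c *: a) = c *: dI a.
Hypotheses (w0I : w0 *m I = j *: w0) (w1I : w1 *m I = j *: w1).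
Hypothesis nijJ : w1 *m dJ (w0 *m J) - w0 *m dJ (w1 *m J)
  + w0 *m dJ w1 *m J - w1 *m dJ w0 *m J = 0.
Hypothesis nijI : (w1 *m J) *m dI (w0 *m J *m I) - (w0 *m J) *m dI (w1 *m J *m I)
  + (w0 *m J) *m dI (w1 *m J) *m I - (w1 *m J) *m dI (w0 *m J) *m I = 0.

Lemma nijenhuis_algebra :
  j *: (w1 *m dI (w0 *m J) - w0 *m dI (w1 *m J)) =
  (w1 *m dJ w0 - w0 *m dJ w1) *m (1%:M + j *: I).
Proof.
have eJ w : w *m I = j *: w -> w *m J *m I = - j *: (w *m J).
  by move=> wI; rewrite -mulmxA JI mulmxN mulmxA wI -scalemxAl scaleNr.
have C0 : (w1 *m J) *m dI (w0 *m J) - (w0 *m J) *m dI (w1 *m J) = 0.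
  set P := _ - _.
  have PI : P *m I = j *: P.
    rewrite mulmxBl -!(mulmxA _ (dI _) I) !dII !mulmxN !(mulmxA _ I) !eJ //.
    by rewrite -!scalemxAl !scaleNr !opprK scalerBr.
  have : - j *: P - P *m I = 0.
    rewrite -[RHS]nijI !eJ // !dIZ -!scalemxAr -scalerBr -/P mulmxBl opprB addrA.
    by [].
  rewrite PI scaleNr -opprD -scalerDr => /eqP; rewrite oppr_eq0 scaler_eq0.
  have j0 : j != 0.
    by apply: contra_eq_neq j2 => ->; rewrite expr0n /= eq_sym oppr_eq0 oner_eq0.
  rewrite (negPf j0) /= -mulr2n -scaler_nat scaler_eq0 (negPf two) /=.
  by move=> /eqP.
set X := w1 *m dJ w0 - w0 *m dJ w1.
set Y := w1 *m dJ (w0 *m J) - w0 *m dJ (w1 *m J).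
set D := w1 *m dI (w0 *m J) - w0 *m dI (w1 *m J).
have YX : Y = X *m J.
  apply/eqP; rewrite -subr_eq0 -[X in _ == X]nijJ /X mulmxBl opprB addrA.
  by [].
have E (w a : 'rV[F]_m) : w *m I = j *: w ->
    w *m dI a *m J + j *: (w *m dJ a) + w *m dJ a *m I + w *m J *m dI a = 0.
  move=> wI; rewrite -(mulmx0 _ w) -(dIJ a) !mulmxDr !mulmxA wI.
  by rewrite -scalemxAl.
have {E} : D *m J + j *: Y + Y *m I = 0.
  rewrite -[RHS](subr0 0) -{1}(E w1 (w0 *m J) w1I) -(E w0 (w1 *m J) w0I).
  rewrite (subr0_eq C0) /D /Y !mulmxBl scalerBr.
  move: (w0 *m J *m dI _) (w1 *m _ *m J) (w0 *m _ *m J) => e d1 d0.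
  move: (j *: (w1 *m _)) (j *: (w0 *m _)) (w1 *m _ *m I) (w0 *m _ *m I).
  by move=> y1 y0 z1 z0; apply/rowP => k; rewrite !mxE; ring.
have XJI : X *m J *m I = - (X *m I *m J).
  by rewrite -mulmxA JI mulmxN mulmxA.
rewrite YX XJI => DJ.
have {}DJ : D *m J = X *m I *m J - j *: (X *m J).
  apply/eqP; rewrite -subr_eq0 -[X in _ == X]DJ; apply/eqP.
  move: (D *m J) (X *m I *m J) (j *: _) => a b c.
  by apply/rowP => k; rewrite !mxE; ring.
have -> : D = - (D *m J *m J).
  by rewrite -mulmxA J2 mulmxN mulmx1 opprK.
rewrite DJ mulmxBl -scalemxAl -!(mulmxA _ J J) J2 !mulmxN !mulmx1 scalerN.
rewrite mulmxDr mulmx1 -scalemxAr; move: (X *m I) => Z; move: (X : 'rV[F]_m) => X'.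
by apply/rowP => k; rewrite !mxE; ring: j2.
Qed.
End NijenhuisAlgebra.

Section MatrixDerivative.
Context {R : realType} {m : nat} {M : manifold R m}.
Local Notation C := R[i].
Variables (c : chart M) (x : 'rV[R]_m).
Hypothesis cx : cdom c x.
Local Open Scope classical_set_scope.

Definition dmx p q (A : 'rV[R]_m -> 'M[C]_(p, q)) (a : 'rV[C]_m) : 'M[C]_(p, q) :=
  \matrix_(i, j) deriveC (fun y => A y i j) x a.

Lemma dmxE p q (A : 'rV[R]_m -> 'M[C]_(p, q)) a i j :
  dmx A a i j = deriveC (fun y => A y i j) x a.
Proof. exact: mxE. Qed.

Lemma smooth_cmx_diff p q (A : 'rV[R]_m -> 'M[C]_(p, q)) i j :
  smooth_cmx c A -> differentiableC (fun y => A y i j) x.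
Proof. by move=> sA; exact: smoothC_differentiable (sA i j) cx. Qed.

Lemma dmx_comb p q (A : 'rV[R]_m -> 'M[C]_(p, q)) s t a b : smooth_cmx c A ->
  dmx A (s *: a + t *: b) = s *: dmx A a + t *: dmx A b.
Proof.
move=> sA; apply/matrixP => i j.
rewrite dmxE [RHS]mxE [X in _ = X + _]mxE [X in _ = _ + X]mxE !dmxE.
exact: (deriveC_comb s t a b (smooth_cmx_diff i j sA)).
Qed.

Lemma dmxZ p q (A : 'rV[R]_m -> 'M[C]_(p, q)) s a : smooth_cmx c A ->
  dmx A (s *: a) = s *: dmx A a.
Proof.
by move=> sA; have := dmx_comb s 0 a 0 sA; rewrite !scale0r !addr0.
Qed.

Lemma dmxM p q r (A : 'rV[R]_m -> 'M[C]_(p, q)) (B : _ -> 'M[C]_(q, r)) a :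
  smooth_cmx c A -> smooth_cmx c B ->
  dmx (fun y => A y *m B y) a = dmx A a *m B x + A x *m dmx B a.
Proof.
move=> sA sB; apply/matrixP => i j; rewrite !mxE -big_split /=.
under eq_fun do rewrite mxE.
rewrite deriveC_sum => [|k _]; last first.
  by apply: differentiableCM; exact: smooth_cmx_diff.
apply: eq_bigr => k _; rewrite deriveCM; try exact: smooth_cmx_diff.
by rewrite !mxE addrC; congr (_ + _); exact: mulrC.
Qed.

Lemma dmx_near p q (A B : 'rV[R]_m -> 'M[C]_(p, q)) a :
  (forall y, cdom c y -> A y = B y) -> dmx A a = dmx B a.
Proof.
move=> AB; apply/matrixP => i j; rewrite !mxE; apply: deriveC_near.
by apply: (cdom_near cx) => y /AB ->.
Qed.

Lemma dmx_cst p q (A : 'M[C]_(p, q)) a : dmx (fun=> A) a = 0.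
Proof. by apply/matrixP => i j; rewrite !mxE deriveC_cst. Qed.

Lemma dmxD p q (A B : 'rV[R]_m -> 'M[C]_(p, q)) a :
  smooth_cmx c A -> smooth_cmx c B ->
  dmx (fun y => A y + B y) a = dmx A a + dmx B a.
Proof.
move=> sA sB; apply/matrixP => i j; rewrite !mxE.
under eq_fun do rewrite mxE.
by rewrite deriveCD //; exact: smooth_cmx_diff.
Qed.

Lemma dmx_scale p q (A : 'rV[R]_m -> 'M[C]_(p, q)) s a :
  smooth_cmx c A -> dmx (fun y => s *: A y) a = s *: dmx A a.
Proof.
move=> sA; apply/matrixP => i j; rewrite !mxE.
under eq_fun do rewrite mxE.
rewrite deriveCM; [|exact: differentiableC_cst|exact: smooth_cmx_diff].
by rewrite deriveC_cst mulr0 addr0.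
Qed.

Lemma dmx_pi01 (I : 'rV[R]_m -> 'M[R]_m) a : smooth_mx (cdom c) I ->
  dmx (fun y => pi01 (I y)) a = (2^-1 * 'i%C) *: dmx (fun y => cmx (I y)) a.
Proof.
move=> sI; have sIc := smooth_cmx_real sI.
apply/matrixP => i j; rewrite !mxE.
have E y : pi01 (I y) i j = 2^-1 * (i == j)%:R + 2^-1 * 'i%C * cmx (I y) i j.
  by rewrite !mxE; ring.
under eq_fun do rewrite E.
have dI := smooth_cmx_diff i j sIc.
rewrite deriveCD; [|exact: differentiableC_cst|]; last first.
  by apply: differentiableCM => //; exact: differentiableC_cst.
rewrite deriveC_cst add0r deriveCM; [|exact: differentiableC_cst|exact: dI].
by rewrite deriveC_cst mulr0 addr0.
Qed.

Lemma eq_linear_real (f : 'rV[C]_m -> 'rV[C]_m) :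
  (forall s t a b, f (s *: a + t *: b) = s *: f a + t *: f b) ->
  (forall u, f (cmx u) = 0) -> forall a, f a = 0.
Proof.
move=> fl fr a.
have -> : a = 1 *: cmx (map_mx (@complex.Re R) a) +
              'i%C *: cmx (map_mx (@complex.Im R) a).
  apply/rowP => k; rewrite !mxE; apply: complex_eq.
    by rewrite cReD !cReM /=; ring.
  by rewrite cImD !cImM /=; ring.
by rewrite fl !fr !scaler0 addr0.
Qed.

Definition nijC (A : 'rV[R]_m -> 'M[R]_m) : 'rV[C]_m -> 'rV[C]_m -> 'rV[C]_m :=
  nij_form (cmx (A x)) (dmx (fun y => cmx (A y))).

Lemma nijC_eq0 (A : 'rV[R]_m -> 'M[R]_m) : smooth_mx (cdom c) A ->
  (forall X Y : 'rV[R]_m -> 'rV[R]_m,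
     smooth_mx (cdom c) X -> smooth_mx (cdom c) Y -> nijenhuis A X Y x = 0) ->
  forall a b, nijC A a b = 0.
Proof.
move=> sA nA; have sAc := smooth_cmx_real sA.
pose DR (w : 'rV[R]_m) : 'M[R]_m := \matrix_(i, j) 'D_w (fun y => A y i j) x.
have DE w : dmx (fun y => cmx (A y)) (cmx w) = cmx (DR w).
  apply/matrixP => i j; rewrite !mxE -deriveC_real; apply: deriveC_near.
  by apply: (cdom_near cx) => y _; rewrite mxE.
have dA v w : 'D_w (fun y => v *m A y) x = v *m DR w.
  have dAij i j : derivable (fun y => A y i j) x w.
    by apply: diff_derivable; exact: smooth_differentiable (sA i j) cx.
  have E i j : (fun y => (v *m A y) i j) = \sum_(k < m) (fun y => v i k * A y k j).
    by apply/funext => y; rewrite mxE fct_sumE.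
  have dk i j k : derivable (fun y => v i k * A y k j) x w.
    by apply: derivableM => //; exact: derivable_cst.
  rewrite derive_mx; last first.
    by apply/derivable_mxP => i j; rewrite E; apply: derivable_sum.
  apply/matrixP => i j; rewrite !mxE E derive_sum //.
  apply: eq_bigr => k _; rewrite mxE.
  have := @deriveM _ _ (cst (v i k)) (fun y => A y k j) x w.
  by move=> -> //; rewrite derive_cst scaler0 addr0.
have real u v : nijC A (cmx u) (cmx v) = 0.
  have := nA (cst u) (cst v) (fun i j => smooth_cst _ _) (fun i j => smooth_cst _ _).
  rewrite /nijenhuis /bracket /= !dA !derive_cst !subr0 !sub0r mulNmx opprK.
  rewrite /nijC /nij_form -!cmxM !DE -!cmxM.
  move=> H; transitivity (cmx (v *m DR (u *m A x) - u *m DR (v *m A x)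
     + u *m DR v *m A x - v *m DR u *m A x)).
    by rewrite /cmx !map_mxB map_mxD map_mxB.
  by rewrite H /cmx map_mx0.
have DL s t a b := dmx_comb s t a b sAc.
move=> a b; apply: (eq_linear_real (f := fun a => nijC A a b)) => [s t a1 a2|u].
  exact: nij_form_linear.
rewrite /nijC nij_formC; apply/eqP; rewrite oppr_eq0; apply/eqP.
apply: (eq_linear_real (f := fun b => nijC A b (cmx u))) => [s t a1 a2|v].
  exact: nij_form_linear.
exact: real.
Qed.

End MatrixDerivative.

Section PointwiseOmega.
Context {R : realType} {m : nat}.
Local Notation C := R[i].
Variables I J K g : 'M[R]_m.
Hypotheses (I2 : I *m I = - 1%:M) (J2 : J *m J = - 1%:M).
Hypotheses (IJ : I *m J = K) (JI : J *m I = - K).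
Hypotheses (gs : g^T = g) (gI : I *m g *m I^T = g) (gJ : J *m g *m J^T = g).
Local Notation p := (pi10 I).
Local Notation q := (pi01 I).
Local Notation Jc := (cmx J).

Lemma RmxE : Rmx I J = p - p *m Jc.
Proof. by rewrite /Rmx /scalJ mulmxDr scaleN1r scale1r mulmxN mulmx1 addrC. Qed.

Lemma Rmx_mul_pi10 : Rmx I J *m p = p.
Proof.
rewrite RmxE mulmxBl pi10_idem // -mulmxA (J_pi10 IJ JI) mulmxA pi10_pi01 //.
by rewrite mul0mx subr0.
Qed.

Lemma Rmx_mul_pi01 : Rmx I J *m q = - (p *m Jc).
Proof.
rewrite RmxE mulmxBl pi10_pi01 // -mulmxA (J_pi01 IJ JI) mulmxA pi10_idem //.
by rewrite sub0r.
Qed.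

Lemma row_J_I (w : 'rV[C]_m) (a : C) : w *m cmx I = a *: w ->
  w *m Jc *m cmx I = - a *: (w *m Jc).
Proof.
by move=> wI; rewrite -mulmxA (cmxJI IJ JI) mulmxN mulmxA wI -scalemxAl scaleNr.
Qed.

Lemma pullback_fundamental_form v :
  fundamental_form I g (v *m Rmx I J) =
  - 'i%C * - (gC g (row ord0 v) (row ord_max v *m Jc)
     - 'i%C * gC g (row ord0 v) (row ord_max v *m cmx K)).
Proof.
have i2 : ('i%C : C) ^+ 2 = -1 by rewrite sqrCi.
have i2' : (- 'i%C : C) ^+ 2 = -1 by rewrite sqrrN sqrCi.
rewrite /fundamental_form !row_mul.
set X := row ord0 v; set Y := row ord_max v.
have wI (Z : 'rV[C]_m) : Z *m p *m cmx I = 'i%C *: (Z *m p).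
  exact: row_pi10_I.
set w0 := X *m p; set w1 := Y *m p.
have w0I : w0 *m cmx I = 'i%C *: w0 := wI X.
have w1I : w1 *m cmx I = 'i%C *: w1 := wI Y.
have w0JI := row_J_I w0I; have w1JI := row_J_I w1I.
have g00 : gC g w0 w1 = 0 := gC_eigen gI w0I w1I i2.
have gJJ : gC g (w0 *m Jc) (w1 *m Jc) = 0 := gC_eigen gI w0JI w1JI i2'.
have gJ0 : gC g (w0 *m Jc) w1 = - gC g w0 (w1 *m Jc) := gC_skew J2 gJ w0 w1.
have Xq : gC g (X *m q) (w1 *m Jc) = 0.
  exact: (gC_eigen gI (row_pi01_I I2 X) w1JI i2').
have gX : gC g X (w1 *m Jc) = gC g w0 (w1 *m Jc).
  have -> : X = 1 *: w0 + 1 *: (X *m q).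
    by rewrite !scale1r -mulmxDr pi10D01 mulmx1.
  by rewrite (gCDl g w0 (X *m q)) Xq mulr0 addr0 mul1r.
have gXY : gC g X (Y *m Jc) - 'i%C * gC g X (Y *m cmx K) = 2 * gC g w0 (w1 *m Jc).
  have p2 : 2 *: p = 1%:M - 'i%C *: cmx I.
    by rewrite /pi10 scalerA mulfV ?pnatr_eq0 // scale1r.
  have E : 2 *: (w1 *m Jc) = 1 *: (Y *m Jc) + - 'i%C *: (Y *m cmx K).
    rewrite /w1 scalemxAl scalemxAr p2 (cmxK IJ) mulmxBr mulmx1 mulmxBl.
    by rewrite -scalemxAr -scalemxAl mulmxA scale1r scaleNr.
  transitivity (gC g X (2 *: (w1 *m Jc))); last by rewrite gCZr gX.
  by rewrite E gCDr mul1r mulNr.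
rewrite gXY.
have -> : X *m Rmx I J = 1 *: w0 + -1 *: (w0 *m Jc).
  by rewrite RmxE mulmxBr mulmxA scale1r scaleN1r.
have -> : Y *m Rmx I J *m cmx I = 'i%C *: w1 + 'i%C *: (w1 *m Jc).
  rewrite RmxE mulmxBr mulmxBl mulmxA -/w1 w1I w1JI scaleNr opprK.
  by [].
rewrite gCDl !gCDr g00 gJJ gJ0.
by move: (gC g w0 _) => z; ring.
Qed.

End PointwiseOmega.

Section PointwiseHessian.
Context {R : realType} {m : nat} {M : manifold R m}.
Local Notation C := R[i].
Variables (I J K : field M 'M[R]_m) (phi : M -> R) (c : chart M) (x : 'rV[R]_m).
Hypotheses (sphi : smooth_fun phi) (cx : cdom c x).
Local Open Scope classical_set_scope.

Definition pder k (y : 'rV[R]_m) : C := deriveC (loc phi c) y (delta_mx 0 k).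

Lemma smoothC_pder k : smoothC (cdom c) (pder k).
Proof. by apply: smoothC_deriveC; [exact: cdom_open|exact: smoothC_loc]. Qed.

Definition hess (a b : 'rV[C]_m) : C := \sum_k b 0 k * deriveC (pder k) x a.

Definition dphi (b : 'rV[C]_m) : C := \sum_k b 0 k * pder k x.

Lemma hess0 a : hess a 0 = 0.
Proof. by rewrite /hess big1 // => k _; rewrite mxE mul0r. Qed.

Lemma dphi_comb s t a b : dphi (s *: a + t *: b) = s * dphi a + t * dphi b.
Proof.
rewrite /dphi !mulr_sumr -big_split; apply: eq_bigr => k _ /=.
by rewrite !mxE mulrDl !mulrA.
Qed.

Lemma deriveC_coef (A : 'rV[R]_m -> 'M[C]_m) a b : smooth_cmx c A ->
  deriveC (fun y => \sum_k (b *m A y) 0 k * pder k y) x a =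
  hess a (b *m A x) + dphi (b *m dmx x A a).
Proof.
move=> sA; have sbA := smooth_cmxM (smooth_cmx_cst c b) sA.
have dk k := smoothC_differentiable (smoothC_pder k) cx.
have dbA k := smooth_cmx_diff cx 0 k sbA.
rewrite deriveC_sum => [|k _]; last exact: differentiableCM.
rewrite /hess /dphi -big_split; apply: eq_bigr => k _ /=.
rewrite deriveCM //; congr (_ + _); rewrite mulrC; congr (_ * _).
rewrite -[LHS](dmxE x (fun y => b *m A y) a 0 k) (dmxM cx _ (smooth_cmx_cst c b) sA).
by rewrite dmx_cst mul0mx add0r.
Qed.

Lemma ext_d_coef (al : dform M 1) (A : 'rV[R]_m -> 'M[C]_m) v : smooth_cmx c A ->
  (forall y b, cdom c y -> al c y b = \sum_k (b *m A y) 0 k * pder k y) ->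
  ext_d al c x v =
  hess (row ord0 v) (row ord_max v *m A x) +
  dphi (row ord_max v *m dmx x A (row ord0 v)) -
  (hess (row ord_max v) (row ord0 v *m A x) +
   dphi (row ord0 v *m dmx x A (row ord_max v))).
Proof.
move=> sA alE; rewrite /ext_d big_ord_recl big_ord1 /= expr0 mul1r expr1 mulN1r.
have lmax : lift ord0 ord0 = ord_max :> 'I_2 by exact: val_inj.
have E (b : 'M[C]_(1, m)) a : deriveC (fun y => al c y b) x a =
    hess a (b *m A x) + dphi (b *m dmx x A a).
  rewrite -deriveC_coef //; apply: deriveC_near.
  by apply: (cdom_near cx) => y cy; exact: alE.
rewrite !E lmax.
have -> : row' ord0 v = row ord_max v :> 'M[C]_(1, m).
  by apply/matrixP => i j; rewrite !mxE ord1 lmax.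
have -> : row' ord_max v = row ord0 v :> 'M[C]_(1, m).
  by apply/matrixP => i j; rewrite !mxE ord1; congr (v _ _); exact: val_inj.
by [].
Qed.

Lemma delbar_funE y b : cdom c y ->
  delbar I 0 0 (fun_form phi) c y b = \sum_k (b *m pi01 (I c y)) 0 k * pder k y.
Proof.
move=> cy; rewrite /delbar pq_part_0k /pullback ext_d_fun.
rewrite deriveC_sum_delta; last first.
  exact: smoothC_differentiable (smoothC_loc c sphi) cy.
by apply: eq_bigr => k _; rewrite mxE.
Qed.

Lemma pq_part11 (A : 'M[R]_m) (al : @cov R m 2) v :
  pq_part A 1 1 al v =
  al (act_rows [set ord_max]%SET (pi01 A) (pi10 A) v) +
  al (act_rows [set ord0]%SET (pi01 A) (pi10 A) v).
Proof.
rewrite /pq_part (bigD1 [set ord_max]%SET) /=; last first.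
  by rewrite cardsCs finset.setCK !cards1 card_ord.
rewrite (bigD1 [set ord0]%SET) /=; last first.
  rewrite cardsCs finset.setCK !cards1 card_ord /=.
  by apply/eqP => /setP/(_ ord0); rewrite !inE.
rewrite big1 ?addr0 // => S /andP[/andP[/andP[_ /cards1P[i ->]]]].
by case: (ord2P i) => ->; rewrite eqxx.
Qed.

End PointwiseHessian.

Section PointwiseIdentity.
Context {R : realType} {m : nat} {M : manifold R m}.
Local Notation C := R[i].
Variables (I J K : field M 'M[R]_m) (phi : M -> R) (c : chart M) (x : 'rV[R]_m).
Hypotheses (sphi : smooth_fun phi) (cx : cdom c x).
Hypotheses (hc : hypercomplex I J K).
Local Open Scope classical_set_scope.

Let sI : smooth_mx (cdom c) (I c). Proof. by case: hc => -[[]]. Qed.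
Let sJ : smooth_mx (cdom c) (J c). Proof. by case: hc => _ [[]]. Qed.
Let I2 y : cdom c y -> I c y *m I c y = - 1%:M.
Proof. by case: hc => -[_ H _] *; apply: H. Qed.
Let J2 y : cdom c y -> J c y *m J c y = - 1%:M.
Proof. by case: hc => _ [_ H _] *; apply: H. Qed.
Let IJ y : cdom c y -> I c y *m J c y = K c y.
Proof. by case: hc => _ _ _ H cy; case: (H c y cy). Qed.
Let JI y : cdom c y -> J c y *m I c y = - K c y.
Proof. by case: hc => _ _ _ H cy; case: (H c y cy). Qed.

Let dI := dmx x (fun y => cmx (I c y)).
Let dJ := dmx x (fun y => cmx (J c y)).
Let sIc := smooth_cmx_real sI.
Let sJc := smooth_cmx_real sJ.
Local Notation Ix := (cmx (I c x)).
Local Notation Jx := (cmx (J c x)).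
Local Notation p := (pi10 (I c x)).
Local Notation q := (pi01 (I c x)).

Lemma dmx_I_anticomm a : dI a *m Ix = - (Ix *m dI a).
Proof.
apply/eqP; rewrite -addr_eq0 -(dmxM cx a sIc sIc).
by rewrite (dmx_near cx a (B := fun=> - 1%:M)) ?dmx_cst // => y cy; rewrite cmxI2 ?I2.
Qed.

Lemma dmx_IJ a : dI a *m Jx + Ix *m dJ a + dJ a *m Ix + Jx *m dI a = 0.
Proof.
rewrite -addrA -(dmxM cx a sIc sJc) -(dmxM cx a sJc sIc).
rewrite -(dmxD cx a (smooth_cmxM sIc sJc) (smooth_cmxM sJc sIc)).
rewrite (dmx_near cx a (B := fun=> 0)) ?dmx_cst // => y cy.
by rewrite (cmxJI (IJ cy) (JI cy)) addrN.
Qed.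

Lemma nij_I a b : nijC x (I c) a b = 0.
Proof.
apply: (nijC_eq0 cx sI) => X Y sX sY.
by case: hc => -[_ _ H] _ _ _; exact: H.
Qed.

Lemma nij_J a b : nijC x (J c) a b = 0.
Proof.
apply: (nijC_eq0 cx sJ) => X Y sX sY.
by case: hc => _ [_ _ H] _ _; exact: H.
Qed.

Lemma hypercomplex_torsion (r0 r1 : 'rV[C]_m) :
  let w0 := r0 *m p in let w1 := r1 *m p in
  (2^-1 * 'i%C) *: (w1 *m dI (w0 *m Jx) - w0 *m dI (w1 *m Jx)) =
  (w1 *m dJ w0 - w0 *m dJ w1) *m q.
Proof.
move=> w0 w1.
have i2 : ('i%C : C) ^+ 2 = -1 by rewrite sqrCi.
have two : 2 != 0 :> C by rewrite pnatr_eq0.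
have H := nijenhuis_algebra i2 two (cmxI2 (J2 cx)) (cmxJI (IJ cx) (JI cx))
  dmx_I_anticomm dmx_IJ (fun s a => dmxZ cx s a sIc)
  (row_pi10_I (I2 cx) r0) (row_pi10_I (I2 cx) r1)
  (nij_J _ _) (nij_I _ _).
rewrite -scalerA; apply: etrans (congr1 (fun z => 2^-1 *: z) H) _.
exact: scalemxAr.
Qed.

Lemma invmxJ y : cdom c y -> invmx (J c y) = - J c y.
Proof.
move=> cy; have JJ : J c y *m - J c y = 1%:M by rewrite mulmxN J2 // opprK.
have [uJ _] := mulmx1_unit JJ.
by rewrite -[LHS]mulmx1 -JJ mulmxA mulVmx // mul1mx.
Qed.

Definition delJ_coef y : 'M[C]_m := (-1 *: cmx (J c y)) *m pi01 (I c y).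

Lemma delJ_funE y b : cdom c y ->
  delJ I J 0 (fun_form phi) c y b =
  \sum_k (b *m delJ_coef y) 0 k * pder phi c k y.
Proof.
move=> cy; transitivity (delbar I 0 0 (fun_form phi) c y
    (b *m cmx (invmx (J c y)))); first by [].
have -> : cmx (invmx (J c y)) = -1 *: cmx (J c y).
  by rewrite invmxJ // /cmx map_mxN scaleN1r.
by rewrite delbar_funE // /delJ_coef mulmxA.
Qed.

Lemma smooth_delJ_coef : smooth_cmx c delJ_coef.
Proof.
apply: smooth_cmxM; last exact: smooth_pi01.
move=> i j; under eq_fun do rewrite mxE.
by apply: smoothCM; [exact: cdom_open|exact: smoothC_cst|exact: sJc].
Qed.

Lemma dmx_delJ_coef a : dmx x delJ_coef a =
  - (dJ a *m q) - (2^-1 * 'i%C) *: (Jx *m dI a).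
Proof.
rewrite (dmxM cx); [|by move=> i j; under eq_fun do rewrite mxE; apply: smoothCM;
  [exact: cdom_open|exact: smoothC_cst|exact: sJc]|exact: smooth_pi01].
rewrite (dmx_pi01 cx a sI) (dmx_scale cx (-1) a sJc) !scaleN1r mulNmx; congr (_ + _).
by rewrite mulNmx -scalemxAr.
Qed.

Lemma pullback_ddbar v :
  ddbar I phi c x (v *m Rmx (I c x) (J c x)) = ddJ I J phi c x v.
Proof.
have I2x := I2 cx; have IJx := IJ cx; have JIx := JI cx.
have [P [sP PE dPE Px]] : exists P : 'rV[R]_m -> 'M[C]_m, [/\ smooth_cmx c P,
    forall y b, cdom c y -> delbar I 0 0 (fun_form phi) c y b =
      \sum_k (b *m P y) 0 k * pder phi c k y,
    forall a, dmx x P a = (2^-1 * 'i%C) *: dI a & P x = q].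
  exists (fun y => pi01 (I c y)); split=> //; first exact: smooth_pi01.
    by move=> y b cy; exact: delbar_funE.
  by move=> a; exact: (dmx_pi01 cx a sI).
have [A [sA AE dAE Ax]] : exists A : 'rV[R]_m -> 'M[C]_m, [/\ smooth_cmx c A,
    forall y b, cdom c y -> delJ I J 0 (fun_form phi) c y b =
      \sum_k (b *m A y) 0 k * pder phi c k y,
    forall a, dmx x A a = - (dJ a *m q) - (2^-1 * 'i%C) *: (Jx *m dI a) &
    A x = (-1 *: Jx) *m q].
  exists delJ_coef; split=> //; first exact: smooth_delJ_coef.
    exact: delJ_funE.
  exact: dmx_delJ_coef.
have EA w := ext_d_coef sphi cx w sP PE.
have EB w := ext_d_coef sphi cx w sA AE.
set r0 := row ord0 v; set r1 := row ord_max v.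
set w0 := r0 *m p; set w1 := r1 *m p.
have -> : ddJ I J phi c x v = ext_d (delJ I J 0 (fun_form phi)) c x (v *m p).
  by rewrite /ddJ /del pq_part_k0.
have -> : ddbar I phi c x (v *m Rmx (I c x) (J c x)) =
    ext_d (delbar I 0 0 (fun_form phi)) c x
      (act_rows [set ord_max]%SET q p (v *m Rmx (I c x) (J c x))) +
    ext_d (delbar I 0 0 (fun_form phi)) c x
      (act_rows [set ord0]%SET q p (v *m Rmx (I c x) (J c x))).
  exact: pq_part11.
have R0 w : w *m Rmx (I c x) (J c x) *m p = w *m p :> 'rV[C]_m.
  by rewrite -mulmxA (Rmx_mul_pi10 I2x IJx JIx).
have R1 w : w *m Rmx (I c x) (J c x) *m q = - (w *m p *m Jx) :> 'rV[C]_m.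
  by rewrite -mulmxA (Rmx_mul_pi01 I2x IJx JIx) mulmxN mulmxA.
apply: etrans (f_equal2 (fun a b : C => a + b) (EA _) (EA _)) _.
apply: etrans _ (esym (EB _)).
rewrite !row_act_rows !row_mul.
rewrite !finset.in_set1 !eqxx /=.
rewrite -/r0 -/r1 (R0 r0) (R0 r1) (R1 r0) (R1 r1) -/w0 -/w1.
have P0 (w : 'rV[C]_m) : w *m p *m q = 0.
  by rewrite -mulmxA pi10_pi01 // mulmx0.
have LD a b : dphi phi c x (a + b) = dphi phi c x a + dphi phi c x b.
  by have := dphi_comb phi c x 1 1 a b; rewrite !scale1r !mul1r.
have LZ s a : dphi phi c x (s *: a) = s * dphi phi c x a.
  by have := dphi_comb phi c x s 0 a 0; rewrite scale0r addr0 mul0r addr0.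
have LN a : dphi phi c x (- a) = - dphi phi c x a.
  by rewrite -scaleN1r LZ mulN1r.
pose h : C := 2^-1 * 'i%C.
have dIN a : dI (- a) = - dI a.
  by rewrite -scaleN1r /dI (dmxZ cx (-1) a sIc) scaleN1r.
have dP (w a : 'rV[C]_m) : dphi phi c x (w *m dmx x P a) =
    h * dphi phi c x (w *m dI a).
  by rewrite dPE -scalemxAr LZ.
have dB (w a : 'rV[C]_m) : dphi phi c x (w *m dmx x A a) =
    - dphi phi c x (w *m dJ a *m q) - h * dphi phi c x (w *m Jx *m dI a).
  rewrite dAE mulmxBr mulmxN LD !LN -!mulmxA -LZ.
  by rewrite (scalemxAr h w).
have hB (w : 'rV[C]_m) : w *m A x = - (w *m Jx) *m q.
  by rewrite Ax scaleN1r !mulNmx mulmxN mulmxA.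
have T : h * (dphi phi c x (w1 *m dI (w0 *m Jx)) -
              dphi phi c x (w0 *m dI (w1 *m Jx))) =
    dphi phi c x (w1 *m dJ w0 *m q) - dphi phi c x (w0 *m dJ w1 *m q).
  by rewrite -LN -LD -LZ hypercomplex_torsion mulmxBl LD LN.
have alg (H1 H2 A1 A2 A3 A4 B1 B2 t1 t2 t3 t4 t5 t6 t7 t8 s1 s2 s3 s4 : C) :
  h * (A3 - A2) = B1 - B2 -> t1 = H1 -> t2 = h * - A1 -> t3 = 0 ->
  t4 = h * - A2 -> t5 = 0 -> t6 = h * - A3 -> t7 = H2 -> t8 = h * - A4 ->
  s1 = H1 -> s2 = - B1 - h * A1 -> s3 = H2 -> s4 = - B2 - h * A4 ->
  t1 + t2 - (t3 + t4) + (t5 + t6 - (t7 + t8)) = s1 + s2 - (s3 + s4).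
  move=> E -> -> -> -> -> -> -> -> -> -> -> ->.
  have -> : B1 = h * (A3 - A2) + B2 by rewrite E subrK.
  by ring.
apply: (alg (hess phi c x w0 (- (w1 *m Jx) *m q))
            (hess phi c x w1 (- (w0 *m Jx) *m q)) _ _ _ _ _ _
            _ _ _ _ _ _ _ _ _ _ _ _ T).
- by rewrite Px.
- by rewrite dP mulNmx LN.
- by rewrite Px (P0 r0) hess0.
- by rewrite dP dIN mulmxN LN.
- by rewrite Px (P0 r1) hess0.
- by rewrite dP dIN mulmxN LN.
- by rewrite Px.
- by rewrite dP mulNmx LN.
- by rewrite hB.
- exact: dB.
- by rewrite hB.
- exact: dB.
Qed.

End PointwiseIdentity.

(** * The Monge-Ampere equations *)

Section Conjugation.
Context {R : realType} {m : nat}.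
Local Notation C := R[i].
Variable I : 'M[R]_m.
Hypothesis I2 : I *m I = - 1%:M.

Lemma conjmxK p q (v : 'M[C]_(p, q)) : conjmx (conjmx v) = v.
Proof. by apply/matrixP => i j; rewrite !mxE conjcK. Qed.

Lemma conjmxM p q r (A : 'M[C]_(p, q)) (B : 'M[C]_(q, r)) :
  conjmx (A *m B) = conjmx A *m conjmx B.
Proof. exact: map_mxM. Qed.

Lemma cov_conj k (al : @cov R m k) : is_cov al -> is_cov (conj_cov al).
Proof.
move=> [mal aal]; split.
  move=> i u v w a b Eu Ev Ew; rewrite /conj_cov.
  have E u' : row' i u' = row' i u -> row' i (conjmx u') = row' i (conjmx u).
    move=> Eu'; apply/matrixP => p q; rewrite !mxE.
    by move/matrixP: Eu' => /(_ p q); rewrite !mxE => ->.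
  rewrite (mal i _ (conjmx v) (conjmx w) (conjc a) (conjc b)) ?E //.
    by rewrite rmorphD !rmorphM /= !conjcK.
  apply/rowP => j; move/rowP: Eu => /(_ j); rewrite !mxE => ->.
  by rewrite rmorphD !rmorphM.
move=> v i j ij E; rewrite /conj_cov (aal _ i j) ?conjc0 //.
by apply/rowP => l; move/rowP: E => /(_ l); rewrite !mxE => ->.
Qed.

Lemma conj_cov_pq k (al : @cov R m k) : is_pq I k 0 al ->
  is_pq I 0 k (conj_cov al).
Proof.
move=> [cal]; rewrite pq_part_k0 => pal; split; first exact: cov_conj.
rewrite pq_part_0k; apply/funext => v; rewrite /pullback /conj_cov.
rewrite conjmxM pi01_conj conjmxK; congr conjc.
by rewrite -[in RHS]pal.
Qed.

Lemma conj_cov_eq0 k (al : @cov R m k) : conj_cov al = (fun=> 0) -> al = (fun=> 0).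
Proof.
move=> E; apply/funext => v; have := congr1 (@^~ (conjmx v)) E.
rewrite /conj_cov conjmxK => /(congr1 conjc); rewrite conjcK => ->.
exact: conjc0.
Qed.

End Conjugation.

Section Assembly.
Context {R : realType} {m : nat} {M : manifold R m}.
Local Notation C := R[i].
Variables (I J K g : field M 'M[R]_m) (phi : M -> R).
Hypotheses (hM : hkt I J K g) (sphi : smooth_fun phi).

Let hc : hypercomplex I J K. Proof. by case: hM. Qed.
Let hg : quaternionic_hermitian I J K g. Proof. by case: hM. Qed.
Let eI : endo_field I. Proof. by case: hc => -[]. Qed.
Let I2 c x : cdom c x -> I c x *m I c x = - 1%:M.
Proof. by case: hc => -[_ H _] *; apply: H. Qed.
Let J2 c x : cdom c x -> J c x *m J c x = - 1%:M.
Proof. by case: hc => _ [_ H _] *; apply: H. Qed.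
Let IJ c x : cdom c x -> I c x *m J c x = K c x.
Proof. by case: hc => _ _ _ H cx; case: (H c x cx). Qed.
Let JI c x : cdom c x -> J c x *m I c x = - K c x.
Proof. by case: hc => _ _ _ H cx; case: (H c x cx). Qed.
Let gs c x : cdom c x -> (g c x)^T = g c x.
Proof. by case: hg => -[_ _ H _] _ *; apply: H. Qed.

Lemma g_inv_I c x : cdom c x -> I c x *m g c x *m (I c x)^T = g c x.
Proof.
move=> cx; have u : @unit_quat R 0 1 0 0 by rewrite /unit_quat !expr0n expr1n /= !addr0 add0r.
by have := hermitian_inv hg cx u; rewrite /= quat_I.
Qed.

Lemma g_inv_J c x : cdom c x -> J c x *m g c x *m (J c x)^T = g c x.
Proof.
move=> cx; have u : @unit_quat R 0 0 1 0 by rewrite /unit_quat !expr0n expr1n /= !addr0 add0r.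
by have := hermitian_inv hg cx u; rewrite /= quat_Jm.
Qed.

Definition omega_phi : dform M 2 :=
  add_form (omegaI I g) (scale_form (fun=> - 'i%C) (ddbar I phi)).

Definition Omega_phi : dform M 2 := add_form (Omega J K g) (ddJ I J phi).

Lemma omegaI_is_form : is_form (omegaI I g).
Proof.
apply: is_form_omegaI => //; [by case: hg|exact: g_inv_I].
Qed.

Lemma omegaI_pq c x : cdom c x -> is_pq (I c x) 1 1 (omegaI I g c x).
Proof.
move=> cx; exact: (fundamental_form_pq (I2 cx) (gs cx) (g_inv_I cx)).
Qed.

Lemma omega_phi_is_form : is_form omega_phi.
Proof.
apply: is_form_add; first exact: omegaI_is_form.
exact: is_form_scale (is_form_ddbar eI sphi).
Qed.

Lemma omega_phi_pq c x : cdom c x -> is_pq (I c x) 1 1 (omega_phi c x).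
Proof.
move=> cx; exact: (is_pq_comb _ (I2 cx) (omegaI_pq cx) (ddbar_pq eI sphi cx (I2 cx))).
Qed.

Lemma pow_Lambda (al : dform M 2) n : is_form al ->
  (forall c x, cdom c x -> is_pq (I c x) 1 1 (al c x)) ->
  Lambda I n n (pow_form al n).
Proof.
move=> fal pal; split; first exact: is_form_pow.
move=> c x cx; have := wedge_prod_pq (I2 cx) n (fun=> pal c x cx).
by rewrite !muln1.
Qed.

Lemma Rmx_omegaI c x : cdom c x ->
  pullback (Rmx (I c x) (J c x)) (omegaI I g c x) =
  fun v => - 'i%C * Omega J K g c x v.
Proof.
move=> cx; apply/funext => v.
exact: (pullback_fundamental_form (I2 cx) (J2 cx) (IJ cx) (JI cx)
  (g_inv_I cx) (g_inv_J cx)).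
Qed.

Lemma Rmx_omega_phi c x : cdom c x ->
  pullback (Rmx (I c x) (J c x)) (omega_phi c x) =
  fun v => - 'i%C * Omega_phi c x v.
Proof.
move=> cx; apply/funext => v.
rewrite /Omega_phi /add_form mulrDr -(pullback_ddbar sphi cx hc).
congr (_ + _); exact: (congr1 (@^~ v) (Rmx_omegaI cx)).
Qed.

Lemma wedge_pow_Phi n (Theta Phi : dform M (n * 2)) (om Om : dform M 2) c x v :
  (forall xi : dform M (n * 2), Lambda I n n xi ->
     form_eq (wedge_form Phi xi)
             (wedge_form (R_form I J K n xi) (conj_form Theta))) ->
  is_form om -> (forall c x, cdom c x -> is_pq (I c x) 1 1 (om c x)) ->
  cdom c x -> 
  pullback (Rmx (I c x) (J c x)) (om c x) = (fun v => - 'i%C * Om c x v) ->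
  wedge_form (pow_form om n) Phi c x v =
  (-1) ^+ (ord_swap (n * 2)) * ((- 'i%C) ^+ n *
    wedge (pow_form Om n c x) (conj_cov (Theta c x)) v).
Proof.
move=> hPhi fom pom cx RE.
have Lom := pow_Lambda n fom pom.
have E : R_form I J K n (pow_form om n) c x =
    fun v => (- 'i%C) ^+ n * pow_form Om n c x v.
  have [_ /(_ c x cx) pq] := Lom.
  have nn : (n + n = n * 2)%N by rewrite addnn muln2.
  rewrite /R_form (RopE (I2 cx) (J2 cx) (IJ cx) (JI cx) nn pq).
  by rewrite /pow_form -wedge_prod_pullback RE wedge_prod_scale.
have := congr1 (@^~ v) (hPhi _ Lom c x cx).
rewrite /wedge_form E /conj_form wedge_scalel => <-.
by rewrite wedge_swap.
Qed.

Lemma Om_pq (om Om : dform M 2) c x : cdom c x -> is_cov (om c x) ->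
  pullback (Rmx (I c x) (J c x)) (om c x) = (fun v => - 'i%C * Om c x v) ->
  is_pq (I c x) 2 0 (Om c x).
Proof.
move=> cx com RE.
have -> : Om c x = fun v => 'i%C * pullback (Rmx (I c x) (J c x)) (om c x) v.
  apply/funext => v; rewrite RE mulrA mulrN -expr2 sqrCi opprK mul1r.
  by [].
have [cp pp] := pullback_Rmx_pq (J c x) (I2 cx) com.
split; first exact: cov_scale.
rewrite pq_part_k0 in pp; rewrite pq_part_k0; apply/funext => v.
exact: (congr1 (fun be : cov 2 => 'i%C * be v) pp).
Qed.

End Assembly.

Theorem theorem3p9 (R : realType) (n : nat) (M : manifold R (4 * n))
  (I J K g : field M 'M[R]_(4 * n)) (hM : hkt I J K g)
  (Theta : dform M (n * 2)) (Theta_hol : holomorphic I (2 * n) Theta)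
  (Theta_nz : nowhere_vanishing Theta)
  (Theta_real : qreal J Theta) (Theta_pos : qpositive I J Theta)
  (Phi : dform M (n * 2)) (Phi_type : Lambda I n n Phi)
  (Phi_def : forall xi : dform M (n * 2), Lambda I n n xi ->
     form_eq (wedge_form Phi xi)
             (wedge_form (R_form I J K n xi) (conj_form Theta)))
  (f phi : M -> R) (f_smooth : smooth_fun f) (phi_smooth : smooth_fun phi) :
  let exp_f : M -> R[i] := fun p => (expR (f p))%:C in
  form_eq (pow_form (add_form (Omega J K g) (ddJ I J phi)) n)
          (scale_form exp_f (pow_form (Omega J K g) n))
  <->
  form_eq (wedge_form
             (pow_form (add_form (omegaI I g)
                                 (scale_form (fun=> - 'i%C) (ddbar I phi))) n)
             Phi)
          (scale_form exp_f (wedge_form (pow_form (omegaI I g) n) Phi)).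
Proof.
move=> exp_f.
have fB := omega_phi_is_form hM phi_smooth.
have pB c x (cx : cdom c x) := omega_phi_pq hM phi_smooth cx.
have fom := omegaI_is_form hM.
have pom c x (cx : cdom c x) := omegaI_pq hM cx.
have EB c x v (cx : cdom c x) := wedge_pow_Phi hM v Phi_def fB pB cx
  (Rmx_omega_phi hM phi_smooth cx).
have Eom c x v (cx : cdom c x) := wedge_pow_Phi hM v Phi_def fom pom cx
  (Rmx_omegaI hM cx).
split=> H c x cx; apply/funext => v.
  apply: etrans (EB c x v cx) _; rewrite /scale_form (Eom c x v cx).
  have alg (s t a b d : R[i]) : a = d * b -> s * (t * a) = d * (s * (t * b)).
    by move=> ->; rewrite (mulrCA t) (mulrCA s).
  apply: alg; apply: etrans (wedge_scalel _ _ _ _).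
  exact: (congr1 (fun al => wedge al (conj_cov (Theta c x)) v) (H c x cx)).
pose e := exp_f (param c x).
pose A := pow_form (Omega_phi I J K g phi) n c x.
pose B := pow_form (Omega J K g) n c x.
have i0 : (- 'i%C) ^+ n != 0 :> R[i].
  by rewrite expf_neq0 // oppr_eq0 neq0Ci.
have I2 : I c x *m I c x = - 1%:M by case: hM => -[[_ H2 _] _ _ _] _ _; exact: H2.
have E w : wedge A (conj_cov (Theta c x)) w =
    e * wedge B (conj_cov (Theta c x)) w.
  have alg (s t a b d : R[i]) : s != 0 -> t != 0 ->
      s * (t * a) = d * (s * (t * b)) -> a = d * b.
    by move=> s0 t0; rewrite (mulrCA d) => /(mulfI s0); rewrite mulrCA => /(mulfI t0).
  have s0 : (-1) ^+ ord_swap (n * 2) != 0 :> R[i] by rewrite signr_eq0.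
  apply: (alg _ _ _ _ _ s0 i0).
  apply: etrans (esym (EB c x w cx)) _.
  have := congr1 (@^~ w) (H c x cx); rewrite /scale_form (Eom c x w cx).
  by [].
have pow20 (al : @cov R (4 * n) 2) : is_pq (I c x) 2 0 al ->
    is_pq (I c x) (n * 2) 0 (wedge_prod (fun=> al) n).
  by move=> pal; have := wedge_prod_pq I2 n (fun=> pal); rewrite muln0.
have pA : is_pq (I c x) (n * 2) 0 A.
  have [cB _ _] := fB.
  exact: pow20 (Om_pq hM cx (cB c x cx) (Rmx_omega_phi hM phi_smooth cx)).
have pB' : is_pq (I c x) (n * 2) 0 B.
  have [cB _ _] := fom.
  exact: pow20 (Om_pq hM cx (cB c x cx) (Rmx_omegaI hM cx)).
have pT : is_pq (I c x) 0 (n * 2) (conj_cov (Theta c x)).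
  case: Theta_hol => -[_ /(_ c x cx)] + _; rewrite [in X in is_pq _ X](mulnC 2 n).
  exact: conj_cov_pq.
have [r10 r01] : \rank (pi10 (I c x)) = (n * 2)%N /\ \rank (pi01 (I c x)) = (n * 2)%N.
  by apply: (rank_pi I2); rewrite addnn -muln2 -mulnA mulnC.
have W0 : wedge (fun v => - e * B v + A v) (conj_cov (Theta c x)) = fun=> 0.
  by apply/funext => w; rewrite wedge_combl E mulNr addNr.
have pAB : is_pq (I c x) (n * 2) 0 (fun v => - e * B v + A v).
  have := is_pq_comb (- e) I2 pA pB'; congr is_pq; apply/funext => w.
  exact: addrC.
have [AB|T0] := wedge_eq0 I2 r10 r01 pAB pT W0.
  have := congr1 (@^~ v) AB => /= /eqP; rewrite mulNr addrC subr_eq0 => /eqP.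
  by [].
by case: (Theta_nz c x cx); apply: conj_cov_eq0.
Qed.
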